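(* Let $d\geq 2$, let $p_1<p_2<\dots$ denote the prime numbers in increasing order, and let $\varphi(s)=c_1+\sum_{j=1}^d c_{p_j}p_j^{-s}$ be a Dirichlet polynomial belonging to the Gordon–Hedenmalm class $\mathcal{G}$, with $c_{p_j}\neq 0$ for $j=1,\dots,d$. Then the composition operator $\mathcal{C}_\varphi f=f\circ\varphi$ is bounded on $\mathcal{H}^p$ for every $p\in[1,\infty)$.
   Context: For $1\leq p<\infty$, $\mathcal{H}^p$ is the Banach space completion of the Dirichlet polynomials $P(s)=\sum_{n=1}^N a_n n^{-s}$ with respect to the norm $\|P\|_{\mathcal{H}^p}=\lim_{T\to\infty}\left(\frac{1}{2T}\int_{-T}^T|P(it)|^p\,dt\right)^{1/p}$; its elements are Dirichlet series converging absolutely in $\mathbb{C}_{1/2}$, where $\mathbb{C}_\theta=\{s:\operatorname{Re}s>\theta\}$. The Gordon–Hedenmalm class $\mathcal{G}$ consists of functions $\varphi:\mathbb{C}_{1/2}\to\mathbb{C}_{1/2}$ of the form $\varphi(s)=c_0s+\varphi_0(s)$, $\varphi_0(s)=\sum_{n\ge1}c_nn^{-s}$, where $c_0$ is a non-negative integer, $\varphi_0$ converges uniformly in $\mathbb{C}_\varepsilon$ for every $\varepsilon>0$, and: if $c_0=0$ then $\varphi_0(\mathbb{C}_0)\subset\mathbb{C}_{1/2}$; if $c_0\ge1$ then either $\varphi_0\equiv0$ or $\varphi_0(\mathbb{C}_0)\subset\mathbb{C}_0$. *)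

(* Defs.v *)
From Stdlib Require Import Reals Lra.
From Coquelicot Require Import Coquelicot.
From mathcomp Require ssreflect ssrbool ssrnat prime.

Open Scope R_scope.

Lemma next_prime_ex (m : nat) :
  exists p : nat, andb (ssrnat.leq (S m) p) (prime.prime p) = true.
Proof.
  destruct (prime.prime_above m) as [p H1 H2]. exists p.
  rewrite H1, H2; reflexivity.
Qed.

Definition next_prime (m : nat) : nat :=
  @ssrnat.ex_minn (fun p => andb (ssrnat.leq (S m) p) (prime.prime p)) (next_prime_ex m).

(* nth_prime j = p_j (1-indexed): nth_prime 1 = 2, nth_prime 2 = 3, ... *)
Fixpoint nth_prime (j : nat) : nat :=
  match j with
  | O => 1%nat (* unused junk value *)
  | S j' => next_prime (nth_prime j')
  end.

(* Complex powers n^{-s} = exp(-s log n) for a positive integer n.    *)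

Definition cpow_neg (n : nat) (s : C) : C :=
  let L := ln (INR n) in
  let r := exp (- (Re s) * L) in
  (r * cos (- (Im s) * L), r * sin (- (Im s) * L)).

Definition dir_sum (a : nat -> C) (N : nat) (s : C) : C :=
  sum_n_m (fun n => Cmult (a n) (cpow_neg n s)) 1 N.

Definition is_dirpoly (P : C -> C) : Prop :=
  exists (N : nat) (a : nat -> C), forall s, P s = dir_sum a N s.

Definition rpow (x q : R) : R := if Rle_dec x 0 then 0 else Rpower x q.

Definition hp_norm_poly (p : R) (P : C -> C) : R :=
  rpow (Lim (fun T => / (2 * T) * RInt (fun t => rpow (Cmod (P (0, t))) p) (- T) T)
            p_infty) (/ p).

(* H^p, 1 <= p < oo, is the completion of the Dirichlet polynomials under
   hp_norm_poly; its elements are realized as functions on C_{1/2}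
   (pointwise limits there of H^p-Cauchy sequences of Dirichlet polynomials).
   [in_Hp p f r] : f belongs to H^p and has H^p norm r. *)
Definition in_Hp (p : R) (f : C -> C) (r : R) : Prop :=
  exists Pk : nat -> C -> C,
    (forall k, is_dirpoly (Pk k)) /\
    (forall eps : R, 0 < eps -> exists K : nat, forall k m : nat,
        (K <= k)%nat -> (K <= m)%nat ->
        hp_norm_poly p (fun s => Cminus (Pk k s) (Pk m s)) < eps) /\
    (forall s : C, 1/2 < Re s ->
        filterlim (fun k => Pk k s) eventually (locally (f s))) /\
    is_lim_seq (fun k => hp_norm_poly p (Pk k)) r.

Definition comp_bounded_Hp (p : R) (phi : C -> C) : Prop :=
  exists M : R, forall (f : C -> C) (r : R), in_Hp p f r ->
    exists r' : R, in_Hp p (fun s => f (phi s)) r' /\ r' <= M * r.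

Definition in_GH_class (phi : C -> C) : Prop :=
  exists (c0 : nat) (c : nat -> C) (phi0 : C -> C),
    (forall s : C, 1/2 < Re s -> phi s = Cplus (Cmult (RtoC (INR c0)) s) (phi0 s)) /\
    (forall eps : R, 0 < eps -> forall e : R, 0 < e -> exists N : nat,
        forall M : nat, (N <= M)%nat -> forall s : C, eps < Re s ->
          Cmod (Cminus (dir_sum c M s) (phi0 s)) < e) /\
    ((c0 = 0%nat /\ forall s : C, 0 < Re s -> 1/2 < Re (phi0 s)) \/
     ((1 <= c0)%nat /\
      ((forall s : C, 0 < Re s -> phi0 s = RtoC 0) \/
       (forall s : C, 0 < Re s -> 0 < Re (phi0 s))))).

(* Main.v *)
(* By Bohr's correspondence the [H^p] norm of a Dirichlet polynomial is an [L^p] mean over the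
   characters of the polytorus, which is approximated here by means over finite grids. Membership in
   the Gordon-Hedenmalm class forces [c_0 = 0] and, by Kronecker's theorem,
   [1 / 2 + sum |c_p| <= Re c_1]; near the point where the real part of the symbol is minimal, the
   first two prime variables make [Re phi - 1 / 2] at least a multiple of [t_1 ^ 2 + t_2 ^ 2].
   Writing [p = j q] with [1 <= q < 2] and replacing [f] by [f ^ j], it remains to treat exponents
   below [2]. There a coefficient inequality [sum W(n) |a_n|^2 <= ||f||_q ^ 2] with a multiplicative
   weight [W] embeds [H^q] into a Hilbert space whose kernel grows like [(2 Re s - 1) ^ (- y)],
   [y < 2 / q + 1 / 2]. A dual large sieve along [t_1], followed by a convergent sum over [t_2],
   bounds the mean of [|f o phi|^q]. Finally [f o phi] is a limit of Dirichlet polynomials because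
   [exp u] is the limit of [(1 + u / n) ^ n]. *)

Require Import Defs.
From Stdlib Require Import Reals.
From Coquelicot Require Import Coquelicot.
From Stdlib Require Import Lra Lia.
From Stdlib Require ClassicalEpsilon.
From HB Require Import structures.
From mathcomp Require ssreflect ssrfun ssrbool eqtype ssrnat seq div choice fintype prime bigop.
From mathcomp Require zify.

(** The norm bound must not depend on the polynomial, while all means are over grids with
    [2 * K + 1] points per variable. On the grid the symbol is shifted by [1 / (2 * K + 1)]: this
    keeps it off the boundary line, at a distance matching the grid spacing. The error is
    [O(1 / K)], with a constant that does depend on the polynomial, and it dies in the limit.

    The exponents fit as follows. Near the minimum, the row with |t_2| = Y has about [K Y] points
    with |t_1| <= |t_2|, where [2 Re phi - 1] is at least of order Y^2. The sieve and Hölder give it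
    a mean of order Y^(1 + q/2 - q y), up to an epsilon, which is summable over the rows for y < 2/q
    + 1/2. A coefficient inequality in L^p0 that has weight w_1 on pairs of coefficients allows any
    y > 1/w_1, and w_1 = p0/2 is established for p0 = 1 and p0 = 4/3. The slack 1/2 is the reason
    why two exponents suffice: 2 < 2/q + 1/2 when q < 4/3, and 3/2 < 2/q + 1/2 when q < 2. *)

Module Hardy.

Import ssreflect ssrfun ssrbool eqtype ssrnat seq div choice fintype prime bigop.
Open Scope R_scope.

(** * Real powers and positive functionals *)

Lemma rpow_gt0E x q : 0 < x -> rpow x q = Rpower x q.
Proof. by rewrite /rpow => h; case: Rle_dec => // ?; lra. Qed.

Lemma rpow0 q : rpow 0 q = 0.
Proof. by rewrite /rpow; case: Rle_dec => // ?; lra. Qed.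

Lemma rpow_ge0 x q : 0 <= rpow x q.
Proof. rewrite /rpow; case: Rle_dec => // ?; first lra. exact/Rlt_le/exp_pos. Qed.

Lemma rpow_gt0 x q : 0 < x -> 0 < rpow x q.
Proof. by move=> h; rewrite rpow_gt0E //; apply: exp_pos. Qed.

Lemma rpowM x y q : 0 <= x -> 0 <= y -> rpow (x * y) q = rpow x q * rpow y q.
Proof.
case=> [hx|<-]; last by move=> _; rewrite Rmult_0_l !rpow0 Rmult_0_l.
case=> [hy|<-]; last by rewrite Rmult_0_r !rpow0 Rmult_0_r.
by rewrite !rpow_gt0E //; [rewrite Rpower_mult_distr|apply: Rmult_lt_0_compat].
Qed.

Lemma rpow_rpow x a b : 0 <= x -> rpow (rpow x a) b = rpow x (a * b).
Proof.
case=> [hx|<-]; last by rewrite !rpow0.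
by rewrite (rpow_gt0E _ b) ?rpow_gt0E ?Rpower_mult //; apply: exp_pos.
Qed.

Lemma rpowD x a b : 0 <= x -> rpow x (a + b) = rpow x a * rpow x b.
Proof.
case=> [hx|<-]; last by rewrite !rpow0 Rmult_0_r.
by rewrite !rpow_gt0E // Rpower_plus.
Qed.

Lemma rpow1r x : 0 <= x -> rpow x 1 = x.
Proof.
case=> [hx|<-]; last by rewrite rpow0.
by rewrite rpow_gt0E // Rpower_1.
Qed.

Lemma rpow1l q : rpow 1 q = 1.
Proof. by rewrite rpow_gt0E; [rewrite /Rpower ln_1 Rmult_0_r exp_0|lra]. Qed.

Lemma rpow_nat x n : 0 <= x -> rpow x (INR n.+1) = x ^ n.+1.
Proof.
case=> [hx|<-]; first by rewrite rpow_gt0E // Rpower_pow.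
by rewrite rpow0 /= Rmult_0_l.
Qed.

Lemma rpow_sqr x : 0 <= x -> rpow x 2 = x ^ 2.
Proof. by move=> h; rewrite -(rpow_nat x 1 h). Qed.

Lemma rpow_le x y q : 0 <= q -> 0 <= x -> x <= y -> rpow x q <= rpow y q.
Proof.
move=> hq; case=> [hx|<-] hxy; last by rewrite rpow0; apply: rpow_ge0.
rewrite !rpow_gt0E //; [exact: Rle_Rpower_l|lra].
Qed.

Lemma rpow_lt x y q : 0 < q -> 0 <= x -> x < y -> rpow x q < rpow y q.
Proof.
move=> hq; case=> [hx|<-] hxy; last by rewrite rpow0; apply: rpow_gt0.
rewrite !rpow_gt0E //; [exact: Rlt_Rpower_l|lra].
Qed.

Lemma rpow_le_inv x y q : 0 < q -> 0 <= x -> 0 <= y -> rpow x q <= rpow y q -> x <= y.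
Proof.
move=> hq hx hy h; apply: Rnot_lt_le => hlt.
have := rpow_lt _ _ _ hq hy hlt; lra.
Qed.

Lemma rpow_root x q : 0 <= x -> 0 < q -> rpow (rpow x q) (/ q) = x.
Proof. by move=> hx hq; rewrite rpow_rpow // Rinv_r ?rpow1r //; lra. Qed.

Lemma rpow_rootV x q : 0 <= x -> 0 < q -> rpow (rpow x (/ q)) q = x.
Proof. by move=> hx hq; rewrite rpow_rpow // Rinv_l ?rpow1r //; lra. Qed.

Lemma rpow_le1 x q : 0 <= q -> 0 <= x -> x <= 1 -> rpow x q <= 1.
Proof. by move=> hq h0 h1; rewrite -(rpow1l q); apply: rpow_le. Qed.

Lemma rpow_inv x q : 0 < x -> rpow (/ x) q = / rpow x q.
Proof.
move=> hx; have hi := Rinv_0_lt_compat _ hx.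
rewrite !rpow_gt0E // /Rpower ln_Rinv // -exp_Ropp; congr exp; ring.
Qed.

Lemma rpow_opp x q : 0 < x -> rpow x (- q) = / rpow x q.
Proof.
by move=> hx; rewrite !rpow_gt0E // Rpower_Ropp.
Qed.

(** The value 0 on nonpositive arguments makes the power continuous on the whole line, which removes
    side conditions from integrals and limits. *)
Lemma continuous_rpow q x : 0 < q -> continuous (fun u => rpow u q) x.
Proof.
move=> hq; case: (Rtotal_order x 0) => [hx|[->|hx]].
- apply: (continuous_ext_loc _ (fun _ => 0)).
    exists (mkposreal (- x) ltac:(lra)) => y hy.
    rewrite /rpow; case: Rle_dec => // n; exfalso.
    move: hy; rewrite /ball /= /AbsRing_ball /abs /minus /plus /opp /= => hy.
    move: (Rle_abs (y + - x)); lra.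
  exact: continuous_const.
- apply/filterlim_locally => eps.
  exists (mkposreal (rpow eps (/ q)) (rpow_gt0 _ _ (cond_pos eps))) => y.
  rewrite /ball /= /AbsRing_ball /abs /minus /plus /opp /= rpow0 => hy.
  rewrite Ropp_0 Rplus_0_r Rabs_pos_eq; last exact: rpow_ge0.
  case: (Rle_dec y 0) => h.
    rewrite /rpow; case: Rle_dec => // _; exact: cond_pos.
  rewrite Ropp_0 Rplus_0_r in hy.
  rewrite -(rpow_rootV eps q) //; last exact/Rlt_le/cond_pos.
  apply: rpow_lt => //; first lra.
  by move: (Rle_abs y); lra.
- apply: (continuous_ext_loc _ (fun u => exp (q * ln u))).
    exists (mkposreal x hx) => y.
    rewrite /ball /= /AbsRing_ball /abs /minus /plus /opp /= => hy.
    have : 0 < y by move: (Rle_abs (- (y + - x))); rewrite Rabs_Ropp; lra.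
    by move=> y0; rewrite rpow_gt0E.
  apply: continuous_comp; last exact: continuous_exp.
  apply: (continuous_scal_r q ln); exact: continuous_ln.
Qed.

Lemma bernoulli u r : 0 <= u -> 1 <= r -> 1 + r * (u - 1) <= rpow u r.
Proof.
case=> [hu|<-] hr; last by rewrite rpow0; lra.
rewrite rpow_gt0E //.
pose f := fun t => Rpower t r.
have hd : forall t, 0 < t -> is_derive f t (r * Rpower t (r - 1)).
  by move=> t ht; apply/is_derive_Reals; exact: derivable_pt_lim_power.
have hp : forall t, 1 <= t -> 1 <= Rpower t (r - 1).
  move=> t ht; apply: Rle_trans (_ : Rpower t 0 <= _).
    by rewrite Rpower_O; lra.
  by apply: Rle_Rpower; lra.
have hp' : forall t, 0 < t -> t <= 1 -> Rpower t (r - 1) <= 1.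
  move=> t ht ht1; apply: Rle_trans (_ : Rpower 1 (r - 1) <= 1).
    by apply: Rle_Rpower_l; lra.
  by rewrite /Rpower ln_1 Rmult_0_r exp_0; lra.
have f1 : f 1 = 1 by rewrite /f /Rpower ln_1 Rmult_0_r exp_0.
have hmm : 0 < Rmin 1 u by apply: Rmin_glb_lt; lra.
have [c [hc1 hc2]] := MVT_gen f 1 u (fun t => r * Rpower t (r - 1))
  (fun t ht => hd t (Rlt_trans _ _ _ hmm (proj1 ht)))
  (fun t ht => derivable_continuous_pt _ _
     (ex_derive_Reals_0 _ _ (ex_intro _ _ (hd t (Rlt_le_trans _ _ _ hmm (proj1 ht)))))).
rewrite f1 in hc2; rewrite -/(f u).
case: (Rle_dec 1 u) => h.
- rewrite Rmin_left // Rmax_right // in hc1.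
  have hk := hp c (proj1 hc1); move: (Rpower c _) hk hc2 => k hk hc2.
  have : 0 <= r * ((k - 1) * (u - 1)) by apply: Rmult_le_pos; nra.
  lra.
- rewrite Rmin_right ?Rmax_left in hc1; try lra.
  have hk := hp' c ltac:(lra) (proj2 hc1); move: (Rpower c _) hk hc2 => k hk hc2.
  have : 0 <= r * ((1 - k) * (1 - u)) by apply: Rmult_le_pos; nra.
  lra.
Qed.

(** Bernoulli's inequality rescaled by homogeneity. The convexity behind Young, Jensen and Minkowski
    enters through this tangent line. *)
Lemma rpow_tangent u m r : 0 <= u -> 0 < m -> 1 <= r ->
  rpow m r + r * rpow m (r - 1) * (u - m) <= rpow u r.
Proof.
move=> hu hm hr.
have hum : 0 <= u / m by apply: Rdiv_le_0_compat.
have hb := bernoulli (u / m) r hum hr.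
have -> : rpow u r = rpow m r * rpow (u / m) r.
  by rewrite -rpowM //; [congr rpow; field; lra|lra].
have hmr := rpow_gt0 m r hm.
have e : rpow m r = rpow m (r - 1) * m.
  rewrite -{3}(rpow1r m); last lra.
  rewrite -rpowD; [congr rpow; ring|lra].
apply: Rle_trans (Rmult_le_compat_l _ _ _ (Rlt_le _ _ hmr) hb).
apply: Req_le; rewrite {2}e {1}e; field; lra.
Qed.

Lemma young x y p q : 0 <= x -> 0 <= y -> 1 < p -> / p + / q = 1 ->
  x * y <= rpow x p / p + rpow y q / q.
Proof.
move=> hx hy hp hpq.
have hip : 0 < / p < 1.
  split; [apply: Rinv_0_lt_compat; lra|rewrite -Rinv_1; apply: Rinv_lt_contravar; lra].
have hq0 : 0 < q.
  have h : 0 < / q by lra.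
  by rewrite -(Rinv_inv q); apply: Rinv_0_lt_compat.
case: hy => [hy|<-]; last first.
  rewrite rpow0 Rmult_0_r /Rdiv Rmult_0_l Rplus_0_r.
  by apply: Rmult_le_pos; [exact: rpow_ge0|lra].
(* tangent line of [u^p] at the point where equality holds in Young *)
have hm := rpow_gt0 y (q - 1) hy.
have h := rpow_tangent x _ p hx hm ltac:(lra).
have hqp : (q - 1) * (p - 1) = 1.
  have : p * q * (/ p + / q) = p * q by rewrite hpq; ring.
  rewrite Rmult_plus_distr_l.
  have -> : p * q * / p = q by field; lra.
  have -> : p * q * / q = p by field; lra.
  lra.
have e1 : rpow (rpow y (q - 1)) (p - 1) = y.
  by rewrite rpow_rpow ?hqp ?rpow1r; lra.
have e2 : rpow (rpow y (q - 1)) p = rpow y q.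
  rewrite rpow_rpow; last lra.
  congr rpow; lra.
have e3 : rpow y (q - 1) * y = rpow y q.
  rewrite -{2}(rpow1r y); last lra.
  by rewrite -rpowD; [congr rpow; ring|lra].
rewrite e1 e2 in h.
have h2 : p * (x * y) <= rpow x p + (p - 1) * rpow y q.
  have : p * y * rpow y (q - 1) = p * rpow y q by rewrite -e3; ring.
  lra.
have e4 : / q = 1 - / p by lra.
rewrite /Rdiv e4; apply: (Rmult_le_reg_l p); first lra.
apply: Rle_trans h2 _; apply: Req_le; field; lra.
Qed.

(** Finite sums, grid means, iterated grid means and normalized sums over a subset are all of this
    kind, so the integral inequalities are proved once. No normalization is built in; Jensen's
    inequality asks for [E 1 = 1] separately. *)
Definition positive_functional {X : Type} (E : (X -> R) -> R) : Prop :=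
  [/\ forall f g, E (fun x => f x + g x) = E f + E g,
      forall c f, E (fun x => c * f x) = c * E f
    & forall f g, (forall x, f x <= g x) -> E f <= E g].

Section PositiveFunctional.

Context {X : Type} (E : (X -> R) -> R) (hE : positive_functional E).

Lemma pf_add f g : E (fun x => f x + g x) = E f + E g.
Proof. by case: hE. Qed.

Lemma pf_scal c f : E (fun x => c * f x) = c * E f.
Proof. by case: hE. Qed.

Lemma pf_le f g : (forall x, f x <= g x) -> E f <= E g.
Proof. by case: hE => _ _; apply. Qed.

Lemma pf_ext f g : (forall x, f x = g x) -> E f = E g.
Proof. by move=> h; apply: Rle_antisym; apply: pf_le => x; rewrite h; lra. Qed.

Lemma pf_0 : E (fun _ => 0) = 0.
Proof.
rewrite (pf_ext _ (fun _ => 0 * 0)); last by move=> x; ring.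
by rewrite (pf_scal 0 (fun _ => 0)); ring.
Qed.

Lemma pf_ge0 f : (forall x, 0 <= f x) -> 0 <= E f.
Proof. by move=> h; rewrite -pf_0; apply: pf_le. Qed.

Lemma pf_const c : E (fun=> c) = c * E (fun=> 1).
Proof. by rewrite -pf_scal; apply: pf_ext => x; ring. Qed.

(** Strictly positive upper bounds [a], [b] stand in for the norms, which may vanish. After
    normalization by them, [young] applies pointwise. *)
Lemma pf_holder_pos f g p q a b :
  (forall x, 0 <= f x) -> (forall x, 0 <= g x) -> 1 < p -> 1 < q -> / p + / q = 1 ->
  0 < a -> 0 < b -> E (fun x => rpow (f x) p) <= rpow a p ->
  E (fun x => rpow (g x) q) <= rpow b q -> E (fun x => f x * g x) <= a * b.
Proof.
move=> hf hg hp hq hpq ha hb hfa hgb.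
have hai := Rinv_0_lt_compat _ ha; have hbi := Rinv_0_lt_compat _ hb.
have hab : 0 < a * b by apply: Rmult_lt_0_compat.
have key : E (fun x => / (a * b) * (f x * g x)) <=
    E (fun x => / p * (rpow (/ a) p * rpow (f x) p) + / q * (rpow (/ b) q * rpow (g x) q)).
  apply: pf_le => x.
  have h := young (/ a * f x) (/ b * g x) p q
    ltac:(apply: Rmult_le_pos => //; lra) ltac:(apply: Rmult_le_pos => //; lra) hp hpq.
  rewrite !rpowM in h => //; try lra.
  apply: Rle_trans (Rle_trans _ _ _ _ h) _; apply: Req_le; last by rewrite /Rdiv; ring.
  by field; lra.
rewrite pf_scal pf_add !pf_scal in key.
have ea : rpow (/ a) p * E (fun x => rpow (f x) p) <= 1.
  have := Rmult_le_compat_l _ _ _ (rpow_ge0 (/ a) p) hfa.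
  by rewrite -rpowM ?Rinv_l ?rpow1l //; lra.
have eb : rpow (/ b) q * E (fun x => rpow (g x) q) <= 1.
  have := Rmult_le_compat_l _ _ _ (rpow_ge0 (/ b) q) hgb.
  by rewrite -rpowM ?Rinv_l ?rpow1l //; lra.
have hip : 0 < / p by apply: Rinv_0_lt_compat; lra.
have hiq : 0 < / q by apply: Rinv_0_lt_compat; lra.
have : / (a * b) * E (fun x => f x * g x) <= 1 by nra.
move/(Rmult_le_compat_l (a * b) _ _ (Rlt_le _ _ hab)).
by rewrite -Rmult_assoc Rinv_r ?Rmult_1_l ?Rmult_1_r //; lra.
Qed.

Lemma pf_holder f g p q : (forall x, 0 <= f x) -> (forall x, 0 <= g x) ->
  1 < p -> 1 < q -> / p + / q = 1 ->
  E (fun x => f x * g x) <=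
    rpow (E (fun x => rpow (f x) p)) (/ p) * rpow (E (fun x => rpow (g x) q)) (/ q).
Proof.
move=> hf hg hp hq hpq.
set A := rpow _ (/ p); set B := rpow _ (/ q).
have hA : 0 <= A by apply: rpow_ge0.
have hB : 0 <= B by apply: rpow_ge0.
have aux h r e : 1 < r -> 0 < e -> (forall x, 0 <= h x) -> 
    E (fun x => rpow (h x) r) <= rpow (rpow (E (fun x => rpow (h x) r)) (/ r) + e) r.
  move=> hr he hh.
  have h0 : 0 <= E (fun x => rpow (h x) r) by apply: pf_ge0 => x; apply: rpow_ge0.
  rewrite -{1}(rpow_rootV (E _) r h0) ; last lra.
  by apply: rpow_le; [lra|exact: rpow_ge0|lra].
apply: le_epsilon => e he.
(* The excess [(A + d) * (B + d) - A * B] is at most [d * (A + B + 1)], hence at most [e]. *)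
pose d := Rmin 1 (e / (A + B + 1)).
have hd : 0 < d by apply: Rmin_glb_lt; [lra|apply: Rdiv_lt_0_compat; lra].
have h := pf_holder_pos f g p q (A + d) (B + d) hf hg hp hq hpq
  ltac:(lra) ltac:(lra) (aux f p d hp hd hf) (aux g q d hq hd hg).
apply: Rle_trans h _.
have h1 : d <= 1 by apply: Rmin_l.
have h2 : d * (A + B + 1) <= e.
  have h3 : d <= e / (A + B + 1) by apply: Rmin_r.
  have := Rmult_le_compat_r (A + B + 1) _ _ ltac:(lra) h3.
  by rewrite /Rdiv Rmult_assoc Rinv_l ?Rmult_1_r //; lra.
nra.
Qed.

Lemma pf_jensen f r : E (fun=> 1) = 1 -> (forall x, 0 <= f x) -> 1 <= r ->
  rpow (E f) r <= E (fun x => rpow (f x) r).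
Proof.
move=> h1 hf hr; case: (pf_ge0 f hf) => [hm|<-]; last first.
  by rewrite rpow0; apply: pf_ge0 => x; apply: rpow_ge0.
have := pf_le _ _ (fun x => rpow_tangent (f x) (E f) r (hf x) hm hr).
rewrite pf_add pf_scal pf_add (pf_const (- _)) (pf_const (rpow _ _)) h1; lra.
Qed.

(** Convexity after scaling [f] and [g] by upper bounds of their norms; no dual exponent occurs, so
    [p = 1] is included. *)
Lemma pf_minkowski f g p : 1 <= p -> (forall x, 0 <= f x) -> (forall x, 0 <= g x) ->
  rpow (E (fun x => rpow (f x + g x) p)) (/ p) <=
  rpow (E (fun x => rpow (f x) p)) (/ p) + rpow (E (fun x => rpow (g x) p)) (/ p).
Proof.
move=> hp hf hg.
set A := rpow (E (fun x => rpow (f x) p)) (/ p).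
set B := rpow (E (fun x => rpow (g x) p)) (/ p).
have hA : 0 <= A by apply: rpow_ge0.
have hB : 0 <= B by apply: rpow_ge0.
have eA : rpow A p = E (fun x => rpow (f x) p).
  by rewrite rpow_rootV //; [apply: pf_ge0 => x; apply: rpow_ge0|lra].
have eB : rpow B p = E (fun x => rpow (g x) p).
  by rewrite rpow_rootV //; [apply: pf_ge0 => x; apply: rpow_ge0|lra].
have hS : 0 <= E (fun x => rpow (f x + g x) p) by apply: pf_ge0 => x; apply: rpow_ge0.
suff key a b : A <= a -> B <= b -> 0 < a -> 0 < b ->
    rpow (E (fun x => rpow (f x + g x) p)) (/ p) <= a + b.
  apply: le_epsilon => e he; apply: Rle_trans (key (A + e / 2) (B + e / 2) _ _ _ _) _; lra.
move=> hAa hBb ha hb.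
rewrite -(rpow_root (a + b) p); [|lra|lra].
apply: rpow_le => //; first by apply/Rlt_le/Rinv_0_lt_compat; lra.
(* convexity: [u + v = (a+b) (a/(a+b) (u/a) + b/(a+b) (v/b))] *)
have hab : 0 < a + b by lra.
have pt x : rpow (f x + g x) p <=
    rpow (a + b) p * (a / (a + b) * (/ rpow a p * rpow (f x) p)
                      + b / (a + b) * (/ rpow b p * rpow (g x) p)).
  set u := f x / a; set v := g x / b; set m := a / (a + b) * u + b / (a + b) * v.
  have hu : 0 <= u by apply: Rdiv_le_0_compat.
  have hv : 0 <= v by apply: Rdiv_le_0_compat.
  have hca : 0 < a / (a + b) by apply: Rdiv_lt_0_compat.
  have hcb : 0 < b / (a + b) by apply: Rdiv_lt_0_compat.
  have hcab : a / (a + b) + b / (a + b) = 1 by field; lra.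
  have -> : f x + g x = (a + b) * m by rewrite /m /u /v; field; lra.
  have hm : 0 <= m by rewrite /m; nra.
  rewrite rpowM //; last lra.
  apply: Rmult_le_compat_l; first exact: rpow_ge0.
  have -> : / rpow a p * rpow (f x) p = rpow u p.
    rewrite /u /Rdiv rpowM ?rpow_inv //; [ring|exact/Rlt_le/Rinv_0_lt_compat].
  have -> : / rpow b p * rpow (g x) p = rpow v p.
    rewrite /v /Rdiv rpowM ?rpow_inv //; [ring|exact/Rlt_le/Rinv_0_lt_compat].
  have hup := rpow_ge0 u p; have hvp := rpow_ge0 v p.
  have em : m = a / (a + b) * u + b / (a + b) * v by [].
  move: (a / (a + b)) (b / (a + b)) hca hcb hcab em => wa wb hca hcb hcab em.
  clearbody m; case: hm => [hm|<-]; last by rewrite rpow0; nra.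
  have hT1 := rpow_tangent u m p hu hm hp; have hT2 := rpow_tangent v m p hv hm hp.
  move: (p * rpow m (p - 1)) hT1 hT2 => k hT1 hT2.
  have e1 := Rmult_le_compat_l wa _ _ ltac:(lra) hT1.
  have e2 := Rmult_le_compat_l wb _ _ ltac:(lra) hT2.
  have e3 : wa * (rpow m p + k * (u - m)) + wb * (rpow m p + k * (v - m)) =
      (wa + wb) * rpow m p + k * (wa * u + wb * v - (wa + wb) * m) by ring.
  rewrite hcab -em in e3; lra.
apply: Rle_trans (pf_le _ _ pt) _.
rewrite pf_scal pf_add !pf_scal -eA -eB.
have h1 : / rpow a p * rpow A p <= 1.
  have := rpow_le A a p ltac:(lra) hA hAa.
  move/(Rmult_le_compat_l (/ rpow a p) _ _ (Rlt_le _ _ (Rinv_0_lt_compat _ (rpow_gt0 a p ha)))).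
  rewrite Rinv_l //; have := rpow_gt0 a p ha; lra.
have h2 : / rpow b p * rpow B p <= 1.
  have := rpow_le B b p ltac:(lra) hB hBb.
  move/(Rmult_le_compat_l (/ rpow b p) _ _ (Rlt_le _ _ (Rinv_0_lt_compat _ (rpow_gt0 b p hb)))).
  rewrite Rinv_l //; have := rpow_gt0 b p hb; lra.
have hca : 0 < a / (a + b) by apply: Rdiv_lt_0_compat.
have hcb : 0 < b / (a + b) by apply: Rdiv_lt_0_compat.
have hcab : a / (a + b) + b / (a + b) = 1 by field; lra.
rewrite -{2}(Rmult_1_r (rpow (a + b) p)).
apply: Rmult_le_compat_l; first exact: rpow_ge0.
rewrite -hcab; nra.
Qed.

End PositiveFunctional.

(** * Finite sums and grid means *)

HB.instance Definition _ := Monoid.isComLaw.Build R 0 Rplus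
  (fun x y z => esym (Rplus_assoc x y z)) Rplus_comm Rplus_0_l.
HB.instance Definition _ := Monoid.isMulLaw.Build R 0 Rmult Rmult_0_l Rmult_0_r.
HB.instance Definition _ := Monoid.isAddLaw.Build R Rmult Rplus
  (fun x y z => Rmult_plus_distr_r x y z) (fun x y z => Rmult_plus_distr_l x y z).
HB.instance Definition _ := Monoid.isComLaw.Build C (RtoC 0) Cplus Cplus_assoc Cplus_comm Cplus_0_l.
HB.instance Definition _ := Monoid.isMulLaw.Build C (RtoC 0) Cmult Cmult_0_l Cmult_0_r.
HB.instance Definition _ := Monoid.isAddLaw.Build C Cmult Cplus Cmult_plus_distr_r Cmult_plus_distr_l.

Notation "\rsum_ ( i <- r | P ) F" := (\big[Rplus/0%R]_(i <- r | P%B) F%R)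
  (at level 34, F at level 41, i, r at level 60).
Notation "\rsum_ ( i <- r ) F" := (\big[Rplus/0%R]_(i <- r) F%R)
  (at level 34, F at level 41, i, r at level 60).
Notation "\csum_ ( i <- r | P ) F" := (\big[Cplus/RtoC 0]_(i <- r | P%B) F%C)
  (at level 34, F at level 41, i, r at level 60).
Notation "\csum_ ( i <- r ) F" := (\big[Cplus/RtoC 0]_(i <- r) F%C)
  (at level 34, F at level 41, i, r at level 60).

Lemma C_ext (z w : C) : Re z = Re w -> Im z = Im w -> z = w.
Proof. by case: z => a b; case: w => c d /= -> ->. Qed.

Section Sums.

Context {I : Type}.
Implicit Types (r : seq I) (P : pred I).

Lemma rsum_le r P (F G : I -> R) : (forall i, P i -> F i <= G i) ->
  \rsum_(i <- r | P i) F i <= \rsum_(i <- r | P i) G i.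
Proof. by move=> h; apply: (big_ind2 Rle) => //; [lra|move=> *; lra]. Qed.

Lemma rsum_ge0 r P (F : I -> R) : (forall i, P i -> 0 <= F i) -> 0 <= \rsum_(i <- r | P i) F i.
Proof. by move=> h; apply: big_ind => //; [lra|move=> *; lra]. Qed.

Lemma rsum_pf r P : positive_functional (fun f => \rsum_(i <- r | P i) f i).
Proof.
split=> [f g|c f|f g h]; first by rewrite big_split.
  by rewrite big_distrr.
by apply: rsum_le.
Qed.

Lemma rsum_const r c : \rsum_(i <- r) c = INR (size r) * c.
Proof.
elim: r => [|i r IH]; first by rewrite big_nil Rmult_0_l.
by rewrite big_cons IH -[size (i :: r)]/(size r).+1 S_INR; ring.
Qed.

Lemma csum_Re r P (F : I -> C) : Re (\csum_(i <- r | P i) F i) = \rsum_(i <- r | P i) Re (F i).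
Proof. exact: (big_morph Re). Qed.

Lemma csum_Im r P (F : I -> C) : Im (\csum_(i <- r | P i) F i) = \rsum_(i <- r | P i) Im (F i).
Proof. exact: (big_morph Im). Qed.

Lemma Cmod_csum r P (F : I -> C) :
  Cmod (\csum_(i <- r | P i) F i) <= \rsum_(i <- r | P i) Cmod (F i).
Proof.
apply: (big_ind2 (fun z x => Cmod z <= x)) => [|z x w y h1 h2|i _]; [|..|lra].
  rewrite Cmod_0; lra.
apply: Rle_trans (Cmod_triangle _ _) _; lra.
Qed.

Lemma csum_RtoC r P (F : I -> R) : RtoC (\rsum_(i <- r | P i) F i) = \csum_(i <- r | P i) RtoC (F i).
Proof. by apply: (big_morph RtoC) => // x y; rewrite RtoC_plus. Qed.

Lemma csum_conj r P (F : I -> C) : Cconj (\csum_(i <- r | P i) F i) = \csum_(i <- r | P i) Cconj (F i).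
Proof.
apply: (big_morph Cconj) => [x y|]; last by rewrite /Cconj /= Ropp_0.
exact: Cplus_conj.
Qed.

End Sums.

Lemma rsum_le_seq (I : eqType) (r : seq I) (F G : I -> R) : (forall i, i \in r -> F i <= G i) ->
  \rsum_(i <- r) F i <= \rsum_(i <- r) G i.
Proof.
move=> h; rewrite big_seq [X in _ <= X]big_seq; exact: rsum_le.
Qed.

Lemma rsum_subset (I : eqType) (r s : seq I) (F : I -> R) :
  uniq r -> uniq s -> {subset r <= s} -> (forall i, i \in s -> 0 <= F i) ->
  \rsum_(i <- r) F i <= \rsum_(i <- s) F i.
Proof.
move=> ur us hrs hF; rewrite (bigID (mem r) _ _ (r := s)) /=.
have -> : \rsum_(i <- s | i \in r) F i = \rsum_(i <- r) F i.
  rewrite -big_filter; apply: perm_big; apply: uniq_perm => //; first exact: filter_uniq.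
  by move=> i; rewrite mem_filter; case: (boolP (i \in r)) => // /hrs ->.
have : 0 <= \rsum_(i <- s | i \notin r) F i.
  by rewrite big_seq_cond; apply: rsum_ge0 => i /andP[/hF].
lra.
Qed.

Lemma rsum_term_le (I : eqType) (r : seq I) (F : I -> R) j : (forall i, i \in r -> 0 <= F i) ->
  j \in r -> F j <= \rsum_(i <- r) F i.
Proof.
elim: r => // i r IH hF; rewrite inE big_cons => hj.
have hr : 0 <= \rsum_(i <- r) F i.
  by rewrite big_seq; apply: rsum_ge0 => k hk; apply: hF; rewrite inE hk orbT.
have hi : 0 <= F i by apply: hF; rewrite inE eqxx.
case/orP: hj => [/eqP ->|hj]; first lra.
suff : F j <= \rsum_(i0 <- r) F i0 by lra.
by apply: IH => // k hk; apply: hF; rewrite inE hk orbT.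
Qed.

(** * Means over equally spaced grids of angles *)

Definition cis (x : R) : C := (cos x, sin x).

Lemma cisD x y : cis (x + y) = Cmult (cis x) (cis y).
Proof. by apply: C_ext; rewrite /= ?cos_plus ?sin_plus; ring. Qed.

Lemma cis0 : cis 0 = RtoC 1.
Proof. by rewrite /cis cos_0 sin_0. Qed.

Lemma cisN x : cis (- x) = Cconj (cis x).
Proof. by apply: C_ext; rewrite /= ?cos_neg ?sin_neg. Qed.

Lemma Cmod_cis x : Cmod (cis x) = 1.
Proof.
rewrite /Cmod /= -{3}sqrt_1; congr sqrt.
have := sin2_cos2 x; rewrite /Rsqr; lra.
Qed.

Lemma Cmod_sqr (z : C) : Cmod z ^ 2 = Re z ^ 2 + Im z ^ 2.
Proof. rewrite /Cmod pow2_sqrt //; nra. Qed.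

(** The number of points is odd and the grid symmetric, so that index [K] is [al] itself. The centre
    is later placed where the real part of the symbol is smallest, or at a point whose value has to
    be detected. *)
Definition gpt (K : nat) (al : R) (k : nat) : R :=
  al + 2 * PI * (INR k - INR K) / INR (2 * K + 1).

Definition gmean (K : nat) (al : R) (h : R -> R) : R :=
  / INR (2 * K + 1) * \rsum_(k <- iota 0 (2 * K + 1)) h (gpt K al k).

Definition cgmean (K : nat) (al : R) (h : R -> C) : C :=
  Cmult (RtoC (/ INR (2 * K + 1))) (\csum_(k <- iota 0 (2 * K + 1)) h (gpt K al k)).

Lemma grid_size_gt0 K : 0 < INR (2 * K + 1).
Proof. by rewrite addn1; apply: lt_0_INR; apply/ltP. Qed.

Lemma gmean_pf K al : positive_functional (gmean K al).
Proof.
have hK := Rinv_0_lt_compat _ (grid_size_gt0 K).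
split=> [f g|c f|f g h]; rewrite /gmean.
- by rewrite big_split /=; ring.
- by rewrite -big_distrr /=; ring.
- by apply: Rmult_le_compat_l; [lra|apply: rsum_le].
Qed.

Lemma gmean_1 K al : gmean K al (fun=> 1) = 1.
Proof.
by rewrite /gmean rsum_const size_iota Rmult_1_r Rinv_l //; have := grid_size_gt0 K; lra.
Qed.

Lemma cgmean_split K al h :
  cgmean K al h = (gmean K al (fun t => Re (h t)), gmean K al (fun t => Im (h t))).
Proof.
by apply: C_ext; rewrite /cgmean /gmean /=; rewrite -?csum_Re -?csum_Im /Re /Im; ring.
Qed.

Lemma cgmean_Cmod K al h : Cmod (cgmean K al h) <= gmean K al (fun t => Cmod (h t)).
Proof.
rewrite /cgmean /gmean Cmod_mult Cmod_R Rabs_pos_eq; last first.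
  exact/Rlt_le/Rinv_0_lt_compat/grid_size_gt0.
apply: Rmult_le_compat_l; first exact/Rlt_le/Rinv_0_lt_compat/grid_size_gt0.
exact: Cmod_csum.
Qed.

Lemma cgmeanD K al f g : cgmean K al (fun t => Cplus (f t) (g t)) = Cplus (cgmean K al f) (cgmean K al g).
Proof. by rewrite /cgmean big_split /=; ring. Qed.

Lemma cgmeanZ K al c f : cgmean K al (fun t => Cmult c (f t)) = Cmult c (cgmean K al f).
Proof. by rewrite /cgmean -big_distrr /=; ring. Qed.

Lemma cgmean_ext K al f g : (forall t, f t = g t) -> cgmean K al f = cgmean K al g.
Proof. by move=> h; rewrite /cgmean; congr Cmult; apply: eq_bigr => k _. Qed.

Lemma cgmean_sum (I : Type) (r : seq I) (F : I -> R -> C) K al :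
  cgmean K al (fun t => \csum_(i <- r) F i t) = \csum_(i <- r) cgmean K al (F i).
Proof. by rewrite /cgmean exchange_big /= big_distrr. Qed.

(** The factor [2 * sin (h / 2)] makes the sum telescope. *)
Lemma sum_cos_arith (x h : R) (n : nat) :
  2 * sin (h / 2) * \rsum_(k <- iota 0 n) cos (x + INR k * h)
  = sin (x + INR n * h - h / 2) - sin (x - h / 2).
Proof.
elim: n => [|n IH]; first by rewrite big_nil /= Rmult_0_l Rplus_0_r; ring.
rewrite -addn1 iotaD big_cat big_seq1 /= Rmult_plus_distr_l IH add0n addn1 S_INR.
have -> : x + (INR n + 1) * h - h / 2 = (x + INR n * h) + h / 2 by field.
rewrite (sin_plus (x + INR n * h)) (sin_minus (x + INR n * h)); ring.
Qed.

(** The range conditions keep [|n - m|] below the number of grid points. Hence no aliasing occurs,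
    and the grid mean is exactly the integral over the circle. *)
Lemma gmean_cos K al x n m : (n <= 2 * K)%N -> (m <= 2 * K)%N ->
  gmean K al (fun t => cos (x + (INR n - INR m) * t)) = if n == m then cos x else 0.
Proof.
move=> hn hm; case: eqP => [->|hnm].
  rewrite -[RHS]Rmult_1_l -(gmean_1 K al) Rmult_comm -(pf_scal _ (gmean_pf K al)).
  apply: (pf_ext _ (gmean_pf K al)) => t.
  by rewrite Rmult_1_r; congr cos; ring.
set M := INR (2 * K + 1); have hM : 0 < M by apply: grid_size_gt0.
set e := INR n - INR m; set h := 2 * PI * e / M.
have hs : sin (h / 2) <> 0.
  have he0 : e <> 0 by move=> he; apply: hnm; apply: INR_eq; rewrite /e in he; lra.
  have heM : Rabs e < M.
    have a1 : INR n < M by apply: lt_INR; apply/ltP; rewrite addn1.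
    have a2 : INR m < M by apply: lt_INR; apply/ltP; rewrite addn1.
    have b1 := pos_INR n; have b2 := pos_INR m.
    by apply: Rabs_def1; rewrite /e; lra.
  have -> : h / 2 = PI * (e / M) by rewrite /h; field; lra.
  have hq : Rabs (e / M) < 1.
    rewrite Rabs_div; last by move=> hM0; lra.
    rewrite (Rabs_pos_eq M); last lra.
    by apply: (Rmult_lt_reg_r M) => //; rewrite /Rdiv Rmult_assoc Rinv_l; lra.
  have hpi := PI_RGT_0.
  case/Rabs_def2: hq => q1 q2.
  case: (Rtotal_order (e / M) 0) => [h0|[h0|h0]].
  - have h1 : - PI < PI * (e / M) by nra.
    have h2 : PI * (e / M) < 0 by nra.
    have := sin_lt_0_var _ h1 h2; lra.
  - exfalso; apply: he0.
    have e1 : e = e / M * M by field; lra.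
    by rewrite e1 h0; ring.
  - have h1 : 0 < PI * (e / M) by nra.
    have h2 : PI * (e / M) < PI by nra.
    have := sin_gt_0 _ h1 h2; lra.
pose x0 := x + e * (al - 2 * PI * INR K / M).
have := sum_cos_arith x0 h (2 * K + 1); rewrite -/M.
have -> : x0 + M * h - h / 2 = (x0 - h / 2) + 2 * PI * e by rewrite /h; field; lra.
have per : sin (x0 - h / 2 + 2 * PI * e) = sin (x0 - h / 2).
  rewrite /e Rmult_minus_distr_l.
  have -> : x0 - h / 2 + (2 * PI * INR n - 2 * PI * INR m) =
     (x0 - h / 2 - 2 * INR m * PI) + 2 * INR n * PI by ring.
  rewrite sin_period -(sin_period _ m); congr sin; ring.
rewrite per Rminus_diag => /Rmult_integral[]; first lra.
rewrite /gmean => hz; rewrite (_ : \big[_/_]_(_ <- _) _ = 0) ?Rmult_0_r //.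
rewrite -[RHS]hz; apply: eq_bigr => k _; congr cos; rewrite /x0 /gpt /h -/M; field; lra.
Qed.

Lemma cgmean_cis K al n m : (n <= 2 * K)%N -> (m <= 2 * K)%N ->
  cgmean K al (fun t => cis ((INR n - INR m) * t)) = if n == m then RtoC 1 else RtoC 0.
Proof.
move=> hn hm; rewrite cgmean_split.
have -> : gmean K al (fun t => Re (cis ((INR n - INR m) * t))) = if n == m then cos 0 else 0.
  rewrite -(gmean_cos K al 0 n m hn hm); apply: (pf_ext _ (gmean_pf K al)) => t.
  by rewrite /= Rplus_0_l.
have -> : gmean K al (fun t => Im (cis ((INR n - INR m) * t))) = if n == m then cos (- (PI / 2)) else 0.
  rewrite -(gmean_cos K al (- (PI / 2)) n m hn hm); apply: (pf_ext _ (gmean_pf K al)) => t.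
  by rewrite cos_plus cos_neg sin_neg cos_PI2 sin_PI2 /=; ring.
by rewrite cos_neg cos_PI2 cos_0; case: ifP.
Qed.

(** * Coefficient inequalities in one variable *)

Definition tpoly (a : nat -> C) (n : nat) (t : R) : C :=
  \csum_(j <- iota 0 n.+1) Cmult (a j) (cis (INR j * t)).

Lemma csum_delta (r : seq nat) (F : nat -> C) k : uniq r -> k \in r ->
  \csum_(j <- r) Cmult (F j) (if j == k then RtoC 1 else RtoC 0) = F k.
Proof.
move=> ur kr; rewrite (bigD1_seq k) //= eqxx Cmult_1_r big1 ?Cplus_0_r //.
by move=> j /negbTE ->; rewrite Cmult_0_r.
Qed.

Lemma csum_delta0 (r : seq nat) (F : nat -> C) (P : pred nat) : {in r, forall j, ~~ P j} ->
  \csum_(j <- r) Cmult (F j) (if P j then RtoC 1 else RtoC 0) = RtoC 0.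
Proof.
move=> h; rewrite big_seq big1 // => j /h /negbTE ->; exact: Cmult_0_r.
Qed.

(** Extracts the coefficient of frequency [c] from a product; [c = 0] and [c = k] give the two
    halves of the pairing in [cgmean_test]. *)
Lemma cgmean_tpoly_mul K al a n k s m c : (n + m * k <= 2 * K)%N -> (c <= 2 * K)%N ->
  cgmean K al (fun t => Cmult (cis (- INR c * t)) (Cmult (tpoly a n t) (tpoly s m (INR k * t))))
  = \csum_(i <- iota 0 m.+1) Cmult (s i) (\csum_(j <- iota 0 n.+1)
       Cmult (a j) (if (j + i * k == c)%N then RtoC 1 else RtoC 0)).
Proof.
move=> hK hc.
rewrite (cgmean_ext _ _ _ (fun t => \csum_(i <- iota 0 m.+1) Cmult (s i)
   (\csum_(j <- iota 0 n.+1) Cmult (a j) (cis ((INR (j + i * k) - INR c) * t))))).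
  rewrite cgmean_sum; apply: eq_big_seq => i; rewrite mem_iota => /andP[_ hi].
  rewrite cgmeanZ cgmean_sum; congr Cmult; apply: eq_big_seq => j; rewrite mem_iota => /andP[_ hj].
  rewrite cgmeanZ cgmean_cis //; apply: leq_trans hK; rewrite add0n !ltnS in hi hj.
  by apply: leq_add => //; rewrite leq_mul2r hi orbT.
move=> t; rewrite {2}/tpoly !big_distrr /=; apply: eq_bigr => i _.
rewrite /tpoly; set S := \csum_(j <- _) _.
have -> : Cmult (cis (- INR c * t)) (Cmult S (Cmult (s i) (cis (INR i * (INR k * t)))))
  = Cmult (s i) (Cmult (cis (- INR c * t + INR i * (INR k * t))) S) by rewrite cisD; ring.
rewrite /S big_distrr /=; congr Cmult; apply: eq_bigr => j _.
rewrite plus_INR mult_INR.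
have -> : (INR j + INR i * INR k - INR c) * t = (- INR c * t + INR i * (INR k * t)) + INR j * t by ring.
rewrite (cisD (_ + _)); ring.
Qed.

(* [u] stands for [cis (k t)]: the test function is [(1 + b / u) s(u)]. *)
Lemma cgmean_test K al a n k b s m : (0 < k <= n)%N -> (0 < m)%N -> (n + m * k <= 2 * K)%N ->
  cgmean K al (fun t => Cmult (tpoly a n t)
      (Cmult (Cplus 1 (Cmult b (cis (- INR k * t)))) (tpoly s m (INR k * t))))
  = Cplus (Cmult (a 0%N) (Cplus (s 0%N) (Cmult b (s 1%N)))) (Cmult b (Cmult (s 0%N) (a k))).
Proof.
move=> /andP[k0 kn] m0 hK.
have hk : (k <= 2 * K)%N by apply: leq_trans hK; apply: leq_trans kn (leq_addr _ _).
rewrite (cgmean_ext _ _ _ (fun t => Cplus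
   (Cmult (cis (- INR 0 * t)) (Cmult (tpoly a n t) (tpoly s m (INR k * t))))
   (Cmult b (Cmult (cis (- INR k * t)) (Cmult (tpoly a n t) (tpoly s m (INR k * t))))))); last first.
  by move=> t; rewrite Ropp_0 Rmult_0_l cis0; ring.
rewrite cgmeanD cgmeanZ !cgmean_tpoly_mul //.
have e1 : \csum_(i <- iota 0 m.+1) Cmult (s i) (\csum_(j <- iota 0 n.+1)
       Cmult (a j) (if (j + i * k == 0)%N then RtoC 1 else RtoC 0)) = Cmult (s 0%N) (a 0%N).
  rewrite -[iota 0 m.+1]/(0%N :: iota 1 m) big_cons [X in Cplus _ X]big1_seq; last first.
    move=> i /andP[_]; rewrite mem_iota => /andP[i0 _].
    rewrite (_ : \big[_/_]_(j <- _) _ = RtoC 0) ?Cmult_0_r //.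
    apply: (csum_delta0 _ a (fun j => (j + i * k == 0)%N)) => j _.
    by rewrite addn_eq0 negb_and muln_eq0 -!lt0n negb_or -!lt0n i0 k0 orbT.
  rewrite Cplus_0_r; congr Cmult; rewrite -(csum_delta (iota 0 n.+1) a 0%N) ?iota_uniq ?mem_iota //.
  by apply: eq_bigr => j _; rewrite mul0n addn0.
have e2 : \csum_(i <- iota 0 m.+1) Cmult (s i) (\csum_(j <- iota 0 n.+1)
       Cmult (a j) (if (j + i * k == k)%N then RtoC 1 else RtoC 0)) =
     Cplus (Cmult (s 0%N) (a k)) (Cmult (s 1%N) (a 0%N)).
  case: m m0 {hK e1} => // m _; rewrite -[iota 0 m.+2]/(0%N :: 1%N :: iota 2 m) 2!big_cons.
  rewrite [X in Cplus _ (Cplus _ X)]big1_seq; last first.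
    move=> i /andP[_]; rewrite mem_iota => /andP[i1 _].
    rewrite (_ : \big[_/_]_(j <- _) _ = RtoC 0) ?Cmult_0_r //.
    apply: (csum_delta0 _ a (fun j => (j + i * k == k)%N)) => j _.
    rewrite neq_ltn; apply/orP; right.
    apply: leq_trans (leq_addl _ _); apply: leq_trans (leq_mul i1 (leqnn k)).
    by rewrite mulSn mul1n -{1}(add0n k) ltn_add2r.
  rewrite Cplus_0_r; congr Cplus; congr Cmult.
    rewrite -(csum_delta (iota 0 n.+1) a k) ?iota_uniq ?mem_iota //=.
    by apply: eq_bigr => j _; rewrite mul0n addn0.
  rewrite -(csum_delta (iota 0 n.+1) a 0%N) ?iota_uniq ?mem_iota //.
  by apply: eq_bigr => j _; rewrite mul1n -{2}(add0n k) eqn_add2r.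
rewrite e1 e2; ring.
Qed.

Lemma tpoly_coef_le K al a n k : (k <= n)%N -> (n <= 2 * K)%N ->
  Cmod (a k) <= gmean K al (fun t => Cmod (tpoly a n t)).
Proof.
move=> kn hK.
have := cgmean_tpoly_mul K al a n 0 (fun _ => RtoC 1) 0 k.
rewrite mul0n addn0 => /(_ hK (leq_trans kn hK)).
rewrite big_seq1 muln0 (eq_bigr (fun j => Cmult (a j) (if j == k then RtoC 1 else RtoC 0))); last first.
  by move=> j _; rewrite addn0.
rewrite csum_delta ?iota_uniq ?mem_iota ?add0n ?ltnS // Cmult_1_l => <-.
apply: Rle_trans (cgmean_Cmod _ _ _) _; apply: Req_le; apply: (pf_ext _ (gmean_pf K al)) => t.
rewrite !Cmod_mult Cmod_cis Rmult_1_l {2}/tpoly big_seq1 Rmult_0_l cis0 Cmult_1_l.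
by rewrite Cmod_1 Rmult_1_r.
Qed.

Lemma gmean_parseval K al k d m : (0 < k)%N -> (m * k <= 2 * K)%N ->
  gmean K al (fun t => Cmod (tpoly d m (INR k * t)) ^ 2) = \rsum_(i <- iota 0 m.+1) Cmod (d i) ^ 2.
Proof.
move=> k0 hK.
have h : cgmean K al (fun t => Cmult (tpoly d m (INR k * t)) (Cconj (tpoly d m (INR k * t))))
   = RtoC (\rsum_(i <- iota 0 m.+1) Cmod (d i) ^ 2).
  rewrite (cgmean_ext _ _ _ (fun t => \csum_(i <- iota 0 m.+1) Cmult (Cconj (d i))
     (\csum_(j <- iota 0 m.+1) Cmult (d j) (cis ((INR (j * k) - INR (i * k)) * t))))); last first.
    move=> t; rewrite {2}/tpoly csum_conj big_distrr /=; apply: eq_bigr => i _.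
    rewrite Cmult_conj -cisN.
    rewrite Cmult_assoc (Cmult_comm _ (Cconj (d i))) -Cmult_assoc; congr Cmult.
    rewrite /tpoly big_distrl /=; apply: eq_bigr => j _; rewrite -Cmult_assoc -cisD.
    congr Cmult; congr cis; rewrite !mult_INR; ring.
  rewrite cgmean_sum csum_RtoC; apply: eq_big_seq => i; rewrite mem_iota => /andP[_ hi].
  rewrite cgmeanZ cgmean_sum Cmod2_conj Cmult_comm; congr Cmult.
  rewrite -(csum_delta (iota 0 m.+1) d i) ?iota_uniq ?mem_iota //.
  apply: eq_big_seq => j; rewrite mem_iota => /andP[_ hj].
  rewrite add0n !ltnS in hi hj.
  rewrite cgmeanZ cgmean_cis ?eqn_pmul2r //.
    by apply: leq_trans hK; rewrite leq_mul2r hj orbT.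
  by apply: leq_trans hK; rewrite leq_mul2r hi orbT.
rewrite cgmean_split in h; case: h => h _; rewrite -h.
apply: (pf_ext _ (gmean_pf K al)) => t.
move: (tpoly d m _) => z; rewrite Cmod_sqr /Re /Im /=; ring.
Qed.

(** The grid size [K0] depends on the degree [n] and not on the coefficients. This uniformity allows
    coefficients that are themselves functions of other variables. *)
Definition two_term (p w : R) : Prop := forall n : nat, exists K0 : nat, forall K al (a : nat -> C) k,
  (K0 <= K)%N -> (0 < k <= n)%N ->
  Cmod (a 0%N) ^ 2 + w * Cmod (a k) ^ 2 <=
    rpow (gmean K al (fun t => rpow (Cmod (tpoly a n t)) p)) (2 / p).

Lemma cis_natmul i t : cis (INR i * t) = Cpow (cis t) i.
Proof.
elim: i => [|i IH]; first by rewrite Rmult_0_l cis0.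
by rewrite S_INR Rmult_plus_distr_r Rmult_1_l cisD IH /=; ring.
Qed.

Lemma csum_geom v m :
  Cmult (Cplus 1 v) (\csum_(i <- iota 0 m) Cpow (Copp v) i) = Cminus 1 (Cpow (Copp v) m).
Proof.
elim: m => [|m IH]; first by rewrite big_nil /=; ring.
rewrite -addn1 iotaD big_cat big_seq1 /= Cmult_plus_distr_l IH add0n addn1 /=; ring.
Qed.

Lemma Cmod_1_plus_conj b u : Cmod u = 1 ->
  Cmod (Cplus 1 (Cmult b (Cconj u))) = Cmod (Cplus 1 (Cmult (Cconj b) u)).
Proof.
move=> _; rewrite -Cmod_conj Cplus_conj Cmult_conj Cconj_conj.
by congr (Cmod (Cplus _ _)); apply: C_ext => //=; rewrite Ropp_0.
Qed.

Lemma Cmod_pow v n : Cmod (Cpow v n) = Cmod v ^ n.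
Proof. by elim: n => [|n IH] /=; rewrite ?Cmod_1 // Cmod_mult IH. Qed.

(** Duality against an almost unimodular function. With [b] proportional to [conj(a_k) a_0] the
    pairing equals [(1 + x) a_0], where [x = |b|^2]. The quotient of [1 + b / u] by [1 + conj(b) u]
    has modulus 1 on the circle; its inverse denominator is replaced by ten terms of the geometric
    series, which leaves a trigonometric polynomial of modulus at most [1 + x^5]. *)
Lemma two_term_1 : two_term 1 (1 / 2).
Proof.
move=> n; exists (n + 9 * n)%N => K al a k hK /andP[k0 kn].
have hn : (n <= 2 * K)%N by apply: leq_trans (leq_trans (leq_addr _ _) hK) (leq_pmull _ _).
rewrite (pf_ext _ (gmean_pf K al) _ (fun t => Cmod (tpoly a n t))); last first.
  by move=> t; rewrite rpow1r //; apply: Cmod_ge_0.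
set S := gmean _ _ _.
have S0 : 0 <= S by apply: (pf_ge0 _ (gmean_pf K al)) => t; apply: Cmod_ge_0.
rewrite (_ : 2 / 1 = 2) ?rpow_sqr //; last lra.
have A0 := Cmod_ge_0 (a 0%N); have Ak := Cmod_ge_0 (a k).
have hAk : Cmod (a k) <= S by apply: tpoly_coef_le.
(* If [a k] is this large, the bound of one coefficient by the mean is enough. Otherwise
   [x <= 1 / 2] below, so the truncation error [x ^ 5] is harmless. *)
case: (Rle_dec (2 * Cmod (a 0%N) ^ 2) (Cmod (a k) ^ 2)) => hcase; first by nra.
have hA0 : 0 < Cmod (a 0%N) by case: A0 => // h; exfalso; rewrite -h in hcase; nra.
set A := Cmod (a 0%N) in A0 hcase hA0 *.
set B := Cmod (a k) in Ak hAk hcase *.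
pose b : C := Cmult (RtoC (/ (2 * A ^ 2))) (Cmult (Cconj (a k)) (a 0%N)).
pose x := B ^ 2 / (4 * A ^ 2).
have hA2 : 0 < A ^ 2 by apply: pow_lt.
have hi : 0 < / (2 * A ^ 2) by apply: Rinv_0_lt_compat; lra.
have hb : Cmod b ^ 2 = x.
  rewrite /b !Cmod_mult Cmod_conj Cmod_R Rabs_pos_eq -/A -/B /x; [field; lra|lra].
have hba : Cmult b (a k) = Cmult (RtoC (2 * x)) (a 0%N).
  have -> : Cmult b (a k) = Cmult (Cmult (RtoC (/ (2 * A ^ 2))) (Cmult (a k) (Cconj (a k)))) (a 0%N).
    by rewrite /b; ring.
  rewrite -Cmod2_conj -/B -RtoC_mult; congr (Cmult (RtoC _) _).
  by rewrite /x; field; lra.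
have x0 : 0 <= x by apply: Rdiv_le_0_compat; nra.
have eB : B ^ 2 = 4 * A ^ 2 * x by rewrite /x; field; lra.
have x1 : x <= 1 / 2 by nra.
pose s := fun i => Cpow (Copp (Cconj b)) i.
have hK9 : (n + 9 * k <= 2 * K)%N.
  apply: leq_trans (leq_pmull K (isT : 0 < 2)%N); apply: leq_trans hK.
  by rewrite leq_add2l leq_mul2l kn.
have := cgmean_test K al a n k b s 9 _ isT hK9; rewrite k0 kn => /(_ isT) hT.
have eT : Cplus (Cmult (a 0%N) (Cplus (s 0%N) (Cmult b (s 1%N)))) (Cmult b (Cmult (s 0%N) (a k)))
   = Cmult (RtoC (1 + x)) (a 0%N).
  have -> : s 0%N = RtoC 1 by [].
  have -> : s 1%N = Copp (Cconj b) by rewrite /s /=; ring.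
  rewrite Cmult_1_l hba.
  have -> : Cmult (a 0%N) (Cplus 1 (Cmult b (Copp (Cconj b)))) =
            Cmult (Cminus 1 (Cmult b (Cconj b))) (a 0%N) by ring.
  rewrite -Cmod2_conj hb; apply: C_ext; rewrite /Re /Im /=; ring.
have H1 : A * (1 + x) <= (1 + x ^ 5) * S.
  have -> : A * (1 + x) = Cmod (Cmult (RtoC (1 + x)) (a 0%N)).
    by rewrite Cmod_mult Cmod_R Rabs_pos_eq -/A; [ring|lra].
  rewrite -eT -hT; apply: Rle_trans (cgmean_Cmod _ _ _) _.
  rewrite /S -(pf_scal _ (gmean_pf K al)); apply: (pf_le _ (gmean_pf K al)) => t.
  rewrite Cmod_mult Rmult_comm; apply: Rmult_le_compat_r; first exact: Cmod_ge_0.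
  rewrite Ropp_mult_distr_l_reverse cisN Cmod_mult Cmod_1_plus_conj ?Cmod_cis // -Cmod_mult.
  set u := cis _.
  have -> : tpoly s 9 (INR k * t) = \csum_(i <- iota 0 10) Cpow (Copp (Cmult (Cconj b) u)) i.
    rewrite /tpoly; apply: eq_bigr => i _; rewrite cis_natmul -/u /s.
    by rewrite -Cpow_mult_l; congr Cpow; ring.
  rewrite csum_geom; apply: Rle_trans (Cmod_triangle _ _) _.
  rewrite Cmod_1 Cmod_opp Cmod_pow Cmod_opp Cmod_mult Cmod_conj Cmod_cis Rmult_1_r.
  by rewrite -hb; apply: Req_le; ring.
rewrite eB.
have H2 : (1 + 2 * x) * (1 + x ^ 5) ^ 2 <= (1 + x) ^ 2.
  (* As [(1 + x)^2 - (1 + 2 x) = x^2], a factor [x^2] can be divided out. *)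
  suff : (1 + 2 * x) * (2 * x ^ 3 + x ^ 8) <= 1.
    have := pow2_ge_0 x; nra.
  have y1 : x ^ 3 <= 1 / 8 by have := pow_incr x (1/2) 3 (conj x0 x1); lra.
  have y2 : x ^ 8 <= 1 / 8 by have := pow_incr x (1/2) 8 (conj x0 x1); lra.
  have y3 : 0 <= x ^ 3 by apply: pow_le.
  have y4 : 0 <= x ^ 8 by apply: pow_le.
  nra.
have H3 : (A * (1 + x)) ^ 2 <= ((1 + x ^ 5) * S) ^ 2 by apply: pow_incr; split => //; nra.
have y5 : 0 <= x ^ 5 by apply: pow_le.
have H4 : 0 < (1 + x ^ 5) ^ 2 by apply: pow_lt; lra.
apply: (Rmult_le_reg_l _ _ _ H4).
have -> : (1 + x ^ 5) ^ 2 * S ^ 2 = ((1 + x ^ 5) * S) ^ 2 by ring.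
apply: Rle_trans H3.
have -> : (A * (1 + x)) ^ 2 = A ^ 2 * (1 + x) ^ 2 by ring.
have -> : (1 + x ^ 5) ^ 2 * (A ^ 2 + 1 / 2 * (4 * A ^ 2 * x)) = A ^ 2 * ((1 + 2 * x) * (1 + x ^ 5) ^ 2) by field.
apply: Rmult_le_compat_l => //; lra.
Qed.

(** The ideal factor, for [|v| < 1], is [(1 + v)^(-1/2)]: multiplied by [1 + v] it gives a function
    whose fourth-power mean is exactly [1 + x] with [x = |v|^2]. The first two coefficients are
    those of its binomial series; the third is lowered from [3 / 8] to [3 / 10], because with
    [3 / 8] the analogue of [test43_bound] fails at [x = 4 / 3]. *)
Definition test43 (i : nat) : R :=
  match i with 0%N => 1 | 1%N => - (1 / 2) | 2%N => 3 / 10 | _ => 0 end.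

(* Coefficients of [((1 + v) (1 - v / 2 + 3 v^2 / 10))^2]. *)
Definition test43_sqr (i : nat) : R :=
  match i with
  | 0%N => 1 | 1%N => 1 | 2%N => - (15 / 100) | 3%N => 4 / 10 | 4%N => 34 / 100
  | 5%N => - (12 / 100) | 6%N => 9 / 100 | _ => 0
  end.

(** Since [(1 + x)^4 - (1 + 3x/2)^2 (1 + x) = x^2 (1 + x) (3/4 + x)], a factor [x^2] splits off. The
    two top powers are then lowered by [x <= 4 / 3]. *)
Lemma test43_bound x : 0 <= x <= 4 / 3 ->
  (1 + 3 / 2 * x) ^ 2 * (1 + x + 225 / 10000 * x ^ 2 + 16 / 100 * x ^ 3 + 1156 / 10000 * x ^ 4
    + 144 / 10000 * x ^ 5 + 81 / 10000 * x ^ 6) <= (1 + x) ^ 4.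
Proof.
move=> [h0 h1].
suff : 0 <= x ^ 2 * ((1 + x) * (75 / 100 + x) - (1 + 3 / 2 * x) ^ 2 *
   (225 / 10000 + 16 / 100 * x + 1156 / 10000 * x ^ 2 + 144 / 10000 * x ^ 3 + 81 / 10000 * x ^ 4)).
  lra.
apply: Rmult_le_pos; first nra.
have h2 : 0 <= x ^ 2 by nra.
have h3 : x ^ 3 <= 4 / 3 * x ^ 2 by nra.
have h4 : x ^ 4 <= (4 / 3) ^ 2 * x ^ 2 by nra.
have h5 : 144 / 10000 * x ^ 3 + 81 / 10000 * x ^ 4 <= (144 / 10000 * (4 / 3) + 81 / 10000 * (4 / 3) ^ 2) * x ^ 2 by lra.
apply: Rle_trans (_ : 0 <= (1 + x) * (75 / 100 + x) - (1 + 3 / 2 * x) ^ 2 * (225 / 10000 + 16 / 100 * x + 1492 / 10000 * x ^ 2)) _.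
  have e : (1 + x) * (75 / 100 + x) - (1 + 3 / 2 * x) ^ 2 * (225 / 10000 + 16 / 100 * x + 1492 / 10000 * x ^ 2)
    = 7275 / 10000 + 15225 / 10000 * x + 320175 / 1000000 * x ^ 2 - 8076 / 10000 * x ^ 3 - 3357 / 10000 * x ^ 4.
    field.
  rewrite e.
  have : x ^ 4 <= 4 / 3 * x ^ 3 by nra.
  have : 0 <= x ^ 3 by nra.
  nra.
have : 0 <= (1 + 3 / 2 * x) ^ 2 by apply: pow2_ge_0.
nra.
Qed.

(** The same duality with dual exponent 4. The fourth power of the modulus of the test function is
    the squared modulus of a polynomial, so Parseval computes its mean from [test43_sqr]. The
    scaling of [b] is chosen so that the pairing is again [(1 + x) a_0]. *)
Lemma two_term_43 : two_term (4 / 3) (2 / 3).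
Proof.
move=> n; exists (n + 9 * n)%N => K al a k hK /andP[k0 kn].
have hn : (n <= 2 * K)%N by apply: leq_trans (leq_trans (leq_addr _ _) hK) (leq_pmull _ _).
set S := gmean _ _ _.
have hpf := gmean_pf K al.
have S0 : 0 <= S by apply: (pf_ge0 _ hpf) => t; apply: rpow_ge0.
set T := rpow S (3 / 4).
have T0 : 0 <= T by apply: rpow_ge0.
have eT4 : T ^ 4 = S ^ 3.
  by rewrite -(rpow_nat T 3) // rpow_rpow // -(rpow_nat S 2) //; congr rpow => /=; lra.
have -> : rpow S (2 / (4 / 3)) = T ^ 2.
  by rewrite -(rpow_nat T 1) // rpow_rpow //; congr rpow => /=; field.
have A0 := Cmod_ge_0 (a 0%N); have Ak := Cmod_ge_0 (a k).
have hAk : Cmod (a k) <= T.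
  apply: Rle_trans (tpoly_coef_le K al a n k kn hn) _.
  have h := pf_jensen _ hpf (fun t => Cmod (tpoly a n t)) (4 / 3) (gmean_1 K al) (fun t => Cmod_ge_0 _) ltac:(lra).
  apply: (rpow_le_inv _ _ (4 / 3)) => //; first lra.
    by apply: (pf_ge0 _ hpf) => t; apply: Cmod_ge_0.
  apply: Rle_trans h _; rewrite /T rpow_rpow // (_ : 3 / 4 * (4 / 3) = 1) ?rpow1r //; last lra.
  by apply: Req_le.
(* Here [|a_0|^2 + 2/3 |a_k|^2 <= |a_k|^2]; in the other case [x <= 4 / 3], the range of
   [test43_bound]. *)
case: (Rle_dec (3 * Cmod (a 0%N) ^ 2) (Cmod (a k) ^ 2)) => hcase; first by nra.
have hA0 : 0 < Cmod (a 0%N) by case: A0 => // h; exfalso; rewrite -h in hcase; nra.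
set A := Cmod (a 0%N) in A0 hcase hA0 *.
set B := Cmod (a k) in Ak hAk hcase *.
pose b : C := Cmult (RtoC (2 / (3 * A ^ 2))) (Cmult (Cconj (a k)) (a 0%N)).
pose x := 4 * B ^ 2 / (9 * A ^ 2).
have hA2 : 0 < A ^ 2 by apply: pow_lt.
have hi : 0 < 2 / (3 * A ^ 2) by apply: Rdiv_lt_0_compat; lra.
have hb : Cmod b ^ 2 = x.
  rewrite /b !Cmod_mult Cmod_conj Cmod_R Rabs_pos_eq -/A -/B /x; [field; lra|lra].
have hba : Cmult b (a k) = Cmult (RtoC (3 / 2 * x)) (a 0%N).
  have -> : Cmult b (a k) = Cmult (Cmult (RtoC (2 / (3 * A ^ 2))) (Cmult (a k) (Cconj (a k)))) (a 0%N).
    by rewrite /b; ring.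
  rewrite -Cmod2_conj -/B -RtoC_mult; congr (Cmult (RtoC _) _).
  by rewrite /x; field; lra.
have x0 : 0 <= x by apply: Rdiv_le_0_compat; nra.
have eB : B ^ 2 = 9 / 4 * A ^ 2 * x by rewrite /x; field; lra.
have x1 : x <= 4 / 3 by nra.
pose s := fun i => Cmult (RtoC (test43 i)) (Cpow (Cconj b) i).
pose d := fun i => Cmult (RtoC (test43_sqr i)) (Cpow (Cconj b) i).
have hK2 : (n + 2 * k <= 2 * K)%N.
  apply: leq_trans (leq_pmull K (isT : 0 < 2)%N); apply: leq_trans hK.
  by rewrite leq_add2l leq_mul.
have hK6 : (6 * k <= 2 * K)%N.
  apply: leq_trans (leq_pmull K (isT : 0 < 2)%N); apply: leq_trans hK.
  by apply: leq_trans (leq_addl _ _); rewrite leq_mul.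
have := cgmean_test K al a n k b s 2 _ isT hK2; rewrite k0 kn => /(_ isT) hT.
have eT : Cplus (Cmult (a 0%N) (Cplus (s 0%N) (Cmult b (s 1%N)))) (Cmult b (Cmult (s 0%N) (a k)))
   = Cmult (RtoC (1 + x)) (a 0%N).
  have -> : s 0%N = RtoC 1 by rewrite /s /=; ring.
  have -> : s 1%N = Cmult (RtoC (- (1 / 2))) (Cconj b) by rewrite /s /=; ring.
  rewrite Cmult_1_l hba.
  have -> : Cmult (a 0%N) (Cplus 1 (Cmult b (Cmult (RtoC (- (1 / 2))) (Cconj b)))) =
            Cmult (Cplus 1 (Cmult (RtoC (- (1 / 2))) (Cmult b (Cconj b)))) (a 0%N) by ring.
  rewrite -Cmod2_conj hb; apply: C_ext; rewrite /Re /Im /=; field.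
pose H t := Cmult (Cplus 1 (Cmult b (cis (- INR k * t)))) (tpoly s 2 (INR k * t)).
have eH t : rpow (Cmod (H t)) 4 = Cmod (tpoly d 6 (INR k * t)) ^ 2.
  rewrite (_ : 4 = INR 4) ?rpow_nat; [|exact: Cmod_ge_0|by rewrite /=; lra].
  rewrite /H Ropp_mult_distr_l_reverse cisN Cmod_mult Cmod_1_plus_conj ?Cmod_cis // -Cmod_mult.
  set u := cis _; set v := Cmult (Cconj b) u.
  have ev (g : nat -> R) m : tpoly (fun i => Cmult (RtoC (g i)) (Cpow (Cconj b) i)) m (INR k * t) =
      \csum_(i <- iota 0 m.+1) Cmult (RtoC (g i)) (Cpow v i).
    apply: eq_bigr => i _; rewrite cis_natmul -/u /v Cpow_mult_l; ring.
  rewrite /s /d !ev !big_cons !big_nil; move: v {ev} => [v1 v2].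
  rewrite (_ : 4%N = (2 * 2)%N) // pow_mult; congr (_ ^ 2); rewrite -Cmod_pow; congr Cmod.
  by apply: C_ext; rewrite /test43 /test43_sqr /Re /Im /=; field.
pose N := 1 + x + 225 / 10000 * x ^ 2 + 16 / 100 * x ^ 3 + 1156 / 10000 * x ^ 4
    + 144 / 10000 * x ^ 5 + 81 / 10000 * x ^ 6.
have eN : gmean K al (fun t => rpow (Cmod (H t)) 4) = N.
  have em i : Cmod (d i) ^ 2 = test43_sqr i ^ 2 * x ^ i.
    rewrite /d Cmod_mult Cmod_R Cmod_pow Cmod_conj Rpow_mult_distr pow2_abs -hb.
    by rewrite -!pow_mult Nat.mul_comm.
  rewrite (pf_ext _ hpf _ _ eH) gmean_parseval // (eq_bigr _ (fun i _ => em i)).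
  by rewrite !big_cons big_nil /N /=; field.
have N1 : 1 <= N.
  have := pow_le x 2 x0; have := pow_le x 3 x0; have := pow_le x 4 x0.
  have := pow_le x 5 x0; have := pow_le x 6 x0; rewrite /N; lra.
have H1 : A * (1 + x) <= T * rpow N (/ 4).
  have -> : A * (1 + x) = Cmod (Cmult (RtoC (1 + x)) (a 0%N)).
    by rewrite Cmod_mult Cmod_R Rabs_pos_eq -/A; [ring|lra].
  rewrite -eT -hT; apply: Rle_trans (cgmean_Cmod _ _ _) _.
  rewrite (pf_ext _ hpf _ (fun t => Cmod (tpoly a n t) * Cmod (H t))); last by move=> t; rewrite Cmod_mult.
  apply: Rle_trans (pf_holder _ hpf _ _ (4 / 3) 4 _ _ _ _ _) _; try lra.
  - by move=> t; apply: Cmod_ge_0.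
  - by move=> t; apply: Cmod_ge_0.
  - by rewrite eN /T -/S (_ : / (4 / 3) = 3 / 4); lra.
have H2 : (A * (1 + x)) ^ 4 <= S ^ 3 * N.
  have -> : S ^ 3 * N = (T * rpow N (/ 4)) ^ 4.
    rewrite Rpow_mult_distr eT4 -(rpow_nat (rpow N (/ 4)) 3); last exact: rpow_ge0.
    by rewrite (_ : INR 4 = 4) ?rpow_rootV /=; lra.
  apply: pow_incr; split => //; apply: Rmult_le_pos; lra.
have H3 := test43_bound x (conj x0 x1); rewrite -/N in H3.
have H4 : (A ^ 2 * (1 + 3 / 2 * x)) ^ 2 <= (T ^ 2) ^ 2.
  have -> : (T ^ 2) ^ 2 = S ^ 3 by rewrite -eT4; ring.
  apply: (Rmult_le_reg_r N); first lra.
  apply: Rle_trans H2.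
  have -> : (A * (1 + x)) ^ 4 = A ^ 4 * (1 + x) ^ 4 by ring.
  have -> : (A ^ 2 * (1 + 3 / 2 * x)) ^ 2 * N = A ^ 4 * ((1 + 3 / 2 * x) ^ 2 * N) by ring.
  by apply: Rmult_le_compat_l => //; apply: pow_le.
rewrite eB.
have -> : A ^ 2 + 2 / 3 * (9 / 4 * A ^ 2 * x) = A ^ 2 * (1 + 3 / 2 * x) by field.
apply: Rsqr_incr_0_var; last by apply: pow_le.
by rewrite !Rsqr_pow2.
Qed.

(** * Coefficient inequalities on the polytorus *)

Lemma pf_sum {X I : Type} (E : (X -> R) -> R) (r : seq I) (F : I -> X -> R) :
  positive_functional E ->
  E (fun x => \rsum_(i <- r) F i x) = \rsum_(i <- r) E (F i).
Proof.
move=> hE; elim: r => [|i r IH].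
  rewrite big_nil (pf_ext E hE _ (fun=> 0)) ?pf_0 // => x; by rewrite big_nil.
by rewrite big_cons -IH -(pf_add E hE); apply: (pf_ext E hE) => x; rewrite big_cons.
Qed.

(** Exchanges an l^r norm with the functional, by duality: Hölder in the sum gives [S <= S^(1/q) T],
    and [S^(1/q)] is divided out. *)
Lemma pf_minkowski_lr {X I : Type} (E : (X -> R) -> R) (s : seq I) (G : I -> X -> R) r :
  positive_functional E -> 1 < r -> (forall i x, 0 <= G i x) ->
  \rsum_(i <- s) rpow (E (G i)) r <= rpow (E (fun x => rpow (\rsum_(i <- s) rpow (G i x) r) (/ r))) r.
Proof.
move=> hE hr hG; set T := E (fun x => rpow _ _); set S := \rsum_(i <- s) _.
have hEG i : 0 <= E (G i) by apply: (pf_ge0 E hE).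
have hT : 0 <= T by apply: (pf_ge0 E hE) => x; apply: rpow_ge0.
have : 0 <= S by apply: rsum_ge0 => i _; apply: rpow_ge0.
case=> [hS|<-]; last exact: rpow_ge0.
have hir : 0 < / r by apply: Rinv_0_lt_compat; lra.
have hir1 : / r < 1 by rewrite -Rinv_1; apply: Rinv_lt_contravar; lra.
set q := / (1 - / r).
have hq1 : 1 < q by rewrite /q -{1}Rinv_1; apply: Rinv_lt_contravar; lra.
have hq : / r + / q = 1 by rewrite /q Rinv_inv; lra.
have hrq : (r - 1) * q = r by rewrite /q; field; split; lra.
suff h : S <= rpow S (/ q) * T.
  have e : S = rpow S (/ q) * rpow S (/ r).
    by rewrite -rpowD ?(Rplus_comm (/ q)) ?hq ?rpow1r; lra.
  have hSq := rpow_gt0 S (/ q) hS.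
  have h1 : rpow S (/ r) <= T by apply: (Rmult_le_reg_l (rpow S (/ q))) => //; rewrite -e.
  rewrite -(rpow_rootV S r) //; [|lra|lra].
  by apply: rpow_le => //; [lra|exact: rpow_ge0].
have eS : S = E (fun x => \rsum_(i <- s) G i x * rpow (E (G i)) (r - 1)).
  rewrite pf_sum //; apply: eq_bigr => i _.
  rewrite [RHS](pf_ext E hE _ (fun x => rpow (E (G i)) (r - 1) * G i x)); last by move=> x; apply: Rmult_comm.
  rewrite (pf_scal E hE) -[X in _ = _ * X](rpow1r (E (G i))) // -rpowD //; congr rpow; ring.
rewrite {1}eS /T -(pf_scal E hE); apply: (pf_le E hE) => x.
have h := pf_holder _ (rsum_pf s xpredT) (fun i => G i x) (fun i => rpow (E (G i)) (r - 1)) r q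
  (fun i => hG i x) (fun i => rpow_ge0 _ _) hr hq1 hq.
apply: Rle_trans h _; rewrite Rmult_comm; apply: Rmult_le_compat_r; first exact: rpow_ge0.
apply: Req_le; congr rpow; apply: eq_bigr => i _; by rewrite rpow_rpow ?hrq.
Qed.

(** * Iterated grid means and the factorization of integers *)

Definition upd (th : nat -> R) (p : nat) (t : R) : nat -> R := fun q => if q == p then t else th q.

Definition avg1 K (al : nat -> R) p (G : (nat -> R) -> R) (th : nat -> R) : R :=
  gmean K (al p) (fun t => G (upd th p t)).

(* The head of the list is the innermost mean. *)
Fixpoint avgs K al (l : seq nat) (G : (nat -> R) -> R) : (nat -> R) -> R :=
  if l is p :: l' then avgs K al l' (avg1 K al p G) else G.

Lemma avgs_le K al l G H th : (forall th, G th <= H th) -> avgs K al l G th <= avgs K al l H th.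
Proof.
elim: l G H => //= p l IH G H h; apply: IH => th'.
by apply: (pf_le _ (gmean_pf _ _)).
Qed.

Lemma avgs_ext K al l G H th : (forall th, G th = H th) -> avgs K al l G th = avgs K al l H th.
Proof. by move=> h; apply: Rle_antisym; apply: avgs_le => th'; rewrite h; lra. Qed.

Lemma avgs_pf K al l th : positive_functional (fun G => avgs K al l G th).
Proof.
split; [|..|by move=> f g; apply: avgs_le].
- elim: l => //= p l IH f g; rewrite -IH; apply: avgs_ext => th'.
  exact: (pf_add _ (gmean_pf _ _)).
- elim: l => //= p l IH c f; rewrite -IH; apply: avgs_ext => th'.
  exact: (pf_scal _ (gmean_pf _ _)).
Qed.

Lemma avgs_1 K al l th : avgs K al l (fun=> 1) th = 1.
Proof.
by elim: l => //= p l IH; rewrite -[RHS]IH; apply: avgs_ext => th'; apply: gmean_1.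
Qed.

(** The argument at [n] of the completely multiplicative character that has argument [th p] at each
    prime [p] of [l]. *)
Definition ang (l : seq nat) (th : nat -> R) (n : nat) : R := \rsum_(p <- l) INR (logn p n) * th p.

Lemma angM l th m n : (0 < m)%N -> (0 < n)%N -> ang l th (m * n) = ang l th m + ang l th n.
Proof.
move=> hm hn; rewrite /ang -big_split /=; apply: eq_bigr => p _.
rewrite lognM // plus_INR; ring.
Qed.

Lemma ang_1 l th : ang l th 1 = 0.
Proof. by rewrite /ang big1 // => p _; rewrite logn1 Rmult_0_l. Qed.

Lemma ang_upd l th p t n : p \notin l -> ang l (upd th p t) n = ang l th n.
Proof.
move=> hp; apply: eq_big_seq => q hq; rewrite /upd; case: eqP => // eq; by rewrite eq (negbTE hp) in hq.
Qed.

Lemma ang_cons_upd l th p t n : p \notin l ->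
  ang (p :: l) (upd th p t) n = INR (logn p n) * t + ang l th n.
Proof. by move=> hp; rewrite /ang big_cons {1}/upd eqxx -/(ang l (upd th p t) n) ang_upd. Qed.

Definition smooth (l : seq nat) (n : nat) : bool := all [in l] (primes n).

Lemma smooth_nil n : (0 < n)%N -> smooth [::] n = (n == 1%N).
Proof.
move=> hn; apply/idP/eqP => [h|->//].
apply/eqP; rewrite eqn_leq hn andbT leqNgt; apply/negP => h1.
have := allP h (pdiv n); rewrite mem_primes pdiv_prime // hn pdiv_dvd => /(_ isT).
by rewrite in_nil.
Qed.

Lemma smooth_logn p l m : prime p -> p \notin l -> smooth l m -> logn p m = 0%N.
Proof.
move=> pp hp /allP h; apply/eqP; rewrite -leqn0 leqNgt logn_gt0; apply/negP => /h; exact/negP.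
Qed.

Lemma logn_expM p m k : prime p -> (0 < m)%N -> logn p m = 0%N -> logn p (p ^ k * m) = k.
Proof.
by move=> pp hm h; rewrite lognM // ?expn_gt0 ?prime_gt0 // h addn0 pfactorK.
Qed.

Lemma logn_expM_neq p q m k : prime p -> prime q -> q != p -> (0 < m)%N ->
  logn q (p ^ k * m) = logn q m.
Proof.
move=> pp pq hqp hm; rewrite lognM // ?expn_gt0 ?prime_gt0 // lognX.
by rewrite logn_prime // (negbTE hqp) muln0.
Qed.

(** Unique factorization [n = p^k m]. As [F] vanishes beyond [N], both factors may run over full
    ranges, and the range of [m] does not depend on [k]. *)
Lemma big_smooth_split (V : Type) (idx : V) (op : Monoid.com_law idx) (N p : nat) l (F : nat -> V) :
  prime p -> p \notin l -> (forall n, (N < n)%N -> F n = idx) ->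
  \big[op/idx]_(n <- iota 1 N | smooth (p :: l) n) F n =
  \big[op/idx]_(k <- iota 0 N.+1) \big[op/idx]_(m <- iota 1 N | smooth l m) F (p ^ k * m)%N.
Proof.
move=> pp hp hF.
have step k : \big[op/idx]_(m <- iota 1 N | smooth l m) F (p ^ k * m)%N =
    \big[op/idx]_(n <- iota 1 N | smooth (p :: l) n && (logn p n == k)) F n.
  rewrite (bigID (fun m => (p ^ k * m <= N)%N)) /= [X in op _ X]big1 ?Monoid.mulm1; last first.
    by move=> m /andP[_]; rewrite -ltnNge => /hF.
  rewrite -big_filter -[RHS]big_filter -(big_map (fun m => p ^ k * m)%N xpredT F).
  have pk : (0 < p ^ k)%N by rewrite expn_gt0 prime_gt0.
  apply: perm_big; apply: uniq_perm.
  - rewrite map_inj_in_uniq ?filter_uniq ?iota_uniq // => x y _ _ /eqP.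
    by rewrite eqn_pmul2l // => /eqP.
  - by rewrite filter_uniq ?iota_uniq.
  move=> n; rewrite mem_filter mem_iota; apply/mapP/idP.
  - case=> m; rewrite mem_filter mem_iota => /andP[/andP[hs hN] /andP[hm _]] ->.
    rewrite logn_expM // ?(smooth_logn _ l) // eqxx andbT muln_gt0 pk hm add1n ltnS hN /= andbT.
    apply/allP => q; rewrite mem_primes => /and3P[pq _ hd].
    rewrite inE; case: eqP => //= /eqP hqp; apply: (allP hs).
    rewrite mem_primes pq hm /=.
    move: hd; rewrite Gauss_dvdr // coprimeXr // prime_coprime // dvdn_prime2 //.
  - move=> /andP[/andP[hs /eqP hk]]; rewrite add1n ltnS => /andP[hn hN].
    have [] := pfactor_coprime pp hn => m hc en.
    rewrite hk in en.
    have hm : (0 < m)%N by move: hn; rewrite en muln_gt0 => /andP[].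
    exists m; last by rewrite en mulnC.
    rewrite mem_filter mem_iota hm add1n ltnS /= mulnC -en hN /=.
    apply/andP; split; last by apply: leq_trans hN; rewrite en leq_pmulr.
    rewrite andbT; apply/allP => q; rewrite mem_primes => /and3P[pq _ hd].
    have : q \in primes n by rewrite mem_primes pq hn en dvdn_mulr.
    move/(allP hs); rewrite inE => /orP[/eqP eq|//].
    by move: hc; rewrite prime_coprime // -eq hd.
rewrite (eq_bigr _ (fun k _ => step k)) (exchange_big_dep (smooth (p :: l))) /=; last by move=> k n _ /andP[].
rewrite big_seq_cond [RHS]big_seq_cond; apply: eq_bigr => n /andP[hin hs].
have /andP[hn hN] : (1 <= n < 1 + N)%N by rewrite -mem_iota.
rewrite -big_filter (eq_filter (a2 := pred1 (logn p n))); last by move=> k; rewrite /= hs eq_sym.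
rewrite -[0%N :: _]/(iota 0 N.+1) filter_pred1_uniq ?iota_uniq ?big_seq1 // mem_iota add0n ltnS /=.
apply: leq_trans (_ : logn p n <= n)%N _; last by rewrite add1n ltnS in hN.
exact: ltnW (ltn_logl _ hn).
Qed.

Definition coef_ineq (p : R) (w : nat -> R) : Prop := forall n : nat, exists K0 : nat,
  forall K al (a : nat -> C), (K0 <= K)%N ->
  \rsum_(k <- iota 0 n.+1) w k * Cmod (a k) ^ 2 <=
    rpow (gmean K al (fun t => rpow (Cmod (tpoly a n t)) p)) (2 / p).

(* The two-term inequalities are averaged over [k] with the weights [lam k]. *)
Lemma two_term_coef_ineq p w1 (w lam : nat -> R) : two_term p w1 -> 0 <= w1 ->
  w 0%N = 1 -> (forall k, (0 < k)%N -> w k = w1 * lam k) -> (forall k, 0 <= lam k) ->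
  (forall n, \rsum_(k <- iota 1 n) lam k <= 1) -> coef_ineq p w.
Proof.
move=> ht hw1 hw0 hw hlam hsum n; have [K0 hK0] := ht n.+1.
exists K0 => K al a hK.
pose a' k := if (k <= n)%N then a k else RtoC 0.
have ea : forall t, tpoly a' n.+1 t = tpoly a n t.
  move=> t; rewrite /tpoly -(addn1 n.+1) iotaD big_cat big_seq1 add0n {2}/a' ltnn Cmult_0_l Monoid.mulm1.
  by apply: eq_big_seq => k; rewrite mem_iota /a' add0n ltnS => /andP[_ ->].
have := hK0 K al a' _ hK; set S := rpow _ _.
have -> : rpow (gmean K al (fun t => rpow (Cmod (tpoly a n t)) p)) (2 / p) = S.
  by congr rpow; apply: (pf_ext _ (gmean_pf K al)) => t; rewrite ea.
move=> h.
have h0 : Cmod (a 0%N) ^ 2 <= S.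
  have := h 1%N isT; rewrite /a' leq0n; have : 0 <= w1 * Cmod (if (1 <= n)%N then a 1%N else 0) ^ 2.
    by apply: Rmult_le_pos => //; apply: pow2_ge_0.
  lra.
rewrite -[iota 0 n.+1]/(0%N :: iota 1 n) big_cons hw0 Rmult_1_l.
have h1 : \rsum_(k <- iota 1 n) w k * Cmod (a k) ^ 2
       <= \rsum_(k <- iota 1 n) (S - Cmod (a 0%N) ^ 2) * lam k.
  apply: rsum_le_seq => k; rewrite mem_iota add1n ltnS => /andP[k0 kn].
  have := h k; rewrite /a' k0 leq0n kn (leqW kn) => /(_ isT) hk.
  rewrite hw //; have := hlam k; nra.
have e1 : \rsum_(k <- iota 1 n) (S - Cmod (a 0%N) ^ 2) * lam k = (S - Cmod (a 0%N) ^ 2) * \rsum_(k <- iota 1 n) lam k.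
  by rewrite big_distrr.
have h2 : 0 <= (S - Cmod (a 0%N) ^ 2) * (1 - \rsum_(k <- iota 1 n) lam k).
  by apply: Rmult_le_pos; have := hsum n; lra.
rewrite e1 in h1; lra.
Qed.

Definition wprod (w : nat -> R) (l : seq nat) (n : nat) : R := \big[Rmult/1]_(p <- l) w (logn p n).

Lemma wprod_expM w p l k m : prime p -> all prime l -> p \notin l -> (0 < m)%N -> smooth l m ->
  wprod w (p :: l) (p ^ k * m) = w k * wprod w l m.
Proof.
move=> pp pl hp hm hs; rewrite /wprod big_cons logn_expM ?(smooth_logn _ l) //; congr Rmult.
apply: eq_big_seq => q hq; rewrite logn_expM_neq //; first exact: (allP pl).
by apply: contraNneq hp => <-.
Qed.

Lemma ang_expM th p l k m : prime p -> all prime l -> p \notin l -> (0 < m)%N ->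
  ang l th (p ^ k * m) = ang l th m.
Proof.
move=> pp pl hp hm; apply: eq_big_seq => q hq; rewrite logn_expM_neq //; first exact: (allP pl).
by apply: contraNneq hp => <-.
Qed.

Definition dtorus (A : nat -> C) (N : nat) (l : seq nat) (th : nat -> R) : C :=
  \csum_(n <- iota 1 N | smooth l n) Cmult (A n) (cis (ang l th n)).

Lemma dtorus_cons A N p l th t : prime p -> all prime l -> p \notin l ->
  (forall n, (N < n)%N -> A n = RtoC 0) ->
  dtorus A N (p :: l) (upd th p t) = tpoly (fun k => dtorus (fun m => A (p ^ k * m)%N) N l th) N t.
Proof.
move=> pp pl hp hA; rewrite /dtorus big_smooth_split //; last by move=> n /hA ->; apply: Cmult_0_l.
apply: eq_bigr => k _; rewrite big_distrl /= big_seq_cond [RHS]big_seq_cond.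
apply: eq_bigr => m /andP[]; rewrite mem_iota => /andP[hm _] hs.
rewrite ang_cons_upd // logn_expM ?(smooth_logn _ l) // ang_expM // Rplus_comm cisD.
by rewrite Cmult_assoc.
Qed.

(** Induction on the primes. The induction hypothesis bounds each slice [A (q ^ k * _)] in the
    remaining variables; [pf_minkowski_lr] moves the sum over [k] inside their mean, where the
    one-variable inequality holds pointwise. Its exponent [2 / p] exceeds 1 because [p < 2]. *)
Lemma coef_ineq_torus p w l : coef_ineq p w -> 0 < p < 2 -> (forall k, 0 <= w k) -> w 0%N = 1 ->
  all prime l -> uniq l ->
  forall N, (0 < N)%N -> exists K0, forall K al A th, (K0 <= K)%N ->
    (forall n, (N < n)%N -> A n = RtoC 0) ->
    \rsum_(n <- iota 1 N | smooth l n) wprod w l n * Cmod (A n) ^ 2 <=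
      rpow (avgs K al l (fun th => rpow (Cmod (dtorus A N l th)) p) th) (2 / p).
Proof.
move=> hw hp w_ge0 w0 pl ul N hN; have [K0 hK0] := hw N; exists K0 => K al.
have hp2 : p * (2 / p) = 2 by field; lra.
move=> A th hK; elim: l pl ul A th => [|q l IH] pl ul A th hA.
  have e1 (V : Type) (idx : V) (op : Monoid.com_law idx) (F : nat -> V) :
      \big[op/idx]_(n <- iota 1 N | smooth [::] n) F n = F 1%N.
    rewrite -(prednK hN) -[iota 1 _]/(1%N :: iota 2 _) big_cons /= big1_seq ?Monoid.mulm1 //.
    move=> n /andP[hs]; rewrite mem_iota => /andP[h2 _].
    by rewrite smooth_nil in hs; [rewrite (eqP hs) in h2|apply: leq_trans h2].
  rewrite e1 /wprod big_nil Rmult_1_l /= /dtorus e1 ang_1 cis0 Cmult_1_r.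
  by rewrite rpow_rpow ?hp2 ?rpow_sqr; [right|apply: Cmod_ge_0..].
move: pl ul => /= /andP[pq pl] /andP[hq ul].
have hexp n : (N < n)%N -> wprod w (q :: l) n * Cmod (A n) ^ 2 = 0.
  by move=> /hA ->; rewrite Cmod_0; ring.
rewrite big_smooth_split //.
pose F k th := dtorus (fun m => A (q ^ k * m)%N) N l th.
pose E G := avgs K al l G th; have hE : positive_functional E by apply: avgs_pf.
have hAk k n : (N < n)%N -> A (q ^ k * n)%N = RtoC 0.
  by move=> hn; apply: hA; apply: leq_trans hn (leq_pmull _ _); rewrite expn_gt0 prime_gt0.
apply: Rle_trans (_ : \rsum_(k <- iota 0 N.+1) rpow (E (fun th => rpow (w k) (p / 2) * rpow (Cmod (F k th)) p)) (2 / p) <= _).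
  apply: rsum_le => k _.
  rewrite (pf_scal E hE) rpowM; [|exact: rpow_ge0|by apply: (pf_ge0 E hE) => th'; apply: rpow_ge0].
  rewrite rpow_rpow // (_ : p / 2 * (2 / p) = 1) ?rpow1r //; last by field; lra.
  apply: Rle_trans (Rmult_le_compat_l _ _ _ (w_ge0 k) (IH pl ul (fun m => A (q ^ k * m)%N) th (hAk k))).
  rewrite big_distrr /=; apply: Req_le.
  rewrite big_seq_cond [RHS]big_seq_cond; apply: eq_bigr => m /andP[]; rewrite mem_iota => /andP[hm _] hs.
  by rewrite wprod_expM // Rmult_assoc.
have hr : 1 < 2 / p by apply: (Rmult_lt_reg_l p); lra.
apply: Rle_trans (pf_minkowski_lr E _ _ _ hE hr _) _.
  by move=> k th'; apply: Rmult_le_pos; apply: rpow_ge0.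
apply: rpow_le; first lra.
  by apply: (pf_ge0 E hE) => th'; apply: rpow_ge0.
apply: avgs_le => th'; rewrite /avg1.
have e : / (2 / p) = p / 2 by field; lra.
rewrite (pf_ext _ (gmean_pf K (al q)) _ (fun t => rpow (Cmod (tpoly (F^~ th') N t)) p)); last first.
  by move=> t; rewrite dtorus_cons.
set S := gmean _ _ _.
have hS : 0 <= S by apply: (pf_ge0 _ (gmean_pf K (al q))) => t; apply: rpow_ge0.
rewrite -[X in _ <= X](rpow_root S (2 / p)) //; last lra.
apply: rpow_le; first by rewrite e; lra.
  by apply: rsum_ge0 => k _; apply: rpow_ge0.
apply: Rle_trans (hK0 K (al q) (F^~ th') hK).
apply: Req_le; apply: eq_bigr => k _.
have e3 : p / 2 * (2 / p) = 1 by field; lra.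
have hc := Cmod_ge_0 (F k th'); move: (Cmod _) hc => c hc.
rewrite rpowM; [|exact: rpow_ge0..].
rewrite (rpow_rpow (w k)); last exact: w_ge0.
by rewrite e3 rpow1r ?(rpow_rpow c) ?hp2 ?rpow_sqr.
Qed.

(** * Bohr correspondence *)

(** Makes [R] an eqType, so that membership in a list of trigonometric terms makes sense. *)
Lemma Req_axiom : Equality.axiom (fun x y : R => if Req_EM_T x y then true else false).
Proof. by move=> x y; case: Req_EM_T => h; constructor. Qed.
HB.instance Definition _ := hasDecEq.Build R Req_axiom.

(** A frequency on the torus may be negative, so it is encoded by a pair [(n, m)] standing for the
    fraction [n / m]. *)
Definition tp_term (l : seq nat) (th : nat -> R) (i : R * R * (nat * nat)) : R :=
  i.1.1 * cos (i.1.2 + (ang l th i.2.1 - ang l th i.2.2)).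

Definition tp_index (l : seq nat) (k n : nat) : bool :=
  [&& (0 < n)%N, smooth l n & all (fun p => (logn p n <= k)%N) l].

(** The bound [k] on the exponents of each prime decides which grids average the polynomial
    exactly. *)
Definition trigpoly (l : seq nat) (k : nat) (G : (nat -> R) -> R) : Prop :=
  exists2 s : seq (R * R * (nat * nat)),
    all (fun i => tp_index l k i.2.1 && tp_index l k i.2.2) s
  & forall th, G th = \rsum_(i <- s) tp_term l th i.

Lemma trigpoly_ext l k G H : (forall th, H th = G th) -> trigpoly l k G -> trigpoly l k H.
Proof. by move=> h [s hs e]; exists s => // th; rewrite h. Qed.

Lemma tp_index1 l k : tp_index l k 1.
Proof. by apply/and3P; split => //; apply/allP => p _; rewrite logn1. Qed.

Lemma tp_indexM l k1 k2 m n : tp_index l k1 m -> tp_index l k2 n -> tp_index l (k1 + k2) (m * n).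
Proof.
move=> /and3P[m0 sm lm] /and3P[n0 sn ln]; apply/and3P; split; first by rewrite muln_gt0 m0.
  apply/allP => p; rewrite mem_primes => /and3P[pp _]; rewrite Euclid_dvdM // => /orP[] hd.
    by apply: (allP sm); rewrite mem_primes pp m0.
  by apply: (allP sn); rewrite mem_primes pp n0.
apply/allP => p hp; rewrite lognM //; apply: leq_add; [exact: (allP lm)|exact: (allP ln)].
Qed.

Lemma trigpoly_const l k c : trigpoly l k (fun=> c).
Proof.
exists [:: (c, 0, (1, 1)%N)]; first by rewrite /= tp_index1.
by move=> th; rewrite big_seq1 /tp_term /= Rminus_diag Rplus_0_r cos_0 Rmult_1_r.
Qed.

Lemma trigpolyD l k G H : trigpoly l k G -> trigpoly l k H -> trigpoly l k (fun th => G th + H th).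
Proof.
move=> [s hs eG] [t ht eH]; exists (s ++ t); first by rewrite all_cat hs.
by move=> th; rewrite big_cat eG eH.
Qed.

Lemma trigpolyM l k1 k2 G H :
  trigpoly l k1 G -> trigpoly l k2 H -> trigpoly l (k1 + k2) (fun th => G th * H th).
Proof.
move=> [s hs eG] [t ht eH].
pose f1 (i j : R * R * (nat * nat)) :=
  (i.1.1 * j.1.1 / 2, i.1.2 + j.1.2, (i.2.1 * j.2.1, i.2.2 * j.2.2)%N).
pose f2 (i j : R * R * (nat * nat)) :=
  (i.1.1 * j.1.1 / 2, i.1.2 - j.1.2, (i.2.1 * j.2.2, i.2.2 * j.2.1)%N).
have hij i j : i \in s -> j \in t -> 
   [/\ tp_index l k1 i.2.1, tp_index l k1 i.2.2, tp_index l k2 j.2.1 & tp_index l k2 j.2.2].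
  by move=> /(allP hs)/andP[-> ->] /(allP ht)/andP[-> ->].
exists ([seq f1 i j | i <- s, j <- t] ++ [seq f2 i j | i <- s, j <- t]).
  rewrite all_cat; apply/andP; split; apply/allP => x /allpairsP [[i j] /= [hi hj ->]];
  by have [? ? ? ?] := hij i j hi hj; apply/andP; split; apply: tp_indexM.
move=> th; rewrite big_cat /= !big_allpairs_dep /= -big_split /= eG eH.
rewrite big_distrl /=; rewrite big_seq [RHS]big_seq; apply: eq_bigr => i hi.
rewrite big_distrr /= -big_split /=; rewrite big_seq [RHS]big_seq; apply: eq_bigr => j hj.
have [/and3P[a1 _ _] /and3P[a2 _ _] /and3P[b1 _ _] /and3P[b2 _ _]] := hij i j hi hj.
rewrite /tp_term /= !angM //.
set A := i.1.2 + (ang l th i.2.1 - ang l th i.2.2).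
set B := j.1.2 + (ang l th j.2.1 - ang l th j.2.2).
have -> : i.1.2 + j.1.2 + (ang l th i.2.1 + ang l th j.2.1 - (ang l th i.2.2 + ang l th j.2.2)) = A + B.
  by rewrite /A /B; ring.
have -> : i.1.2 - j.1.2 + (ang l th i.2.1 + ang l th j.2.2 - (ang l th i.2.2 + ang l th j.2.1)) = A - B.
  by rewrite /A /B; ring.
rewrite cos_plus cos_minus; field.
Qed.

Lemma trigpoly_sum (I : eqType) (r : seq I) (P : pred I) l k (F : I -> (nat -> R) -> R) :
  (forall i, i \in r -> P i -> trigpoly l k (F i)) -> trigpoly l k (fun th => \rsum_(i <- r | P i) F i th).
Proof.
elim: r => [|i r IH] h.
  by apply: trigpoly_ext (trigpoly_const l k 0) => th; rewrite big_nil.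
have hr : trigpoly l k (fun th => \rsum_(i <- r | P i) F i th).
  by apply: IH => j hj; apply: h; rewrite inE hj orbT.
case hP : (P i).
  apply: trigpoly_ext (trigpolyD _ _ _ _ (h i (mem_head _ _) hP) hr) => th.
  by rewrite big_cons hP.
by apply: trigpoly_ext hr => th; rewrite big_cons hP.
Qed.

Lemma trigpoly_pow l k G n : trigpoly l k G -> trigpoly l (n * k) (fun th => G th ^ n).
Proof.
move=> hG; elim: n => [|n IH]; first exact: trigpoly_const.
exact: (trigpolyM _ _ _ _ _ hG IH).
Qed.

Lemma avgs_cos K al l x n m th : uniq l -> 
  {in l, forall p, logn p n <= 2 * K /\ logn p m <= 2 * K}%N ->
  avgs K al l (fun th => cos (x + (ang l th n - ang l th m))) th =
  if all (fun p => logn p n == logn p m) l then cos x else 0.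
Proof.
elim: l th => [|p l IH] th /=; first by rewrite /ang !big_nil Rminus_diag Rplus_0_r.
move=> /andP[hp ul] hK.
have [hn hm] := hK p (mem_head _ _).
have hK' : {in l, forall p, logn p n <= 2 * K /\ logn p m <= 2 * K}%N.
  by move=> q hq; apply: hK; rewrite inE hq orbT.
have e th' : avg1 K al p (fun th => cos (x + (ang (p :: l) th n - ang (p :: l) th m))) th' =
    if logn p n == logn p m then cos (x + (ang l th' n - ang l th' m)) else 0.
  rewrite -(gmean_cos K (al p)) //; apply: (pf_ext _ (gmean_pf _ _)) => t.
  by rewrite !ang_cons_upd //; congr cos; ring.
rewrite (avgs_ext _ _ _ _ _ _ e); case: eqP => _ /=; first exact: IH.
exact: (pf_0 _ (avgs_pf K al l th)).
Qed.

(** The constant term: the common value of the means over fine grids and of the limit of the means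
    along the line. *)
Definition tp_mean (s : seq (R * R * (nat * nat))) : R :=
  \rsum_(i <- s) (i.1.1 * if i.2.1 == i.2.2 then cos i.1.2 else 0).

Lemma smooth_eqn l n m : (0 < n)%N -> (0 < m)%N -> smooth l n -> smooth l m ->
  all (fun p => logn p n == logn p m) l = (n == m).
Proof.
move=> n0 m0 sn sm; apply/idP/eqP => [h|->]; last by apply/allP.
apply: eqn_from_log => // p; case: (boolP (p \in l)) => [hp|hp]; first exact/eqP/(allP h).
have aux k : smooth l k -> logn p k = 0%N.
  move=> hk; apply/eqP; rewrite -leqn0 leqNgt logn_gt0; apply/negP => /(allP hk); exact/negP.
by rewrite !aux.
Qed.

Lemma avgs_tp K al l k s th : uniq l -> (k <= 2 * K)%N ->
  all (fun i => tp_index l k i.2.1 && tp_index l k i.2.2) s ->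
  avgs K al l (fun th => \rsum_(i <- s) tp_term l th i) th = tp_mean s.
Proof.
move=> ul hk hs; rewrite (pf_sum _ s (fun i th => tp_term l th i) (avgs_pf K al l th)).
apply: eq_big_seq => i /(allP hs)/andP[/and3P[a1 a2 a3] /and3P[b1 b2 b3]].
rewrite (pf_scal _ (avgs_pf K al l th)) avgs_cos // ?smooth_eqn // => p hp.
by split; apply: leq_trans hk; [apply: (allP a3)|apply: (allP b3)].
Qed.

(** * Means along the vertical line *)

Definition tmean (f : R -> R) (mu : R) : Prop :=
  (* Convergence is part of this statement, whereas [Lim] in [hp_norm_poly] returns a value in every
     case. *)
  forall eps, 0 < eps -> exists T0, 0 < T0 /\
    forall T, T0 < T -> Rabs (/ (2 * T) * RInt f (- T) T - mu) < eps.

Lemma tmean_const c : tmean (fun=> c) c.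
Proof.
move=> eps he; exists 1; split => [|T hT]; first lra.
rewrite RInt_const /scal /= /mult /=.
have -> : / (2 * T) * ((T - - T) * c) - c = 0 by field; lra.
by rewrite Rabs_R0.
Qed.

Lemma tmean_ext f g mu : (forall t, f t = g t) -> tmean f mu -> tmean g mu.
Proof.
move=> h hf eps /hf [T0 [h0 hT0]]; exists T0; split => // T /hT0.
by rewrite (RInt_ext f g) // => t _.
Qed.

Lemma tmeanD f g a b : (forall t, continuous f t) -> (forall t, continuous g t) ->
  tmean f a -> tmean g b -> tmean (fun t => f t + g t) (a + b).
Proof.
move=> cf cg hf hg eps he.
have [T1 [p1 h1]] := hf (eps / 2) ltac:(lra); have [T2 [p2 h2]] := hg (eps / 2) ltac:(lra).
exists (Rmax T1 T2); split; first exact: Rlt_le_trans p1 (Rmax_l _ _).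
move=> T hT.
have := h1 T (Rle_lt_trans _ _ _ (Rmax_l _ _) hT); have := h2 T (Rle_lt_trans _ _ _ (Rmax_r _ _) hT).
have -> : RInt (fun t => f t + g t) (- T) T = RInt f (- T) T + RInt g (- T) T.
  by apply: RInt_plus; apply: ex_RInt_continuous => t _.
set A := _ * RInt f _ _; set B := _ * RInt g _ _ => hB hA.
have -> : / (2 * T) * (RInt f (- T) T + RInt g (- T) T) - (a + b) = (A - a) + (B - b).
  by rewrite /A /B; ring.
apply: Rle_lt_trans (Rabs_triang _ _) _; lra.
Qed.

Lemma tmeanZ f a c : (forall t, continuous f t) -> tmean f a -> tmean (fun t => c * f t) (c * a).
Proof.
move=> cf hf eps he.
have hc : 0 < Rabs c + 1 by have := Rabs_pos c; lra.
have [T1 [p1 h1]] := hf (eps / (Rabs c + 1)) ltac:(apply: Rdiv_lt_0_compat; lra).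
exists T1; split => // T hT; have := h1 T hT.
have -> : RInt (fun t => c * f t) (- T) T = c * RInt f (- T) T.
  by apply: (RInt_scal f); apply: ex_RInt_continuous => t _.
set A := _ * RInt f _ _ => hA.
have -> : / (2 * T) * (c * RInt f (- T) T) - c * a = c * (A - a) by rewrite /A; ring.
rewrite Rabs_mult.
apply: Rle_lt_trans (_ : (Rabs c + 1) * Rabs (A - a) < _); first by have := Rabs_pos (A - a); nra.
have := Rmult_lt_compat_l _ _ _ hc hA.
by have -> : (Rabs c + 1) * (eps / (Rabs c + 1)) = eps by field; lra.
Qed.

Lemma tmean_cos x lam : lam <> 0 -> tmean (fun t => cos (x + lam * t)) 0.
Proof.
move=> hl eps he.
have hal : 0 < Rabs lam by apply: Rabs_pos_lt.
exists (/ (eps * Rabs lam)); have hel : 0 < eps * Rabs lam by apply: Rmult_lt_0_compat.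
split => [|T hT]; first exact: Rinv_0_lt_compat.
have T0 : 0 < T by apply: Rlt_trans hT; apply: Rinv_0_lt_compat.
have -> : RInt (fun t => cos (x + lam * t)) (- T) T = (sin (x + lam * T) - sin (x + lam * - T)) / lam.
  apply: is_RInt_unique.
  have -> : (sin (x + lam * T) - sin (x + lam * - T)) / lam =
    minus (sin (x + lam * T) / lam) (sin (x + lam * - T) / lam) by rewrite /minus /plus /opp /=; field.
  apply: (is_RInt_derive (fun t => sin (x + lam * t) / lam)) => t _.
    by auto_derive => //; field.
  apply: continuous_comp; last exact: continuous_cos.
  by apply: (ex_derive_continuous (fun t => x + lam * t)); auto_derive.
rewrite Rminus_0_r Rabs_mult Rabs_div // (Rabs_pos_eq (/ (2 * T))); last by apply/Rlt_le/Rinv_0_lt_compat; lra.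
have h2 : Rabs (sin (x + lam * T) - sin (x + lam * - T)) <= 2.
  have := SIN_bound (x + lam * T); have := SIN_bound (x + lam * - T).
  move=> h1 h3; apply: Rabs_le; lra.
apply: Rle_lt_trans (_ : / (2 * T) * (2 / Rabs lam) < _).
  apply: Rmult_le_compat_l; first by apply/Rlt_le/Rinv_0_lt_compat; lra.
  by apply: Rmult_le_compat_r => //; apply/Rlt_le/Rinv_0_lt_compat.
have -> : / (2 * T) * (2 / Rabs lam) = / (T * Rabs lam) by field; lra.
have h3 : 1 < T * (eps * Rabs lam).
  have := Rmult_lt_compat_r _ _ _ hel hT; rewrite Rinv_l; lra.
apply: (Rmult_lt_reg_r (T * Rabs lam)); first exact: Rmult_lt_0_compat.
rewrite Rinv_l; [lra|]; by apply: Rgt_not_eq; apply: Rmult_lt_0_compat.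
Qed.

(* The Kronecker flow: at these angles [cis (ang l _ n) = n^(-it)]. *)
Definition flow (t : R) : nat -> R := fun p => - t * ln (INR p).

Lemma INR_gt0 n : (0 < n)%N -> 0 < INR n.
Proof. by move=> h; apply: lt_0_INR; apply/ltP. Qed.

Lemma ln_smooth l n : uniq l -> all prime l -> (0 < n)%N -> smooth l n ->
  \rsum_(p <- l) INR (logn p n) * ln (INR p) = ln (INR n).
Proof.
elim: l n => [|p l IH] n /=.
  move=> _ _ hn; rewrite smooth_nil // => /eqP ->; rewrite big_nil /=; by rewrite ln_1.
move=> /andP[hp ul] /andP[pp pl] hn hs.
have [m hc en] := pfactor_coprime pp hn.
have hm : (0 < m)%N by move: hn; rewrite en muln_gt0 => /andP[].
have sm : smooth l m.
  apply/allP => q; rewrite mem_primes => /and3P[pq _ hd].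
  have : q \in primes n by rewrite mem_primes pq hn en dvdn_mulr.
  move/(allP hs); rewrite inE => /orP[/eqP eq|//].
  by move: hc; rewrite prime_coprime // -eq hd.
have hpk : (0 < p ^ logn p n)%N by rewrite expn_gt0 prime_gt0.
rewrite big_cons [in RHS]en mult_INR ln_mult; [|exact: INR_gt0..].
rewrite -(IH m) // Rplus_comm; congr Rplus.
  apply: eq_big_seq => q hq; congr (INR _ * _).
  rewrite en mulnC logn_expM_neq //; first exact: (allP pl).
  by apply: contraNneq hp => <-.
elim: (logn p n) => [|k IHk]; first by rewrite expn0 /= ln_1 Rmult_0_l.
have hpk' : (0 < p ^ k)%N by rewrite expn_gt0 prime_gt0.
rewrite expnS mult_INR ln_mult; [|exact/INR_gt0/prime_gt0|exact: INR_gt0].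
by rewrite -IHk S_INR; ring.
Qed.

Lemma ang_flow l t n : uniq l -> all prime l -> (0 < n)%N -> smooth l n ->
  ang l (flow t) n = - t * ln (INR n).
Proof.
move=> ul pl hn sn; rewrite -(ln_smooth l n) // big_distrr /=.
by apply: eq_bigr => p _; rewrite /flow; ring.
Qed.

Lemma continuous_cos_affine c x lam t : continuous (fun t => c * cos (x + lam * t)) t.
Proof. by apply: (ex_derive_continuous (fun t => c * cos (x + lam * t))); auto_derive. Qed.

(** Distinct [n] and [m] have distinct logarithms, so along [flow] every term with [n <> m]
    oscillates with nonzero frequency and averages out. *)
Lemma tmean_tp l k s : uniq l -> all prime l ->
  all (fun i => tp_index l k i.2.1 && tp_index l k i.2.2) s ->
  (forall t, continuous (fun t => \rsum_(i <- s) tp_term l (flow t) i) t) /\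
  tmean (fun t => \rsum_(i <- s) tp_term l (flow t) i) (tp_mean s).
Proof.
move=> ul pl; elim: s => [|i s IH] /=.
  move=> _; rewrite /tp_mean big_nil; split => [t|].
    by apply: (continuous_ext (fun=> 0)) => [u|]; rewrite ?big_nil //; apply: continuous_const.
  by apply: tmean_ext (tmean_const 0) => t; rewrite big_nil.
move=> /andP[/andP[/and3P[a1 a2 _] /and3P[b1 b2 _]] hs].
have [cs ms] := IH hs.
set lam := ln (INR i.2.2) - ln (INR i.2.1).
have e t : tp_term l (flow t) i = i.1.1 * cos (i.1.2 + lam * t).
  by rewrite /tp_term !ang_flow //; congr (_ * cos _); rewrite /lam; ring.
have ci t : continuous (fun t => i.1.1 * cos (i.1.2 + lam * t)) t by apply: continuous_cos_affine.
have ci1 t : continuous (fun t => cos (i.1.2 + lam * t)) t.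
  by apply: (continuous_ext (fun t => 1 * cos (i.1.2 + lam * t))) => [u|];
     [exact: Rmult_1_l|apply: continuous_cos_affine].
split => [t|].
  apply: (continuous_ext (fun t => i.1.1 * cos (i.1.2 + lam * t) + \rsum_(i <- s) tp_term l (flow t) i)).
    by move=> u; rewrite big_cons e.
  exact: (continuous_plus _ _ _ (ci t) (cs t)).
rewrite /tp_mean big_cons; apply: (tmean_ext (fun t => i.1.1 * cos (i.1.2 + lam * t) + \rsum_(i <- s) tp_term l (flow t) i)).
  by move=> u; rewrite big_cons e.
apply: tmeanD => //; apply: tmeanZ => //.
case: eqP => [h|h].
  apply: tmean_ext (tmean_const _) => t; by rewrite /lam h Rminus_diag Rmult_0_l Rplus_0_r.
apply: tmean_cos => hl; apply: h; apply: INR_eq; apply: ln_inv; try exact: INR_gt0.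
by rewrite /lam in hl; lra.
Qed.

(** * Bernstein approximation and the Bohr correspondence *)

(* Bernstein's operator: the expectation of [g (k + B)] for [B] binomial of parameters [n], [x]. *)
Fixpoint bern (n : nat) (g : R -> R) (x k : R) : R :=
  if n is n'.+1 then x * bern n' g x (k + 1) + (1 - x) * bern n' g x k else g k.

Lemma bern_le n g h x k : 0 <= x <= 1 -> (forall k, g k <= h k) -> bern n g x k <= bern n h x k.
Proof.
move=> hx hgh; elim: n k => [|n IH] k /=; first exact: hgh.
have := IH (k + 1); have := IH k; nra.
Qed.

Lemma bern_affine n a b g x k : bern n (fun k => a + b * g k) x k = a + b * bern n g x k.
Proof. by elim: n k => [|n IH] k //=; rewrite !IH; ring. Qed.

(** Mean and variance of the binomial distribution in one formula. *)
Lemma bern_sqr n c x k :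
  bern n (fun k => (k - c) ^ 2) x k = (k + INR n * x - c) ^ 2 + INR n * x * (1 - x).
Proof.
elim: n k => [|n IH] k; first by rewrite /=; ring.
rewrite -[bern n.+1 _ x k]/(x * bern n _ x (k + 1) + (1 - x) * bern n _ x k) !IH S_INR; ring.
Qed.

(** Bernstein's proof of the Weierstrass theorem by Chebyshev's inequality. The bounds on [psi] are
    global because the comparison runs over all real [k]. *)
Lemma bern_approx (psi : R -> R) : (forall x, Rabs (psi x) <= 1) ->
  (forall eps, 0 < eps -> exists2 d, 0 < d & forall x y, Rabs (x - y) < d -> Rabs (psi x - psi y) < eps) ->
  forall eps, 0 < eps -> exists n, forall x, 0 <= x <= 1 ->
    Rabs (psi x - bern n (fun k => psi (k / INR n)) x 0) <= eps.
Proof.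
move=> hb huc eps he; have [d hd hu] := huc (eps / 2) ltac:(lra).
have hd2 : 0 < d ^ 2 by apply: pow_lt.
have [n0 hn0] := INR_unbounded (4 / (d ^ 2 * eps)).
exists n0.+1; set n := n0.+1; have hn : 0 < INR n by apply: INR_gt0.
have hc : 2 / d ^ 2 / INR n <= eps / 2.
  apply: (Rmult_le_reg_r (INR n)) => //; rewrite /Rdiv Rmult_assoc Rinv_l; last lra.
  have h1 : 4 / (d ^ 2 * eps) < INR n by rewrite /n S_INR; lra.
  have h2 := Rmult_lt_compat_r (eps / 2) _ _ ltac:(lra) h1.
  have e2 : 4 / (d ^ 2 * eps) * (eps / 2) = 2 * / d ^ 2 * 1 by field; lra.
  rewrite e2 in h2; lra.
move=> x hx; set B := bern _ _ _ _.
have pt k : Rabs (psi (k / INR n) - psi x) <= eps / 2 + 2 / d ^ 2 / INR n ^ 2 * (k - INR n * x) ^ 2.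
  have -> : 2 / d ^ 2 / INR n ^ 2 * (k - INR n * x) ^ 2 = 2 / d ^ 2 * (k / INR n - x) ^ 2 by field; lra.
  have hnn : 0 <= 2 / d ^ 2 * (k / INR n - x) ^ 2.
    by apply: Rmult_le_pos; [apply: Rdiv_le_0_compat; lra|apply: pow2_ge_0].
  case: (Rlt_dec (Rabs (k / INR n - x)) d) => h; first by have := hu _ _ h; lra.
  have h1 : 1 <= (k / INR n - x) ^ 2 / d ^ 2.
    apply: (Rmult_le_reg_r (d ^ 2)) => //; rewrite /Rdiv Rmult_assoc Rinv_l; last lra.
    rewrite -(pow2_abs (_ - _)) Rmult_1_l Rmult_1_r; apply: pow_incr; lra.
  have -> : 2 / d ^ 2 * (k / INR n - x) ^ 2 = 2 * ((k / INR n - x) ^ 2 / d ^ 2) by field; lra.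
  have h2 : Rabs (psi (k / INR n) - psi x) <= 2.
    apply: Rle_trans (Rabs_triang _ _) _; rewrite Rabs_Ropp.
    have := hb (k / INR n); have := hb x; lra.
  lra.
have hv : 2 / d ^ 2 / INR n ^ 2 * (INR n * x * (1 - x)) <= eps / 2.
  apply: Rle_trans hc.
  have -> : 2 / d ^ 2 / INR n ^ 2 * (INR n * x * (1 - x)) = 2 / d ^ 2 / INR n * (x * (1 - x)) by field; lra.
  rewrite -[X in _ <= X]Rmult_1_r; apply: Rmult_le_compat_l; last nra.
  by apply: Rdiv_le_0_compat => //; apply/Rlt_le/Rdiv_lt_0_compat; lra.
have e1 : bern n (fun k => (k - INR n * x) ^ 2) x 0 = INR n * x * (1 - x) by rewrite bern_sqr; ring.
have up : B <= psi x + eps.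
  apply: Rle_trans (bern_le n _ (fun k => (psi x + eps / 2) + 2 / d ^ 2 / INR n ^ 2 * (k - INR n * x) ^ 2) x 0 hx _) _.
    move=> k; have := pt k; have := Rle_abs (psi (k / INR n) - psi x); lra.
  rewrite (bern_affine n _ _ (fun k => (k - INR n * x) ^ 2)) e1; lra.
have dn : psi x - eps <= B.
  apply: Rle_trans (bern_le n (fun k => (psi x - eps / 2) + - (2 / d ^ 2 / INR n ^ 2) * (k - INR n * x) ^ 2) _ x 0 hx _).
    rewrite (bern_affine n _ _ (fun k => (k - INR n * x) ^ 2)) e1; lra.
  move=> k; have := pt k; have := Rle_abs (- (psi (k / INR n) - psi x)); rewrite Rabs_Ropp; lra.
apply: Rabs_le; lra.
Qed.

Lemma trigpoly_bern l k u n g : trigpoly l k u ->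
  exists k', forall c, trigpoly l k' (fun th => bern n g (u th) c).
Proof.
move=> hu; elim: n => [|n [k' IH]]; first by exists 0%N => c; apply: trigpoly_const.
exists (k + k')%N => c /=; apply: trigpolyD; apply: trigpolyM => //.
apply: (trigpoly_ext _ _ (fun th => 1 + -1 * u th)); first by move=> th; ring.
apply: trigpolyD; first exact: trigpoly_const.
exact: (trigpolyM l 0 k _ _ (trigpoly_const _ _ _) hu).
Qed.

(** Composition with this retraction extends [u ^ q] from [0, 1] to a bounded and uniformly
    continuous function on the line, as [bern_approx] demands. *)
Definition clip (v : R) : R := Rmax 0 (Rmin 1 v).

Lemma clip_bound v : 0 <= clip v <= 1.
Proof.
rewrite /clip; split; first exact: Rmax_l.
by apply: Rmax_lub; [lra|apply: Rmin_l].
Qed.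

Lemma clip_id v : 0 <= v <= 1 -> clip v = v.
Proof. by move=> h; rewrite /clip Rmin_right ?Rmax_right; lra. Qed.

Lemma clip_lip x y : Rabs (clip x - clip y) <= Rabs (x - y).
Proof.
have hc v : [\/ v <= 0 /\ clip v = 0, 0 <= v <= 1 /\ clip v = v | 1 <= v /\ clip v = 1].
  rewrite /clip; case: (Rle_dec v 0) => h0; first by apply: Or31; rewrite Rmin_right ?Rmax_left; lra.
  case: (Rle_dec v 1) => h1; first by apply: Or32; rewrite Rmin_right ?Rmax_right; lra.
  by apply: Or33; rewrite Rmin_left ?Rmax_right; lra.
case: (hc x) => -[h1 ->]; case: (hc y) => -[h2 ->]; rewrite /Rabs;
  repeat (match goal with |- context [Rcase_abs ?a] => destruct (Rcase_abs a) end); lra.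
Qed.

Lemma rpow_clip_uc q : 0 < q -> forall eps, 0 < eps ->
  exists2 d, 0 < d & forall x y, Rabs (x - y) < d -> Rabs (rpow (clip x) q - rpow (clip y) q) < eps.
Proof.
move=> hq eps he.
have hc x : 0 <= x <= 1 -> continuity_pt (fun u => rpow u q) x.
  by move=> _; apply/continuity_pt_filterlim; apply: continuous_rpow.
have [d hd] := Heine_cor2 hc (mkposreal eps he).
exists d => [|x y hxy]; first exact: cond_pos.
apply: hd; try exact: clip_bound.
exact: Rle_lt_trans (clip_lip x y) hxy.
Qed.

Lemma rpow_trigpoly_approx l k u q : 0 < q -> trigpoly l k u -> (forall th, 0 <= u th <= 1) ->
  forall eps, 0 < eps -> exists k' G, trigpoly l k' G /\ forall th, Rabs (rpow (u th) q - G th) <= eps.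
Proof.
move=> hq hu h01 eps he.
have hb x : Rabs (rpow (clip x) q) <= 1.
  have [c0 c1] := clip_bound x.
  by rewrite Rabs_pos_eq; [apply: rpow_le1; lra|apply: rpow_ge0].
have [n hn] := bern_approx (fun x => rpow (clip x) q) hb (rpow_clip_uc q hq) eps he.
have [k' hk'] := trigpoly_bern l k u n (fun k => rpow (clip (k / INR n)) q) hu.
exists k', (fun th => bern n (fun k => rpow (clip (k / INR n)) q) (u th) 0); split => // th.
by have := hn (u th) (h01 th); rewrite clip_id.
Qed.

(** The limit is uniform in the centres [al] and the base point [th], so a grid centred at the
    minimum of the symbol still computes the norm. *)
Definition torus_mean (l : seq nat) (H : (nat -> R) -> R) (L : R) : Prop :=
  forall eps, 0 < eps -> exists K0, forall K al th, (K0 <= K)%N -> Rabs (avgs K al l H th - L) < eps.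

Lemma avgs_dist K al l H G th eps : (forall th, Rabs (H th - G th) <= eps) ->
  Rabs (avgs K al l H th - avgs K al l G th) <= eps.
Proof.
move=> h; have hpf := avgs_pf K al l th.
have hc : avgs K al l (fun=> eps) th = eps.
  by rewrite (pf_const _ hpf) avgs_1 Rmult_1_r.
have h1 : avgs K al l H th <= avgs K al l (fun th => G th + eps) th.
  by apply: avgs_le => th'; have := Rle_abs (H th' - G th'); have := h th'; lra.
have h2 : avgs K al l G th <= avgs K al l (fun th => H th + eps) th.
  apply: avgs_le => th'; have := Rle_abs (- (H th' - G th')); rewrite Rabs_Ropp.
  by have := h th'; lra.
rewrite (pf_add _ hpf) hc in h1; rewrite (pf_add _ hpf) hc in h2.
by apply: Rabs_le; lra.
Qed.

Lemma tmean_dist f g a eps : 0 < eps -> (forall t, continuous f t) -> (forall t, continuous g t) ->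
  (forall t, Rabs (f t - g t) <= eps) -> tmean g a -> 
  exists T0, 0 < T0 /\ forall T, T0 < T -> Rabs (/ (2 * T) * RInt f (- T) T - a) <= 2 * eps.
Proof.
move=> he cf cg h hg; have [T0 [h0 hT0]] := hg eps he.
exists T0; split => // T hT; have T1 : 0 < T by lra.
have hi := Rinv_0_lt_compat (2 * T) ltac:(lra).
have xf : ex_RInt f (- T) T by apply: ex_RInt_continuous => t _.
have xg : ex_RInt g (- T) T by apply: ex_RInt_continuous => t _.
have hd : Rabs (RInt f (- T) T - RInt g (- T) T) <= 2 * T * eps.
  have -> : RInt f (- T) T - RInt g (- T) T = RInt (fun t => f t - g t) (- T) T.
    by rewrite (RInt_minus f g).
  have := abs_RInt_le_const (fun t => f t - g t) (- T) T eps ltac:(lra) _ (fun t _ => h t).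
  move=> hh; apply: Rle_trans (hh _) _; [exact: (ex_RInt_minus f g)|lra].
have := hT0 T hT => h1.
have -> : / (2 * T) * RInt f (- T) T - a =
  / (2 * T) * (RInt f (- T) T - RInt g (- T) T) + (/ (2 * T) * RInt g (- T) T - a) by ring.
apply: Rle_trans (Rabs_triang _ _) _.
rewrite Rabs_mult (Rabs_pos_eq (/ _)); last lra.
have := Rmult_le_compat_l _ _ _ (Rlt_le _ _ hi) hd.
have -> : / (2 * T) * (2 * T * eps) = eps by field; lra.
lra.
Qed.

(** Each approximating trigonometric polynomial has one mean [mu] for both the line and fine grids.
    The number [L] is the limit of one particular sequence of grid means, and it lies within
    [2 * eps] of every such [mu]. *)
Lemma bohr_mean l H : uniq l -> all prime l -> (forall t, continuous (fun t => H (flow t)) t) ->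
  (forall eps, 0 < eps -> exists k G, trigpoly l k G /\ forall th, Rabs (H th - G th) <= eps) ->
  exists L, tmean (fun t => H (flow t)) L /\ torus_mean l H L.
Proof.
move=> ul pl cH happ.
have key eps : 0 < eps -> exists mu, 
    (exists T0, 0 < T0 /\ forall T, T0 < T ->
        Rabs (/ (2 * T) * RInt (fun t => H (flow t)) (- T) T - mu) <= 2 * eps) /\
    (exists K0, forall K al th, (K0 <= K)%N -> Rabs (avgs K al l H th - mu) <= eps).
  move=> he; have [k [G [[s hs eG] hG]]] := happ eps he.
  exists (tp_mean s); split.
    have [cs ms] := tmean_tp l k s ul pl hs.
    apply: tmean_dist ms => // t; by rewrite -eG.
  exists k => K al th hK; rewrite -(avgs_tp K al l k s th ul _ hs); last exact: leq_trans hK (leq_pmull _ _).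
  by apply: avgs_dist => th'; rewrite -eG.
pose x K := avgs K (fun=> 0) l H (fun=> 0).
have [L hL] : exists L, Un_cv x L.
  suff hc : Cauchy_crit x by have [L hL] := Rcomplete.R_complete _ hc; exists L.
  move=> eps he; have [mu [_ [K0 hK0]]] := key (eps / 3) ltac:(lra).
  exists K0 => m n /leP hm /leP hn; rewrite /R_dist.
  have := hK0 m (fun=> 0) (fun=> 0) hm; have := hK0 n (fun=> 0) (fun=> 0) hn.
  rewrite -/(x n) -/(x m) => h1 h2.
  have -> : x m - x n = (x m - mu) - (x n - mu) by ring.
  apply: Rle_lt_trans (Rabs_triang _ _) _; rewrite Rabs_Ropp; lra.
have hmu eps mu : 0 < eps ->
    (exists K0, forall K al th, (K0 <= K)%N -> Rabs (avgs K al l H th - mu) <= eps) ->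
    Rabs (mu - L) <= 2 * eps.
  move=> he [K0 hK0]; have [N hN] := hL eps he.
  have := hN (maxn N K0) (elimT leP (leq_maxl _ _)).
  have := hK0 (maxn N K0) (fun=> 0) (fun=> 0) (leq_maxr _ _).
  rewrite /R_dist -/(x _) => h1 h2.
  have -> : mu - L = (x (maxn N K0) - L) - (x (maxn N K0) - mu) by ring.
  apply: Rle_trans (Rabs_triang _ _) _; rewrite Rabs_Ropp; lra.
exists L; split => eps he; have [mu [[T0 [h0 hT0]] hK]] := key (eps / 5) ltac:(lra);
  have := hmu (eps / 5) _ ltac:(lra) hK => hm.
  exists T0; split => // T /hT0 h.
  have -> : / (2 * T) * RInt (fun t => H (flow t)) (- T) T - L =
    (/ (2 * T) * RInt (fun t => H (flow t)) (- T) T - mu) + (mu - L) by ring.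
  apply: Rle_lt_trans (Rabs_triang _ _) _; lra.
have [K0 hK0] := hK; exists K0 => K al th /(hK0 _ al th) h.
have -> : avgs K al l H th - L = (avgs K al l H th - mu) + (mu - L) by ring.
apply: Rle_lt_trans (Rabs_triang _ _) _; lra.
Qed.

Lemma trigpoly_character l k n a b : tp_index l k n ->
  trigpoly l k (fun th => Re (Cmult (a, b) (cis (ang l th n)))) /\
  trigpoly l k (fun th => Im (Cmult (a, b) (cis (ang l th n)))).
Proof.
move=> hn; have h1 := tp_index1 l k; split.
  exists [:: (a, 0, (n, 1%N)); (b, PI / 2, (n, 1%N))]; first by rewrite /= hn h1.
  move=> th; rewrite !big_cons big_nil /tp_term /= ang_1 Rminus_0_r Rplus_0_l cos_plus cos_PI2 sin_PI2; ring.
exists [:: (a, - (PI / 2), (n, 1%N)); (b, 0, (n, 1%N))]; first by rewrite /= hn h1.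
move=> th; rewrite !big_cons big_nil /tp_term /= ang_1 Rminus_0_r Rplus_0_l cos_plus cos_neg sin_neg cos_PI2 sin_PI2; ring.
Qed.

Lemma trigpoly_Cmod_sqr l k (a : nat -> C) (r : seq nat) (P : pred nat) :
  (forall n, n \in r -> P n -> tp_index l k n) ->
  trigpoly l (k + k) (fun th => Cmod (\csum_(n <- r | P n) Cmult (a n) (cis (ang l th n))) ^ 2).
Proof.
move=> hr.
have hre : trigpoly l k (fun th => Re (\csum_(n <- r | P n) Cmult (a n) (cis (ang l th n)))).
  apply: (trigpoly_ext _ _ (fun th => \rsum_(n <- r | P n) Re (Cmult (a n) (cis (ang l th n))))).
    by move=> th; rewrite csum_Re.
  by apply: trigpoly_sum => n hn hP; case: (a n) => x y; case: (trigpoly_character l k n x y (hr n hn hP)).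
have him : trigpoly l k (fun th => Im (\csum_(n <- r | P n) Cmult (a n) (cis (ang l th n)))).
  apply: (trigpoly_ext _ _ (fun th => \rsum_(n <- r | P n) Im (Cmult (a n) (cis (ang l th n))))).
    by move=> th; rewrite csum_Im.
  by apply: trigpoly_sum => n hn hP; case: (a n) => x y; case: (trigpoly_character l k n x y (hr n hn hP)).
apply: trigpoly_ext (trigpolyD _ _ _ _ (trigpolyM _ _ _ _ _ hre hre) (trigpolyM _ _ _ _ _ him him)) => th.
rewrite Cmod_sqr; ring.
Qed.

Lemma dir_sumE a N s : dir_sum a N s = \csum_(n <- iota 1 N) Cmult (a n) (cpow_neg n s).
Proof.
elim: N => [|N IH]; first by rewrite big_nil /dir_sum sum_n_m_zero //; apply/ltP.
rewrite -{2}addn1 iotaD big_cat big_seq1 -IH /dir_sum sum_n_Sm; last by apply/leP.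
by rewrite add1n.
Qed.

Lemma cpow_neg_line n t : cpow_neg n (0, t) = cis (- t * ln (INR n)).
Proof. by rewrite /cpow_neg /cis /= Ropp_0 Rmult_0_l exp_0 !Rmult_1_l. Qed.

Definition prime_base (l : seq nat) (N : nat) : Prop :=
  [/\ uniq l, all prime l & forall n, (0 < n <= N)%N -> smooth l n].

Lemma prime_base_iota N : prime_base [seq p <- iota 1 N | prime p] N.
Proof.
split; [exact/filter_uniq/iota_uniq|exact: filter_all|].
move=> n /andP[n0 nN]; apply/allP => p; rewrite mem_primes => /and3P[pp _ hd].
rewrite mem_filter pp mem_iota prime_gt0 //= add1n ltnS.
exact: leq_trans (dvdn_leq n0 hd) nN.
Qed.

Lemma dtorusE a N l th : prime_base l N ->
  dtorus a N l th = \csum_(n <- iota 1 N) Cmult (a n) (cis (ang l th n)).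
Proof.
move=> [_ _ h]; rewrite /dtorus -big_filter; congr bigop.
by apply/all_filterP/allP => n; rewrite mem_iota add1n ltnS => /h.
Qed.

Lemma dtorus_flow a N l t : prime_base l N -> dtorus a N l (flow t) = dir_sum a N (0, t).
Proof.
move=> hb; rewrite dtorusE // dir_sumE; apply: eq_big_seq => n; rewrite mem_iota add1n ltnS => hn.
case: hb => ul pl h; case/andP: (hn) => h0 _.
by rewrite cpow_neg_line ang_flow //; apply: h.
Qed.

Lemma dtorus_trigpoly a N l : trigpoly l (N + N) (fun th => Cmod (dtorus a N l th) ^ 2).
Proof.
apply: trigpoly_Cmod_sqr => n; rewrite mem_iota add1n ltnS => /andP[h0 hN] hs.
apply/and3P; split => //; apply/allP => p _.
by apply: leq_trans hN; apply: ltnW; apply: ltn_logl.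
Qed.

Lemma dtorus_bound a N l th : Cmod (dtorus a N l th) <= \rsum_(n <- iota 1 N) Cmod (a n).
Proof.
apply: Rle_trans (Cmod_csum _ _ _) _.
rewrite [X in _ <= X](bigID (smooth l)) /=.
have : 0 <= \rsum_(n <- iota 1 N | ~~ smooth l n) Cmod (a n).
  by apply: rsum_ge0 => n _; apply: Cmod_ge_0.
have -> : \rsum_(n <- iota 1 N | smooth l n) Cmod (Cmult (a n) (cis (ang l th n))) =
    \rsum_(n <- iota 1 N | smooth l n) Cmod (a n).
  by apply: eq_bigr => n _; rewrite Cmod_mult Cmod_cis Rmult_1_r.
move=> h; rewrite /=; lra.
Qed.

Lemma rpow_sqr_half x q : 0 <= x -> rpow (x ^ 2) (q / 2) = rpow x q.
Proof.
move=> hx; rewrite -(rpow_nat x 1) // rpow_rpow //; congr rpow => /=; field.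
Qed.

Lemma continuous_trigpoly_flow l k G t : uniq l -> all prime l -> trigpoly l k G ->
  continuous (fun t => G (flow t)) t.
Proof.
move=> ul pl [s hs e]; have [cs _] := tmean_tp l k s ul pl hs.
by apply: (continuous_ext _ _ _ _ (cs t)) => u; rewrite e.
Qed.

(** [|P|^2] is a trigonometric polynomial, hence the exponent [q / 2]. Division by [(B + 1)^2], with
    [B] the sum of the moduli of the coefficients, brings it into [0, 1], where Bernstein's operator
    approximates. *)
Lemma bohr_dirpoly a N l q : prime_base l N -> 0 < q ->
  exists L, tmean (fun t => rpow (Cmod (dir_sum a N (0, t))) q) L /\
    torus_mean l (fun th => rpow (Cmod (dtorus a N l th)) q) L.
Proof.
move=> hb hq; have [ul pl hs] := hb.
pose H th := rpow (Cmod (dtorus a N l th)) q.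
suff [L [h1 h2]] : exists L, tmean (fun t => H (flow t)) L /\ torus_mean l H L.
  by exists L; split => //; apply: tmean_ext h1 => t; rewrite /H dtorus_flow.
have htp := dtorus_trigpoly a N l.
apply: bohr_mean => // [t|eps he].
  apply: (continuous_ext (fun t => rpow (Cmod (dtorus a N l (flow t)) ^ 2) (q / 2))).
    by move=> u; rewrite rpow_sqr_half //; apply: Cmod_ge_0.
  apply: (continuous_comp (fun t => Cmod (dtorus a N l (flow t)) ^ 2) (fun u => rpow u (q / 2))).
    exact: (continuous_trigpoly_flow l _ _ t ul pl htp).
  by apply: continuous_rpow; lra.
set B := \rsum_(n <- iota 1 N) Cmod (a n).
have hB : 0 <= B by apply: rsum_ge0 => n _; apply: Cmod_ge_0.
have hB1 : 0 < (B + 1) ^ 2 by apply: pow_lt; lra.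
have hBq : 0 < rpow (B + 1) q by apply: rpow_gt0; lra.
have hu : trigpoly l (0 + (N + N)) (fun th => / (B + 1) ^ 2 * Cmod (dtorus a N l th) ^ 2).
  exact: (trigpolyM l 0 _ _ _ (trigpoly_const _ _ _) htp).
have hu01 th : 0 <= / (B + 1) ^ 2 * Cmod (dtorus a N l th) ^ 2 <= 1.
  have h0 := Cmod_ge_0 (dtorus a N l th).
  have h1 : Cmod (dtorus a N l th) ^ 2 <= (B + 1) ^ 2.
    by apply: pow_incr; split => //; have := dtorus_bound a N l th; rewrite -/B; lra.
  split; first by apply: Rmult_le_pos; [exact/Rlt_le/Rinv_0_lt_compat|apply: pow2_ge_0].
  by apply: (Rmult_le_reg_l ((B + 1) ^ 2)) => //; rewrite -Rmult_assoc Rinv_r; lra.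
have [k [G [hG hap]]] := rpow_trigpoly_approx l _ _ (q / 2) ltac:(lra) hu hu01
  (eps / rpow (B + 1) q) ltac:(exact: Rdiv_lt_0_compat).
exists (0 + k)%N, (fun th => rpow (B + 1) q * G th); split.
  exact: (trigpolyM l 0 _ _ _ (trigpoly_const _ _ _) hG).
move=> th; have := hap th; set u := / _ * _.
have -> : H th = rpow (B + 1) q * rpow u (q / 2).
  rewrite /u rpowM; [|exact/Rlt_le/Rinv_0_lt_compat|exact: pow2_ge_0].
  rewrite rpow_inv // !rpow_sqr_half; [|exact: Cmod_ge_0|lra].
  by rewrite /H -Rmult_assoc Rinv_r ?Rmult_1_l //; lra.
rewrite -Rmult_minus_distr_l Rabs_mult (Rabs_pos_eq (rpow _ _)); last lra.
move/(Rmult_le_compat_l _ _ _ (Rlt_le _ _ hBq)).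
by have -> : rpow (B + 1) q * (eps / rpow (B + 1) q) = eps by field; lra.
Qed.

Lemma tmean_le f mu c : (forall t, continuous f t) -> (forall t, f t <= c) -> tmean f mu -> mu <= c.
Proof.
move=> cf h hm; apply: le_epsilon => e he; have [T0 [h0 hT]] := hm e he.
have := hT (T0 + 1) ltac:(lra); set T := T0 + 1; have hT1 : 0 < T by rewrite /T; lra.
have hi : RInt f (- T) T <= RInt (fun=> c) (- T) T.
  apply: RInt_le => //; [lra|by apply: ex_RInt_continuous => t _|exact: ex_RInt_const].
rewrite RInt_const /scal /= /mult /= in hi.
have hT2 : 0 < / (2 * T) by apply: Rinv_0_lt_compat; lra.
have := Rmult_le_compat_l _ _ _ (Rlt_le _ _ hT2) hi.
have -> : / (2 * T) * ((T - - T) * c) = c by field; lra.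
move=> h1 /Rabs_def2; lra.
Qed.

Lemma torus_mean_ge0 l H L : (forall th, 0 <= H th) -> torus_mean l H L -> 0 <= L.
Proof.
move=> h hm; apply: Rnot_lt_le => hL; have [K0 hK] := hm (- L) ltac:(lra).
have := hK K0 (fun=> 0) (fun=> 0) (leqnn _).
have : 0 <= avgs K0 (fun=> 0) l H (fun=> 0) by apply: (pf_ge0 _ (avgs_pf _ _ _ _)).
by move=> h1 /Rabs_def2; lra.
Qed.

Lemma hp_norm_torus a N l q : prime_base l N -> 0 < q ->
  exists L, [/\ 0 <= L, torus_mean l (fun th => rpow (Cmod (dtorus a N l th)) q) L
    & forall P, (forall s, P s = dir_sum a N s) -> hp_norm_poly q P = rpow L (/ q)].
Proof.
move=> hb hq; have [L [h1 h2]] := bohr_dirpoly a N l q hb hq.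
exists L; split => //.
  by apply: torus_mean_ge0 h2 => th; apply: rpow_ge0.
move=> P eP; congr rpow.
have : is_lim (fun T => / (2 * T) * RInt (fun t => rpow (Cmod (P (0, t))) q) (- T) T) p_infty L.
  apply/is_lim_spec => eps; have [T0 [_ hT]] := h1 eps (cond_pos eps).
  exists T0 => T /hT; rewrite (RInt_ext _ (fun t => rpow (Cmod (P (0, t))) q)) // => t _.
  by rewrite eP.
by move/is_lim_unique => ->.
Qed.

(** * Kronecker's theorem for Dirichlet polynomials *)

Lemma avgs_center K al l G : (forall th, 0 <= G th) -> (forall th th', th =1 th' -> G th = G th') ->
  forall th, th =1 al -> / INR (2 * K + 1) ^ size l * G th <= avgs K al l G th.
Proof.
elim: l G => [|p l IH] G h0 hG th hth; first by rewrite /= Rinv_1; lra.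
have hM := grid_size_gt0 K; have hMi := Rinv_0_lt_compat _ hM.
have hK : K \in iota 0 (2 * K + 1) by rewrite mem_iota add0n addn1 ltnS /= leq_pmull.
have h1 : / INR (2 * K + 1) * G th <= avg1 K al p G th.
  apply: Rmult_le_compat_l; first lra.
  have -> : G th = G (upd th p (gpt K (al p) K)).
    apply: hG => q; rewrite /upd /gpt; case: eqP => // ->; rewrite hth; field; lra.
  by apply: (rsum_term_le _ _ (fun k => G (upd th p (gpt K (al p) k)))).
rewrite [avgs _ _ _ _]/=; apply: Rle_trans (IH (avg1 K al p G) _ _ th hth).
- have hp : 0 < INR (2 * K + 1) ^ size l by apply: pow_lt.
  have -> : / INR (2 * K + 1) ^ size (p :: l) * G th =
    / INR (2 * K + 1) ^ size l * (/ INR (2 * K + 1) * G th) by rewrite /=; field; lra.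
  by apply: Rmult_le_compat_l => //; apply/Rlt_le/Rinv_0_lt_compat.
- by move=> th'; apply: (pf_ge0 _ (gmean_pf _ _)).
- move=> t t' e; apply: (pf_ext _ (gmean_pf _ _)) => u; apply: hG => q.
  by rewrite /upd; case: eqP.
Qed.

(** The grid that averages the [n]-th power of a polynomial of degree [c] exactly can be taken with
    [2 * (n * c) + 1] points per variable; the left side counts its points in [d] variables. *)
Lemma exp_beats_poly r (c d : nat) : 1 < r -> exists n, (INR (2 * (n * c) + 1)) ^ d < r ^ n.
Proof.
move=> hr; pose h := ln r; have hh : 0 < h by rewrite /h -ln_1; apply: ln_increasing; lra.
have hf : 0 < INR (Factorial.fact d.+1) by apply: INR_fact_lt_0.
have hhd : 0 < h ^ d.+1 by apply: pow_lt.
have hc : 0 < INR (2 * c + 1) ^ d by apply/pow_lt/grid_size_gt0.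
pose D := INR (2 * c + 1) ^ d * (INR (Factorial.fact d.+1) / h ^ d.+1).
have [n0 hn0] := INR_unbounded D.
pose n := n0.+1; exists n; have hn : 0 < INR n by apply: INR_gt0.
have hDn : D < INR n by rewrite /n S_INR; lra.
have hrn : (INR n * h) ^ d.+1 / INR (Factorial.fact d.+1) <= r ^ n.
  have <- : Rpower r (INR n) = r ^ n by apply: Rpower_pow; lra.
  apply: Rle_trans (exp_ge_taylor (INR n * h) d.+1 _); last by apply: Rmult_le_pos; lra.
  rewrite tech5; set S := sum_f_R0 _ _; suff : 0 <= S by rewrite /=; lra.
  apply: cond_pos_sum => k; apply: Rdiv_le_0_compat; last exact: INR_fact_lt_0.
  by apply: pow_le; apply: Rmult_le_pos; lra.
apply: Rlt_le_trans hrn.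
apply: Rle_lt_trans (_ : (INR n * INR (2 * c + 1)) ^ d < _).
  apply: pow_incr; split; first exact: pos_INR.
  have hnat : (2 * (n * c) + 1 <= n * (2 * c + 1))%N by rewrite mulnDr muln1 mulnCA leq_add2l.
  rewrite -mult_INR; apply: le_INR; exact/leP.
rewrite Rpow_mult_distr -[d.+1]/(S d) [X in _ < X / _]Rpow_mult_distr.
have -> : INR n ^ d.+1 = INR n ^ d * INR n by rewrite /=; ring.
have -> : INR n ^ d * INR n * h ^ d.+1 / INR (Factorial.fact d.+1) =
   INR n ^ d * (INR n * (h ^ d.+1 / INR (Factorial.fact d.+1))) by field; lra.
apply: Rmult_lt_compat_l; first exact: pow_lt.
have -> : INR (2 * c + 1) ^ d = D * (h ^ d.+1 / INR (Factorial.fact d.+1)).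
  by rewrite /D; field; lra.
by apply: Rmult_lt_compat_r => //; apply: Rdiv_lt_0_compat.
Qed.

(* Kronecker's theorem in disguise: the moments [|P|^(2n)] have equal means on the line and on the
   torus, and a single point of a grid of polynomial size detects an exponential growth. *)
Lemma dirpoly_sup_torus a N l B : prime_base l N -> 0 <= B ->
  (forall t, Cmod (dir_sum a N (0, t)) <= B) -> forall th, Cmod (dtorus a N l th) <= B.
Proof.
move=> hb hB h th; have [ul pl _] := hb.
apply: Rnot_lt_le => hlt; set A := Cmod _ in hlt.
(* A value strictly between [B] and [A]: the ratio [r] exceeds 1, and the divisor is positive even
   when [B = 0]. *)
pose B' := (A + B) / 2; have hB' : 0 < B' by rewrite /B'; lra.
pose r := (A / B') ^ 2.
have hAB : 1 < A / B'.
  by apply: (Rmult_lt_reg_r B') => //; rewrite /Rdiv Rmult_assoc Rinv_l; rewrite /B'; lra.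
have hr : 1 < r by rewrite /r; nra.
have [n hn] := exp_beats_poly r (N + N) (size l) hr.
pose G th := (Cmod (dtorus a N l th) ^ 2) ^ n.
have hG : trigpoly l (n * (N + N)) G by apply: trigpoly_pow; apply: dtorus_trigpoly.
have [s hs eG] := hG.
set K := (n * (N + N))%N in hG hs hn.
have [_ ms] := tmean_tp l K s ul pl hs.
have h1 : tp_mean s <= (B ^ 2) ^ n.
  apply: (tmean_le (fun t => G (flow t))) => [t|t|].
  - exact: continuous_trigpoly_flow hG.
  - apply: pow_incr; split; first exact: pow2_ge_0.
    by apply: pow_incr; split; [apply: Cmod_ge_0|rewrite dtorus_flow].
  - by apply: tmean_ext ms => t; rewrite eG.
have h2 : / INR (2 * K + 1) ^ size l * G th <= tp_mean s.
  rewrite -(avgs_tp K th l K s th ul (leq_pmull _ _) hs) //.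
  rewrite (avgs_ext _ _ _ _ G) => [|t]; last by rewrite eG.
  apply: avgs_center => // [t|t t' e].
    by apply: pow_le; apply: pow2_ge_0.
  rewrite /G /dtorus; congr ((Cmod _ ^ 2) ^ n); apply: eq_bigr => m _.
  by congr (Cmult _ (cis _)); apply: eq_bigr => p _; rewrite e.
have hM : 0 < INR (2 * K + 1) ^ size l by apply/pow_lt/grid_size_gt0.
have hBn : (B ^ 2) ^ n <= (B' ^ 2) ^ n.
  apply: pow_incr; split; first exact: pow2_ge_0.
  by apply: pow_incr; rewrite /B'; lra.
have hBp : 0 < (B' ^ 2) ^ n by apply: pow_lt; apply: pow_lt.
have e : G th = r ^ n * (B' ^ 2) ^ n.
  by rewrite /G -/A -Rpow_mult_distr; congr pow; rewrite /r; field; lra.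
have h3 : G th <= INR (2 * K + 1) ^ size l * (B' ^ 2) ^ n.
  apply: (Rmult_le_reg_l (/ INR (2 * K + 1) ^ size l)); first exact: Rinv_0_lt_compat.
  rewrite -Rmult_assoc Rinv_l; lra.
rewrite e in h3; have := Rmult_lt_compat_r _ _ _ hBp hn; lra.
Qed.

(** * Dirichlet polynomials as functions of characters *)

Definition character (chi : nat -> C) : Prop :=
  chi 1%N = RtoC 1 /\ forall m n, (0 < m)%N -> (0 < n)%N -> chi (m * n)%N = Cmult (chi m) (chi n).

Lemma character_cpow s : character (fun n => cpow_neg n s).
Proof.
split=> [|m n hm hn].
  by rewrite /cpow_neg /= ln_1 !Rmult_0_r exp_0 cos_0 sin_0 Rmult_1_l Rmult_0_r.
rewrite /cpow_neg mult_INR ln_mult; [|exact: INR_gt0..].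
rewrite !Rmult_plus_distr_l exp_plus cos_plus sin_plus; apply: C_ext; rewrite /Re /Im /=; ring.
Qed.

Lemma character_ang l th : character (fun n => cis (ang l th n)).
Proof. by split=> [|m n hm hn]; rewrite ?ang_1 ?cis0 // angM // cisD. Qed.

(* Dirichlet polynomials, evaluated at arbitrary completely multiplicative functions: this covers
   both [n^(-s)] and the characters of the polytorus. *)
Definition dirichlet_poly (G : (nat -> C) -> C) : Prop := exists N (a : nat -> C),
  (forall n, (N < n)%N -> a n = RtoC 0) /\
  forall chi, character chi -> G chi = \csum_(n <- iota 1 N) Cmult (a n) (chi n).

Lemma dp_widen N M (a chi : nat -> C) : (N <= M)%N -> (forall n, (N < n)%N -> a n = RtoC 0) ->
  \csum_(n <- iota 1 N) Cmult (a n) (chi n) = \csum_(n <- iota 1 M) Cmult (a n) (chi n).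
Proof.
move=> hNM ha; rewrite -(subnKC hNM) iotaD big_cat /= [X in _ = Cplus _ X]big1_seq ?Cplus_0_r //.
by move=> n /andP[_]; rewrite mem_iota => /andP[h _]; rewrite ha ?Cmult_0_l // -add1n.
Qed.

Lemma dp_const z : dirichlet_poly (fun=> z).
Proof.
exists 1%N, (fun n => if n == 1%N then z else RtoC 0); split => [n|chi [h1 _]].
  by case: eqP => // ->.
by rewrite big_seq1 eqxx h1 Cmult_1_r.
Qed.

Lemma dp_char q : (0 < q)%N -> dirichlet_poly (fun chi => chi q).
Proof.
move=> hq; exists q, (fun n => if n == q then RtoC 1 else RtoC 0); split => [n|chi _].
  by case: eqP => // ->; rewrite ltnn.
rewrite (eq_bigr (fun n => Cmult (chi n) (if n == q then RtoC 1 else RtoC 0))); last first.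
  by move=> n _; rewrite Cmult_comm.
by rewrite csum_delta ?iota_uniq // mem_iota hq add1n ltnS /=.
Qed.

Lemma dp_add G H : dirichlet_poly G -> dirichlet_poly H -> dirichlet_poly (fun chi => Cplus (G chi) (H chi)).
Proof.
move=> [N [a [ha eG]]] [M [b [hb eH]]].
exists (maxn N M), (fun n => Cplus (a n) (b n)); split => [n|chi hchi].
  by rewrite gtn_max => /andP[h1 h2]; rewrite ha // hb // Cplus_0_l.
rewrite eG // eH // (dp_widen N (maxn N M)) ?leq_maxl // (dp_widen M (maxn N M)) ?leq_maxr //.
by rewrite -big_split /=; apply: eq_bigr => n _; ring.
Qed.

(** The coefficients are the Dirichlet convolution, written with an indicator so that no sum over
    divisors is needed. *)
Lemma dp_mul G H : dirichlet_poly G -> dirichlet_poly H -> dirichlet_poly (fun chi => Cmult (G chi) (H chi)).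
Proof.
move=> [N [a [ha eG]]] [M [b [hb eH]]].
exists (N * M)%N, (fun n => \csum_(d <- iota 1 N) \csum_(e <- iota 1 M)
   Cmult (Cmult (a d) (b e)) (if n == (d * e)%N then RtoC 1 else RtoC 0)); split => [n hn|chi hchi].
  rewrite big_seq big1 // => d; rewrite mem_iota add1n ltnS => /andP[_ hd].
  rewrite big_seq big1 // => e; rewrite mem_iota add1n ltnS => /andP[_ he].
  case: eqP => [en|]; last by rewrite Cmult_0_r.
  by move: hn; rewrite en ltnNge leq_mul.
rewrite eG // eH // [RHS](eq_bigr (fun n => \csum_(d <- iota 1 N) \csum_(e <- iota 1 M)
   Cmult (Cmult (Cmult (a d) (b e)) (chi n)) (if n == (d * e)%N then RtoC 1 else RtoC 0))); last first.
  move=> n _ /=. rewrite big_distrl /=; apply: eq_bigr => d _; rewrite big_distrl /=.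
  by apply: eq_bigr => e _; ring.
rewrite [RHS]exchange_big /= big_distrl /=; apply: eq_big_seq => d; rewrite mem_iota add1n ltnS => /andP[d0 hd].
rewrite [RHS]exchange_big /= big_distrr /=; apply: eq_big_seq => e; rewrite mem_iota add1n ltnS => /andP[e0 he].
rewrite (csum_delta _ (fun n => Cmult (Cmult (a d) (b e)) (chi n))) ?iota_uniq //.
  by case: hchi => _ ->; [ring|..].
by rewrite mem_iota add1n ltnS leq_mul // muln_gt0 d0 e0.
Qed.

Lemma dp_ext G H : (forall chi, character chi -> H chi = G chi) -> dirichlet_poly G -> dirichlet_poly H.
Proof. by move=> h [N [a [ha e]]]; exists N, a; split => // chi hc; rewrite h // e. Qed.

Lemma dp_scal z G : dirichlet_poly G -> dirichlet_poly (fun chi => Cmult z (G chi)).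
Proof. exact/dp_mul/dp_const. Qed.

Lemma dp_sum (I : eqType) (r : seq I) (F : I -> (nat -> C) -> C) :
  (forall i, i \in r -> dirichlet_poly (F i)) -> dirichlet_poly (fun chi => \csum_(i <- r) F i chi).
Proof.
elim: r => [|i r IH] h.
  by apply: dp_ext (dp_const (RtoC 0)) => chi _; rewrite big_nil.
apply: dp_ext (dp_add _ _ (h i (mem_head _ _)) (IH _)) => [chi _|j hj].
  by rewrite big_cons.
by apply: h; rewrite inE hj orbT.
Qed.

Lemma dp_pow G n : dirichlet_poly G -> dirichlet_poly (fun chi => Cpow (G chi) n).
Proof.
move=> hG; elim: n => [|n IH]; first exact: dp_const.
exact: (dp_mul _ _ hG IH).
Qed.

Lemma coef_le_torus K al N l : all prime l -> uniq l -> (N <= 2 * K)%N ->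
  forall A th, (forall n, (N < n)%N -> A n = RtoC 0) ->
  forall n, (0 < n <= N)%N -> smooth l n ->
  Cmod (A n) <= avgs K al l (fun th => Cmod (dtorus A N l th)) th.
Proof.
move=> pl ul hK; elim: l pl ul => [|q l IH] pl ul A th hA n hn hs.
  case/andP: (hn) => n0 _; rewrite smooth_nil // in hs; rewrite (eqP hs) in hn *.
  case: N hn hA {hK} => // N hn hA; rewrite /= /dtorus -[iota 1 _]/(1%N :: iota 2 N) big_cons /=.
  rewrite ang_1 cis0 Cmult_1_r big1_seq ?Cplus_0_r; first by right.
  move=> m /andP[hsm]; rewrite mem_iota => /andP[h2 _].
  by rewrite smooth_nil in hsm; [rewrite (eqP hsm) in h2|apply: leq_trans h2].
move: pl ul => /= /andP[pq pl] /andP[hq ul]; case/andP: (hn) => n0 nN.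
have [m hc en] := pfactor_coprime pq n0.
set k := logn q n in en; rewrite mulnC in en.
have hm : (0 < m)%N by move: n0; rewrite en muln_gt0 => /andP[].
have hpk : (0 < q ^ k)%N by rewrite expn_gt0 prime_gt0.
have hmN : (m <= N)%N by apply: leq_trans nN; rewrite en leq_pmull.
have sm : smooth l m.
  apply/allP => p; rewrite mem_primes => /and3P[pp _ hd].
  have : p \in primes n by rewrite mem_primes pp n0 en dvdn_mull.
  move/(allP hs); rewrite inE => /orP[/eqP ep|//].
  by move: hc; rewrite prime_coprime // -ep hd.
have hAk i : (N < i)%N -> A (q ^ k * i)%N = RtoC 0.
  by move=> hi; apply: hA; apply: leq_trans hi (leq_pmull _ _).
rewrite en; apply: Rle_trans (IH pl ul (fun m => A (q ^ k * m)%N) th hAk m _ sm) _; first by rewrite hm.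
apply: avgs_le => th'; rewrite /avg1.
have hkN : (k <= N)%N by apply: leq_trans nN; apply/ltnW/ltn_logl.
apply: Rle_trans (tpoly_coef_le K (al q) (fun k => dtorus (fun m => A (q ^ k * m)%N) N l th') N k hkN hK) _.
by apply: Req_le; apply: (pf_ext _ (gmean_pf K (al q))) => t; rewrite dtorus_cons.
Qed.

(** Applied to the coefficient of a prime, this is the angle at which its term points to the left
    and the real part of the symbol is smallest. *)
Lemma exists_angle (z : C) : exists x, Cmult z (cis x) = RtoC (- Cmod z).
Proof.
case: (Req_dec (Cmod z) 0) => h0.
  exists 0; rewrite (Cmod_eq_0 _ h0) Cmod_0 Cmult_0_l; by rewrite Ropp_0.
have hz : 0 < Cmod z by have := Cmod_ge_0 z; lra.
have hsq := Cmod_sqr z.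
set u := - Re z / Cmod z.
have hu2 : u ^ 2 + (Im z / Cmod z) ^ 2 = 1.
  have -> : u ^ 2 + (Im z / Cmod z) ^ 2 = (Re z ^ 2 + Im z ^ 2) / Cmod z ^ 2 by rewrite /u; field.
  by rewrite -hsq; field.
have hu : -1 <= u <= 1 by split; nra.
have hs : sqrt (1 - u²) = Rabs (Im z / Cmod z).
  by rewrite -sqrt_Rsqr_abs; congr sqrt; rewrite !Rsqr_pow2; lra.
have fin y : cos y = u -> sin y = Im z / Cmod z -> Cmult z (cis y) = RtoC (- Cmod z).
  move=> hc hsn; apply: C_ext; rewrite /cis hc hsn /u.
    have -> : Re (Cmult z (- Re z / Cmod z, Im z / Cmod z)) = - (Re z ^ 2 + Im z ^ 2) / Cmod z.
      by case: (z) h0 => a b h0; rewrite /Re /Im /=; field.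
    by rewrite -hsq /=; field.
  by case: (z) h0 => a b h0; rewrite /Re /Im /=; field.
case: (Rle_dec 0 (Im z / Cmod z)) => h.
  exists (acos u); apply: fin; first by rewrite cos_acos.
  by rewrite sin_acos // hs Rabs_pos_eq.
exists (- acos u); apply: fin; first by rewrite cos_neg cos_acos.
by rewrite sin_neg sin_acos // hs Rabs_left; lra.
Qed.

Lemma exists_angles (c : nat -> C) : exists al, forall q, Cmult (c q) (cis (al q)) = RtoC (- Cmod (c q)).
Proof.
have f := ClassicalEpsilon.constructive_indefinite_description _ (exists_angle _).
by exists (fun q => proj1_sig (f (c q))) => q; apply: (proj2_sig (f (c q))).
Qed.

(** * Symbols in the Gordon-Hedenmalm class *)

Lemma Cmod_cpow n s : Cmod (cpow_neg n s) = exp (- Re s * ln (INR n)).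
Proof.
have -> : cpow_neg n s = Cmult (RtoC (exp (- Re s * ln (INR n)))) (cis (- Im s * ln (INR n))).
  by apply: C_ext; rewrite /cpow_neg /Re /Im /=; ring.
by rewrite Cmod_mult Cmod_cis Cmod_R Rmult_1_r Rabs_pos_eq //; apply/Rlt_le/exp_pos.
Qed.

Lemma ln_INR_ge0 n : (0 < n)%N -> 0 <= ln (INR n).
Proof.
move=> h; rewrite -ln_1; apply: ln_le; first lra.
by apply: (le_INR 1); apply/leP.
Qed.

Lemma Cmod_cpow_le1 n s : (0 < n)%N -> 0 <= Re s -> Cmod (cpow_neg n s) <= 1.
Proof.
move=> hn hs; rewrite Cmod_cpow -exp_0; have := ln_INR_ge0 n hn => h.
have : - Re s * ln (INR n) <= 0 by nra.
by case=> [/exp_increasing|->]; [left|right].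
Qed.

Lemma cpow_neg_split n x t : cpow_neg n (x, t) = Cmult (RtoC (exp (- x * ln (INR n)))) (cpow_neg n (0, t)).
Proof. rewrite cpow_neg_line /cpow_neg; apply: C_ext; rewrite /Re /Im /=; ring. Qed.

Lemma dir_sum_shift a N x t :
  dir_sum a N (x, t) = dir_sum (fun n => Cmult (a n) (RtoC (exp (- x * ln (INR n))))) N (0, t).
Proof.
rewrite !dir_sumE; apply: eq_bigr => n _.
by rewrite (cpow_neg_split n x t) Cmult_assoc.
Qed.

(** A bound on the line is a bound on the torus by [dirpoly_sup_torus], and means over the torus
    dominate each coefficient. *)
Lemma dirichlet_coef_le a N e : (forall t, Cmod (dir_sum a N (0, t)) <= e) ->
  forall n, (0 < n <= N)%N -> Cmod (a n) <= e.
Proof.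
move=> h n hn; set l := [seq p <- iota 1 N | prime p].
have hb : prime_base l N by apply: prime_base_iota.
have [ul pl hs] := hb.
have e0 : 0 <= e by have := h 0; have := Cmod_ge_0 (dir_sum a N (0, 0)); lra.
have ht := dirpoly_sup_torus a N l e hb e0 h.
pose a' n := if (n <= N)%N then a n else RtoC 0.
have ha' : forall n, (N < n)%N -> a' n = RtoC 0 by move=> m; rewrite /a' ltnNge; case: ifP.
have := coef_le_torus N (fun=> 0) N l pl ul (leq_pmull _ _) a' (fun=> 0) ha' n hn (hs n hn).
have -> : a' n = a n by rewrite /a'; case/andP: hn => _ ->.
move=> /(_ isT) h1; apply: Rle_trans h1 _.
have hpf := avgs_pf N (fun=> 0) l (fun=> 0).
apply: Rle_trans (pf_le _ hpf _ (fun=> e) _) _; last by rewrite (pf_const _ hpf) avgs_1; lra.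
move=> th; have -> : dtorus a' N l th = dtorus a N l th; last exact: ht.
rewrite !dtorusE //; apply: eq_big_seq => m; rewrite mem_iota add1n ltnS /a' => /andP[_ ->] //.
Qed.

Definition linsym (c1 : C) (c : nat -> C) (ps : seq nat) (chi : nat -> C) : C :=
  Cplus c1 (\csum_(q <- ps) Cmult (c q) (chi q)).

Lemma linsym_dp c1 c ps : all prime ps -> dirichlet_poly (linsym c1 c ps).
Proof.
move=> hp; apply: dp_add; first exact: dp_const.
by apply: dp_sum => q hq; apply: dp_scal; apply: dp_char; apply: prime_gt0; apply: (allP hp).
Qed.

Lemma linsym_bound c1 c ps chi : (forall q, q \in ps -> Cmod (chi q) <= 1) ->
  Cmod (linsym c1 c ps chi) <= Cmod c1 + \rsum_(q <- ps) Cmod (c q).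
Proof.
move=> h; apply: Rle_trans (Cmod_triangle _ _) _; apply: Rplus_le_compat_l.
apply: Rle_trans (Cmod_csum _ _ _) _; apply: rsum_le_seq => q hq; rewrite Cmod_mult.
have := h q hq; have := Cmod_ge_0 (c q); have := Cmod_ge_0 (chi q); nra.
Qed.

Section SymbolBound.

Variables (c1 : C) (c : nat -> C) (ps : seq nat).
Hypothesis (pps : all prime ps).

Let phi (s : C) : C := linsym c1 c ps (fun n => cpow_neg n s).

Let phi_bound s : 0 <= Re s -> Cmod (phi s) <= Cmod c1 + \rsum_(q <- ps) Cmod (c q).
Proof.
move=> hs; apply: linsym_bound => q /(allP pps) hq; apply: Cmod_cpow_le1 => //; exact: prime_gt0.
Qed.

(** The class supplies data that describe the symbol for [Re s > 1/2], while the conclusion concerns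
    [Re s > 0]. Boundedness of the symbol excludes [c0 >= 1]; uniqueness of Dirichlet coefficients
    identifies [c']; uniform convergence then gives [phi = phi0] on the whole right half-plane. *)
Lemma GH_linsym_halfplane : in_GH_class phi -> forall s, 0 < Re s -> 1 / 2 < Re (phi s).
Proof.
move=> [c0 [c' [phi0 [hphi [hu hc0]]]]].
have hpb := phi_bound; set B := Cmod c1 + \rsum_(q <- ps) Cmod (c q) in hpb.
have c00 : c0 = 0%N.
  case: c0 hphi {hc0} => // k hphi; exfalso.
  have [N hN] := hu (1 / 2) ltac:(lra) 1 ltac:(lra).
  pose B' := \rsum_(n <- iota 1 N) Cmod (c' n).
  have B'0 : 0 <= B' by apply: rsum_ge0 => n _; apply: Cmod_ge_0.
  have B0 : 0 <= B by have := hpb (1, 0) ltac:(rewrite /=; lra); have := Cmod_ge_0 (phi (1, 0)); lra.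
  (* At this real point [c0 * s] exceeds the bound [B] for the symbol, the bound [B'] for the
     partial sum and the error 1 together. *)
  pose x := B + B' + 2; have hx : 1 / 2 < x by rewrite /x; lra.
  have h1 := hN N (le_n _) (x, 0) hx.
  have h2 := hpb (x, 0) ltac:(rewrite /=; lra).
  have h3 : Cmod (dir_sum c' N (x, 0)) <= B'.
    rewrite dir_sumE; apply: Rle_trans (Cmod_csum _ _ _) _; apply: rsum_le_seq => n.
    rewrite mem_iota => /andP[hn _]; rewrite Cmod_mult.
    have := Cmod_cpow_le1 n (x, 0) hn ltac:(rewrite /=; lra); have := Cmod_ge_0 (c' n); nra.
  have h4 : x <= Cmod (Cmult (RtoC (INR k.+1)) (x, 0)).
    rewrite Cmod_mult Cmod_R Rabs_pos_eq; last exact: pos_INR.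
    have -> : (x, 0) = RtoC x by [].
    rewrite Cmod_R Rabs_pos_eq; last lra.
    have := pos_INR k; rewrite S_INR; nra.
  have e : Cmult (RtoC (INR k.+1)) (x, 0) =
     Cplus (phi (x, 0)) (Cplus (Cminus (dir_sum c' N (x, 0)) (phi0 (x, 0))) (Copp (dir_sum c' N (x, 0)))).
    by rewrite (hphi (x, 0) hx); ring.
  rewrite e in h4.
  have := Cmod_triangle (phi (x, 0)) (Cplus (Cminus (dir_sum c' N (x, 0)) (phi0 (x, 0))) (Copp (dir_sum c' N (x, 0)))).
  have := Cmod_triangle (Cminus (dir_sum c' N (x, 0)) (phi0 (x, 0))) (Copp (dir_sum c' N (x, 0))).
  rewrite Cmod_opp; rewrite /x in h4 *; rewrite /x in h1 h2 h3; lra.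
rewrite c00 in hphi; case: hc0 => [[_ hre]|[]]; last by rewrite c00 => /leP.
have [Ne [e [he ee]]] := linsym_dp c1 c ps pps.
have phiE s M : (Ne <= M)%N -> phi s = dir_sum e M s.
  by move=> hM; rewrite /phi ee ?dir_sumE -?(dp_widen Ne M) //; apply: character_cpow.
have coef n : (0 < n)%N -> c' n = e n.
  move=> hn.
  suff h0 : Cmod (Cminus (c' n) (e n)) = 0.
    have := Cmod_eq_0 _ h0 => h1; have -> : c' n = Cplus (Cminus (c' n) (e n)) (e n) by ring.
    by rewrite h1 Cplus_0_l.
  apply: Rle_antisym; last exact: Cmod_ge_0.
  apply: Rnot_lt_le => hlt.
  have hnr : 0 < exp (- 1 * ln (INR n)) by apply: exp_pos.
  (* Half of what a discrepancy of the [n]-th coefficients contributes on the line [Re s = 1]. *)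
  set eps := Cmod (Cminus (c' n) (e n)) * exp (- 1 * ln (INR n)) / 2.
  have heps : 0 < eps by rewrite /eps; nra.
  have [N hN] := hu (1 / 2) ltac:(lra) eps heps.
  pose M := (N + Ne + n)%N.
  have hM : (0 < n <= M)%N by rewrite hn leq_addl.
  pose a n := Cmult (Cminus (c' n) (e n)) (RtoC (exp (- 1 * ln (INR n)))).
  have := dirichlet_coef_le a M eps _ n hM.
  rewrite /a Cmod_mult Cmod_R (Rabs_pos_eq (exp _)); last lra.
  suff ht t : Cmod (dir_sum a M (0, t)) <= eps by move=> /(_ ht); move: heps; rewrite /eps; lra.
  have -> : dir_sum a M (0, t) = Cminus (dir_sum c' M (1, t)) (phi0 (1, t)).
    have -> : phi0 (1, t) = phi (1, t) by rewrite hphi /=; [ring|lra].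
    rewrite (phiE _ M); last by rewrite /M -addnA addnCA leq_addr.
    rewrite -dir_sum_shift !dir_sumE.
    have -> : \csum_(n <- iota 1 M) Cmult (Cminus (c' n) (e n)) (cpow_neg n (1, t)) =
       \csum_(n <- iota 1 M) Cplus (Cmult (c' n) (cpow_neg n (1, t))) (Cmult (RtoC (-1)) (Cmult (e n) (cpow_neg n (1, t)))).
      by apply: eq_bigr => m _; ring.
    by rewrite big_split -big_distrr /=; ring.
  apply: Rlt_le; apply: hN; last by rewrite /=; lra.
  by apply/leP; rewrite /M -addnA leq_addr.
move=> s hs; suff -> : phi s = phi0 s by apply: hre.
suff h0 : Cmod (Cminus (phi s) (phi0 s)) = 0.
  have := Cmod_eq_0 _ h0 => h1; have -> : phi s = Cplus (Cminus (phi s) (phi0 s)) (phi0 s) by ring.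
  by rewrite h1 Cplus_0_l.
apply: Rle_antisym; last exact: Cmod_ge_0.
apply: le_epsilon => eps heps; rewrite Rplus_0_l.
have [N hN] := hu (Re s / 2) ltac:(lra) eps heps.
have := hN (N + Ne)%N ltac:(by apply/leP; rewrite leq_addr) s ltac:(lra).
have -> : dir_sum c' (N + Ne) s = phi s.
  rewrite (phiE s (N + Ne)%N) ?leq_addl // !dir_sumE; apply: eq_big_seq => n.
  by rewrite mem_iota => /andP[hn _]; rewrite coef.
lra.
Qed.

End SymbolBound.

Lemma ang_prime l th q : uniq l -> all prime l -> q \in l -> ang l th q = th q.
Proof.
move=> ul pl hq; rewrite /ang (bigD1_seq q) //= logn_prime ?(allP pl) // eqxx Rmult_1_l.
rewrite big1_seq ?Rplus_0_r // => p /andP[hpq hp].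
by rewrite logn_prime ?(allP pl) // (negbTE hpq) Rmult_0_l.
Qed.

(** [dirpoly_sup_torus] controls moduli, so the half-plane is replaced by a large disc. After
    translation by [- 1/2 - X] the values on the line [Re s = eta] have modulus at most
    [sqrt (X^2 + B^2)], barely more than [X]. If the claim failed by [rho], the value at the angles
    [al] would have modulus at least [X + rho]. Finally [eta] tends to 0. *)
Lemma GH_linsym_extremal c1 c ps : all prime ps ->
  in_GH_class (fun s => linsym c1 c ps (fun n => cpow_neg n s)) ->
  1 / 2 + \rsum_(q <- ps) Cmod (c q) <= Re c1.
Proof.
move=> pps hG; have hre := GH_linsym_halfplane c1 c ps pps hG.
set B := Cmod c1 + \rsum_(q <- ps) Cmod (c q).
have key eta : 0 < eta -> 1 / 2 + \rsum_(q <- ps) Cmod (c q) * exp (- eta * ln (INR q)) <= Re c1.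
  move=> he; apply: Rnot_lt_le => hlt.
  set S := \rsum_(q <- ps) _ in hlt.
  have [Ne [e [hev ee]]] := linsym_dp c1 c ps pps.
  have hsum0 : 0 <= \rsum_(q <- ps) Cmod (c q) by apply: rsum_ge0 => q _; apply: Cmod_ge_0.
  have hB0 : 0 <= B by rewrite /B; have := Cmod_ge_0 c1; lra.
  have hB s : 0 <= Re s -> Cmod (linsym c1 c ps (fun n => cpow_neg n s)) <= B.
    move=> hs; apply: linsym_bound => q /(allP pps) hq; apply: Cmod_cpow_le1 => //; exact: prime_gt0.
  pose rho := 1 / 2 + S - Re c1; have hrho : 0 < rho by rewrite /rho; lra.
  (* [X * rho > B^2] gives [(X + rho)^2 > X^2 + B^2], and [X >= B] keeps the translated real part in
     [[- X, 0]]. *)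
  pose X := B ^ 2 / rho + B + 1.
  have hX0 : 0 <= B ^ 2 / rho by apply: Rdiv_le_0_compat => //; apply: pow2_ge_0.
  have hX : 0 < X by rewrite /X; lra.
  have hXr : B ^ 2 < X * rho.
    have -> : X * rho = B ^ 2 + (B + 1) * rho by rewrite /X; field; lra.
    nra.
  (* the symbol on the line [Re s = eta], moved far to the left *)
  have [N [a [ha ea]]] : dirichlet_poly (fun chi =>
     Cplus (RtoC (- (1 / 2) - X)) (linsym c1 (fun q => Cmult (c q) (RtoC (exp (- eta * ln (INR q))))) ps chi)).
    by apply: dp_add; [apply: dp_const|apply: linsym_dp].
  (* The primes of [ps] are included so that every angle of [al] used below belongs to a
     variable. *)
  set l := undup (ps ++ [seq p <- iota 1 N | prime p]).
  have hb : prime_base l N.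
    split; first exact: undup_uniq.
      by apply/allP => p; rewrite mem_undup mem_cat => /orP[/(allP pps)//|]; rewrite mem_filter => /andP[].
    move=> n hn; have [_ _ h] := prime_base_iota N; apply/allP => p /(allP (h n hn)) hp.
    by change (p \in l); rewrite mem_undup mem_cat hp orbT.
  have [ul pl _] := hb.
  have hps q : q \in ps -> q \in l by move=> h; rewrite mem_undup mem_cat h.
  have R0 : 0 <= X ^ 2 + B ^ 2 by have := pow2_ge_0 X; have := pow2_ge_0 B; lra.
  have hline t : Cmod (dir_sum a N (0, t)) <= sqrt (X ^ 2 + B ^ 2).
    have -> : dir_sum a N (0, t) = Cplus (RtoC (- (1 / 2) - X)) (linsym c1 c ps (fun n => cpow_neg n (eta, t))).
      rewrite dir_sumE -(ea (fun n => cpow_neg n (0, t))); last exact: character_cpow.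
      congr (Cplus _ (Cplus _ _)); apply: eq_bigr => q _.
      by rewrite (cpow_neg_split q eta t) Cmult_assoc.
    have h1 := hre (eta, t) he; have h2 := hB (eta, t) (Rlt_le _ _ he).
    move: (linsym _ _ _ _) h1 h2 => z h1 h2.
    apply: Rsqr_incr_0_var; last exact: sqrt_pos.
    rewrite Rsqr_sqrt // Rsqr_pow2 Cmod_sqr.
    have h3 := Cmod_sqr z.
    have h4 : Cmod z ^ 2 <= B ^ 2 by apply: pow_incr; split => //; apply: Cmod_ge_0.
    have h5 : Re z <= B by apply: Rle_trans (Rle_abs _) _; apply: Rle_trans h2; apply: re_le_Cmod.
    have -> : Re (Cplus (RtoC (- (1 / 2) - X)) z) = Re z - 1 / 2 - X by rewrite /Re /=; ring.
    have -> : Im (Cplus (RtoC (- (1 / 2) - X)) z) = Im z by rewrite /Im /=; ring.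
    have : B <= X by rewrite /X; lra.
    nra.
  have ht := dirpoly_sup_torus a N l _ hb (sqrt_pos _) hline.
  have [al hal] := exists_angles c.
  have := ht al; rewrite dtorusE // -(ea (fun n => cis (ang l al n))); last exact: character_ang.
  set z := Cplus _ _ => hz.
  have ez : Re z = - X - rho.
    rewrite /z /linsym /rho /S.
    have -> : \csum_(q <- ps) Cmult (Cmult (c q) (RtoC (exp (- eta * ln (INR q))))) (cis (ang l al q)) =
      RtoC (-1 * \rsum_(q <- ps) Cmod (c q) * exp (- eta * ln (INR q))).
      rewrite big_distrr csum_RtoC /=; apply: eq_big_seq => q hq; rewrite ang_prime ?hps //.
      have -> : Cmult (Cmult (c q) (RtoC (exp (- eta * ln (INR q))))) (cis (al q)) =
         Cmult (Cmult (c q) (cis (al q))) (RtoC (exp (- eta * ln (INR q)))) by ring.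
      by rewrite hal -RtoC_mult; congr RtoC; ring.
    by rewrite /Re /=; field.
  have hz2 : X + rho <= Cmod z.
    by have := re_le_Cmod z; rewrite ez Rabs_left; lra.
  have : (X + rho) ^ 2 <= X ^ 2 + B ^ 2.
    rewrite -(pow2_sqrt (X ^ 2 + B ^ 2)) //; apply: pow_incr; lra.
  nra.
set T := \rsum_(q <- ps) Cmod (c q) * ln (INR q).
have T0 : 0 <= T.
  rewrite /T big_seq; apply: rsum_ge0 => q /(allP pps)/prime_gt0/ln_INR_ge0.
  by have := Cmod_ge_0 (c q); nra.
apply: le_epsilon => eps heps.
have he : 0 < eps / (T + 1) by apply: Rdiv_lt_0_compat; lra.
have h1 := key _ he; set eta := eps / (T + 1) in he h1.
have h2 : \rsum_(q <- ps) Cmod (c q) - eta * T <= \rsum_(q <- ps) Cmod (c q) * exp (- eta * ln (INR q)).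
  have -> : \rsum_(q <- ps) Cmod (c q) - eta * T =
     \rsum_(q <- ps) (Cmod (c q) + - eta * (Cmod (c q) * ln (INR q))).
    by rewrite big_split /= -big_distrr /= -/T; ring.
  apply: rsum_le => q _; have := exp_ineq1_le (- eta * ln (INR q)); have := Cmod_ge_0 (c q); nra.
have h3 : eta * T <= eps.
  have -> : eps = eta * (T + 1) by rewrite /eta; field; lra.
  nra.
lra.
Qed.

(** * Zeta sums and Euler products *)

Definition cexp (w : C) : C := Cmult (RtoC (exp (Re w))) (cis (Im w)).

Lemma cexpD w z : cexp (Cplus w z) = Cmult (cexp w) (cexp z).
Proof.
rewrite /cexp -[Re (Cplus w z)]/(Re w + Re z) -[Im (Cplus w z)]/(Im w + Im z) exp_plus cisD RtoC_mult; ring.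
Qed.

Lemma cexp_0 : cexp (RtoC 0) = RtoC 1.
Proof. by rewrite /cexp /= exp_0 cis0 Cmult_1_l. Qed.

Lemma Cmod_cexp w : Cmod (cexp w) = exp (Re w).
Proof. by rewrite /cexp Cmod_mult Cmod_cis Rmult_1_r Cmod_R Rabs_pos_eq //; apply/Rlt_le/exp_pos. Qed.

Lemma cpow_neg_cexp n s : cpow_neg n s = cexp (Cmult (RtoC (- ln (INR n))) s).
Proof.
rewrite /cpow_neg /cexp.
have -> : Re (Cmult (RtoC (- ln (INR n))) s) = - Re s * ln (INR n) by rewrite /Re /=; ring.
have -> : Im (Cmult (RtoC (- ln (INR n))) s) = - Im s * ln (INR n) by rewrite /Im /=; ring.
by apply: C_ext; rewrite /Re /Im /=; ring.
Qed.

Lemma abs_sin_le y : Rabs (sin y) <= Rabs y.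
Proof.
have [c [_ hc]] := MVT_gen sin 0 y cos (fun t _ => is_derive_sin t) (fun t _ => continuity_sin t).
rewrite sin_0 !Rminus_0_r in hc; rewrite hc Rabs_mult.
have : Rabs (cos c) <= 1 by apply: Rabs_le; have := COS_bound c; lra.
have := Rabs_pos y; nra.
Qed.

Lemma one_minus_cos y : 0 <= 1 - cos y <= y ^ 2 / 2.
Proof.
have h := COS_bound y; split; first lra.
have e : cos y = 1 - 2 * sin (y / 2) ^ 2 by rewrite {1}(_ : y = 2 * (y / 2)); [rewrite cos_2a_sin; ring|field].
have h1 : sin (y / 2) ^ 2 <= (y / 2) ^ 2.
  rewrite -(pow2_abs (sin _)) -(pow2_abs (y / 2)); apply: pow_incr; split; first exact: Rabs_pos.
  exact: abs_sin_le.
rewrite e; lra.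
Qed.

Lemma sin_minus_id y : Rabs (sin y - y) <= 2 * y ^ 2.
Proof.
case: (Rle_dec (Rabs y) 1) => hy; last first.
  have h1 : Rabs (sin y - y) <= 2 * Rabs y.
    by apply: Rle_trans (Rabs_triang _ _) _; rewrite Rabs_Ropp; have := abs_sin_le y; lra.
  rewrite -pow2_abs; nra.
have [c [hc1 hc]] := MVT_gen (fun t => sin t - t) 0 y (fun t => cos t - 1)
  (fun t _ => ltac:(auto_derive => //; ring))
  (fun t _ => ltac:(apply: continuity_pt_minus; [exact: continuity_sin|exact: continuity_pt_id])).
rewrite sin_0 !Rminus_0_r in hc; rewrite hc Rabs_mult.
have hc2 : Rabs c <= Rabs y.
  move: hc1; rewrite /Rmin /Rmax; case: Rle_dec => h [h1 h2]; rewrite /Rabs;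
  repeat case: Rcase_abs => ?; lra.
have h3 : Rabs (cos c - 1) <= c ^ 2 / 2 by have := one_minus_cos c => h; rewrite Rabs_left1; lra.
have h4 : c ^ 2 <= Rabs y ^ 2 by rewrite -(pow2_abs c); apply: pow_incr; split => //; apply: Rabs_pos.
have h5 := Rabs_pos y; rewrite -(pow2_abs y); have := Rabs_pos (cos c - 1); nra.
Qed.

Lemma exp_le_mono a b : a <= b -> exp a <= exp b.
Proof. by case=> [/exp_increasing|->]; [left|right]. Qed.

Lemma exp_taylor1 x M : Rmax 0 x <= M -> Rabs (exp x - 1) <= exp M * Rabs x.
Proof.
move=> hM.
have [c [hc1 hc]] := MVT_gen exp 0 x exp (fun t _ => is_derive_exp t)
   (fun t _ => derivable_continuous_pt _ _ (derivable_pt_exp t)).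
rewrite exp_0 Rminus_0_r in hc; rewrite hc Rabs_mult Rabs_pos_eq; last exact/Rlt_le/exp_pos.
apply: Rmult_le_compat_r; first exact: Rabs_pos.
by apply: exp_le_mono; have := proj2 hc1; lra.
Qed.

Lemma exp_taylor2 x M : Rmax 0 x <= M -> Rabs (exp x - 1 - x) <= exp M * x ^ 2.
Proof.
move=> hM.
have [c [hc1 hc]] := MVT_gen (fun t => exp t - 1 - t) 0 x (fun t => exp t - 1)
  (fun t _ => ltac:(auto_derive => //; ring))
  (fun t _ => ltac:(apply/continuity_pt_filterlim; apply: (ex_derive_continuous (fun t => exp t - 1 - t)); auto_derive => //)).
rewrite exp_0 in hc.
have -> : exp x - 1 - x = (exp c - 1) * x by move: hc; rewrite !Rminus_0_r; lra.
rewrite Rabs_mult.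
have hcM : Rmax 0 c <= M.
  apply: Rmax_lub; first by apply: Rle_trans hM; apply: Rmax_l.
  by apply: Rle_trans (proj2 hc1) hM.
have h1 := exp_taylor1 c M hcM.
have hc2 : Rabs c <= Rabs x.
  move: hc1; rewrite /Rmin /Rmax; case: Rle_dec => h [h1' h2]; rewrite /Rabs;
  repeat case: Rcase_abs => ?; lra.
have h3 := exp_pos M; have h4 := Rabs_pos x; have h5 := Rabs_pos c.
rewrite -(pow2_abs x); have := Rmult_le_compat_r _ _ _ h4 h1.
have : exp M * Rabs c * Rabs x <= exp M * Rabs x * Rabs x.
  by apply: Rmult_le_compat_r => //; apply: Rmult_le_compat_l => //; lra.
lra.
Qed.

(** The hypothesis concerns the positive part of [Re w], so the factor [exp M] is 1 when
    [Re w <= 0], the case of the zeta sums. *)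
Lemma cexp_taylor w M : Rmax 0 (Re w) <= M ->
  Cmod (Cminus (Cminus (cexp w) 1) w) <= 6 * exp M * Cmod w ^ 2.
Proof.
case: w => x y; rewrite [Re _]/= => hM.
have eM : 1 <= exp M.
  by rewrite -exp_0; apply: exp_le_mono; apply: Rle_trans (Rmax_l _ _) hM.
have exM : exp x <= exp M by apply: exp_le_mono; apply: Rle_trans (Rmax_r _ _) hM.
have h1 := exp_taylor1 x M hM; have h2 := exp_taylor2 x M hM.
have h3 := one_minus_cos y; have h4 := sin_minus_id y.
set z := Cminus _ _.
have ez : z = (exp x * (cos y - 1) + (exp x - 1 - x), exp x * (sin y - y) + (exp x - 1) * y).
  by apply: C_ext; rewrite /z /cexp /cis /Re /Im /=; ring.
have hx0 := exp_pos x.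
have hre : Rabs (Re z) <= exp M * (y ^ 2 / 2) + exp M * x ^ 2.
  rewrite ez [Re _]/=; apply: Rle_trans (Rabs_triang _ _) _; apply: Rplus_le_compat => //.
  rewrite Rabs_mult Rabs_pos_eq; last lra.
  apply: Rmult_le_compat => //; [lra|exact: Rabs_pos|]; rewrite Rabs_left1; lra.
have him : Rabs (Im z) <= exp M * (2 * y ^ 2) + exp M * (Rabs x * Rabs y).
  rewrite ez [Im _]/=; apply: Rle_trans (Rabs_triang _ _) _; apply: Rplus_le_compat.
    rewrite Rabs_mult Rabs_pos_eq; last lra.
    by apply: Rmult_le_compat => //; [lra|exact: Rabs_pos].
  rewrite Rabs_mult; have := Rmult_le_compat_r _ _ _ (Rabs_pos y) h1; lra.
have hz : Cmod z <= Rabs (Re z) + Rabs (Im z).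
  have -> : z = Cplus (RtoC (Re z)) (Cmult Ci (RtoC (Im z))).
    by apply: C_ext; rewrite /Re /Im /=; ring.
  apply: Rle_trans (Cmod_triangle _ _) _; rewrite Cmod_mult Cmod_Ci !Cmod_R.
  rewrite /Re /Im /=; apply: Req_le; rewrite !Rmult_1_l; congr (Rabs _ + Rabs _); ring.
rewrite Cmod_sqr [Re _]/= [Im _]/=.
have hxy : 2 * (Rabs x * Rabs y) <= x ^ 2 + y ^ 2.
  rewrite -(pow2_abs x) -(pow2_abs y); have := pow2_ge_0 (Rabs x - Rabs y); nra.
have : 0 <= x ^ 2 by apply: pow2_ge_0.
have : 0 <= y ^ 2 by apply: pow2_ge_0.
nra.
Qed.

Lemma ln_succ_bounds n : (0 < n)%N ->
  0 <= / INR n - ln (1 + / INR n) <= / INR n ^ 2 /\ 0 <= ln (1 + / INR n) <= / INR n.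
Proof.
move=> hn; have hN := INR_gt0 n hn; have hi := Rinv_0_lt_compat _ hN.
have hN1 : 1 <= INR n by apply: (le_INR 1); apply/leP.
have up : ln (1 + / INR n) <= / INR n.
  rewrite -[X in _ <= X]ln_exp; apply: ln_le; first lra.
  exact: exp_ineq1_le.
have lo : / INR n - / INR n ^ 2 <= ln (1 + / INR n).
  have h : / (1 + / INR n) = 1 - / (INR n + 1) by field; lra.
  have h1 : ln (/ (1 + / INR n)) <= - / (INR n + 1).
    rewrite -[X in _ <= X]ln_exp; apply: ln_le; first by apply: Rinv_0_lt_compat; lra.
    rewrite h; have := exp_ineq1_le (- / (INR n + 1)); lra.
  rewrite ln_Rinv in h1; last lra.
  apply: Rle_trans (_ : / (INR n + 1) <= _); last lra.
  have -> : / INR n - / INR n ^ 2 = (INR n - 1) / INR n ^ 2 by field; lra.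
  apply: (Rmult_le_reg_r (INR n ^ 2 * (INR n + 1))); first by nra.
  have -> : (INR n - 1) / INR n ^ 2 * (INR n ^ 2 * (INR n + 1)) = INR n ^ 2 - 1 by field; lra.
  have -> : / (INR n + 1) * (INR n ^ 2 * (INR n + 1)) = INR n ^ 2 by field; lra.
  lra.
split; split; try lra.
rewrite -ln_1; apply: ln_le; lra.
Qed.

Lemma sum_inv_sqr N : \rsum_(n <- iota 1 N) / INR n ^ 2 <= 2.
Proof.
case: N => [|N]; first by rewrite big_nil; lra.
suff : \rsum_(n <- iota 1 N.+1) / INR n ^ 2 <= 2 - / INR N.+1.
  have := Rinv_0_lt_compat _ (INR_gt0 N.+1 isT); lra.
elim: N => [|N IH]; first by rewrite big_seq1 /= !Rmult_1_r Rinv_1; lra.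
rewrite -(addn1 N.+1) iotaD big_cat big_seq1 add1n addn1.
have hN := INR_gt0 N.+1 isT; move: IH; rewrite (S_INR N.+1); set x := INR N.+1 in hN *.
move=> IH; suff : / (x + 1) ^ 2 <= / x - / (x + 1) by rewrite /=; rewrite /= in IH; lra.
have -> : / x - / (x + 1) = / (x * (x + 1)) by field; lra.
apply: Rinv_le_contravar; nra.
Qed.

(** [z n^(-1-z)] differs from [n^(-z) - (n+1)^(-z)] by at most a multiple of [(|z| + |z|^2) / n^2],
    and the latter telescopes. The bound reflects the simple pole of zeta at 1 and is uniform in
    [N], as the sieve works with finite sums. *)
Lemma zeta_partial_bound z N : 0 <= Re z ->
  Cmod z * Cmod (\csum_(n <- iota 1 N) cpow_neg n (Cplus 1 z)) <= 2 + 2 * Cmod z + 12 * Cmod z ^ 2.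
Proof.
move=> hz; have z0 := Cmod_ge_0 z.
pose r n := cpow_neg n z.
have hr n : (0 < n)%N -> Cmod (r n) <= 1 by move=> hn; apply: Cmod_cpow_le1.
pose D n := Cminus (Cmult z (cpow_neg n (Cplus 1 z))) (Cminus (r n) (r n.+1)).
have hD n : (0 < n)%N -> Cmod (D n) <= (Cmod z + 6 * Cmod z ^ 2) * / INR n ^ 2.
  move=> hn; have hN := INR_gt0 n hn; have hi := Rinv_0_lt_compat _ hN.
  have [[l1 l2] [l3 l4]] := ln_succ_bounds n hn.
  set L := ln (1 + / INR n) in l1 l2 l3 l4.
  have hL : ln (INR n.+1) = ln (INR n) + L.
    rewrite /L -ln_mult; [|lra|lra]; congr ln; rewrite S_INR; field; lra.
  have e1 : r n.+1 = Cmult (r n) (cexp (Cmult (RtoC (- L)) z)).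
    rewrite /r !cpow_neg_cexp -cexpD hL; congr cexp; apply: C_ext; rewrite /Re /Im /=; ring.
  have e2 : cpow_neg n (Cplus 1 z) = Cmult (RtoC (/ INR n)) (r n).
    rewrite /r !cpow_neg_cexp.
    have -> : Cmult (RtoC (- ln (INR n))) (Cplus 1 z) = Cplus (RtoC (- ln (INR n))) (Cmult (RtoC (- ln (INR n))) z) by ring.
    rewrite cexpD; congr (Cmult _ _); rewrite /cexp /= cis0 exp_Ropp exp_ln // Cmult_1_r //.
  set w := Cmult (RtoC (- L)) z in e1.
  have eD : D n = Cmult (r n) (Cplus (Cmult (RtoC (/ INR n - L)) z) (Cminus (Cminus (cexp w) 1) w)).
    rewrite /D e1 e2 /w RtoC_minus RtoC_opp; ring.
  have hw : Cmod (Cminus (Cminus (cexp w) 1) w) <= 6 * exp 0 * Cmod w ^ 2.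
    apply: cexp_taylor; apply: Rmax_lub; first lra.
    have -> : Re w = - (L * Re z) by rewrite /w /Re /=; ring.
    have := Rmult_le_pos _ _ l3 hz; lra.
  rewrite exp_0 Rmult_1_r in hw.
  have hwm : Cmod w <= / INR n * Cmod z.
    rewrite /w Cmod_mult Cmod_R Rabs_Ropp Rabs_pos_eq //; nra.
  have hw2 : Cmod w ^ 2 <= (/ INR n * Cmod z) ^ 2 by apply: pow_incr; split => //; apply: Cmod_ge_0.
  rewrite eD Cmod_mult.
  have h1 := Cmod_triangle (Cmult (RtoC (/ INR n - L)) z) (Cminus (Cminus (cexp w) 1) w).
  rewrite Cmod_mult Cmod_R Rabs_pos_eq // in h1.
  have h2 : (/ INR n - L) * Cmod z <= / INR n ^ 2 * Cmod z.
    apply: Rmult_le_compat_r => //; move: l2; rewrite pow_inv; lra.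
  have h3 := hr n hn; have h4 := Cmod_ge_0 (r n).
  set A := Cmod (Cplus _ _) in h1 *; have hA : 0 <= A by apply: Cmod_ge_0.
  apply: Rle_trans (_ : A <= _); first by nra.
  rewrite Rpow_mult_distr pow_inv in hw2; lra.
have tel : \csum_(n <- iota 1 N) Cminus (r n) (r n.+1) = Cminus (r 1%N) (r N.+1).
  elim: N => [|N IH]; first by rewrite big_nil; ring.
  rewrite -(addn1 N) iotaD big_cat big_seq1 IH add1n addn1 /=; ring.
have e : Cmult z (\csum_(n <- iota 1 N) cpow_neg n (Cplus 1 z)) =
    Cplus (Cminus (r 1%N) (r N.+1)) (\csum_(n <- iota 1 N) D n).
  rewrite -tel big_distrr /= -big_split /=; apply: eq_bigr => n _; rewrite /D; ring.
rewrite -Cmod_mult e.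
apply: Rle_trans (Cmod_triangle _ _) _.
have h1 : Cmod (Cminus (r 1%N) (r N.+1)) <= 2.
  apply: Rle_trans (Cmod_triangle _ _) _; rewrite Cmod_opp.
  have := hr 1%N isT; have := hr N.+1 isT; lra.
have h2 : Cmod (\csum_(n <- iota 1 N) D n) <= (Cmod z + 6 * Cmod z ^ 2) * 2.
  apply: Rle_trans (Cmod_csum _ _ _) _.
  apply: Rle_trans (_ : \rsum_(n <- iota 1 N) (Cmod z + 6 * Cmod z ^ 2) * / INR n ^ 2 <= _).
    by apply: rsum_le_seq => n; rewrite mem_iota => /andP[hn _]; apply: hD.
  rewrite -big_distrr /=; apply: Rmult_le_compat_l; last exact: sum_inv_sqr.
  have := pow2_ge_0 (Cmod z); lra.
lra.
Qed.

(** * Sums over primes and Euler products near the point 1 *)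

Definition nps (sg : R) (n : nat) : R := exp (- sg * ln (INR n)).

Lemma nps_gt0 sg n : 0 < nps sg n.
Proof. exact: exp_pos. Qed.

Lemma npsM sg m n : (0 < m)%N -> (0 < n)%N -> nps sg (m * n) = nps sg m * nps sg n.
Proof.
by move=> hm hn; rewrite /nps -exp_plus mult_INR ln_mult; [congr exp; ring|exact: INR_gt0..].
Qed.

Lemma nps1 sg : nps sg 1 = 1.
Proof. by rewrite /nps /= ln_1 Rmult_0_r exp_0. Qed.

Lemma npsX sg p k : (0 < p)%N -> nps sg (p ^ k) = nps sg p ^ k.
Proof.
move=> hp; elim: k => [|k IH]; first by rewrite expn0 nps1.
by rewrite expnS npsM ?expn_gt0 ?hp // IH.
Qed.

Lemma nps_le_inv sg n : (0 < n)%N -> 1 <= sg -> nps sg n <= / INR n.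
Proof.
move=> hn hs; have -> : / INR n = exp (- ln (INR n)) by rewrite exp_Ropp exp_ln //; exact: INR_gt0.
apply: exp_le_mono; have := ln_INR_ge0 n hn; nra.
Qed.

Lemma zeta_real x N : 0 < x -> x * \rsum_(n <- iota 1 N) nps (1 + x) n <= 2 + 2 * x + 12 * x ^ 2.
Proof.
move=> hx; have := zeta_partial_bound (RtoC x) N ltac:(rewrite /=; lra).
rewrite Cmod_R Rabs_pos_eq; last lra.
have -> : \csum_(n <- iota 1 N) cpow_neg n (Cplus 1 (RtoC x)) = RtoC (\rsum_(n <- iota 1 N) nps (1 + x) n).
  rewrite csum_RtoC; apply: eq_bigr => n _; rewrite -RtoC_plus.
  by apply: C_ext; rewrite /cpow_neg /nps /Re /Im /= Ropp_0 Rmult_0_l ?cos_0 ?sin_0; ring.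
rewrite Cmod_R Rabs_pos_eq //; apply: rsum_ge0 => n _; exact/Rlt_le/nps_gt0.
Qed.

Lemma rsum_uniq_le (l : seq nat) F : uniq l -> all (leq 1) l -> (forall n, 0 <= F n) ->
  \rsum_(n <- l) F n <= \rsum_(n <- iota 1 (sumn l)) F n.
Proof.
move=> ul pl hF; apply: rsum_subset => // [|n hn]; first exact: iota_uniq.
rewrite mem_iota (allP pl n hn) add1n ltnS /= {ul pl}.
elim: l hn => //= m l IH; rewrite inE => /orP[/eqP ->|/IH h]; first exact: leq_addr.
exact: leq_trans h (leq_addl _ _).
Qed.

(** The products of subsets of [l], which index the expansion of the product of the factors
    [1 + p^(-sg)]. *)
Fixpoint sqfree_list (l : seq nat) : seq nat :=
  if l is p :: l' then sqfree_list l' ++ map (muln p) (sqfree_list l') else [:: 1%N].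

Lemma sqfree_listP l : uniq l -> all prime l ->
  uniq (sqfree_list l) /\ all (fun n => (0 < n)%N && smooth l n) (sqfree_list l).
Proof.
elim: l => [|p l IH] //= /andP[hp ul] /andP[pp pl]; have [h1 h2] := IH ul pl.
split.
  rewrite cat_uniq h1 map_inj_uniq ?h1 ?andbT /=; last first.
    by move=> x y /eqP; rewrite eqn_pmul2l ?prime_gt0 // => /eqP.
  apply/hasPn => n /mapP[m hm ->]; apply/negP => /(allP h2)/andP[h0 hs].
  have /andP[m0 _] := allP h2 _ hm; have p0 := prime_gt0 pp.
  have := smooth_logn p l _ pp hp hs; rewrite lognM //.
  by rewrite logn_prime // eqxx.
rewrite all_cat; apply/andP; split.
  apply: sub_all h2 => n /andP[-> hs] /=; apply: sub_all hs => q hq.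
  by change (q \in p :: l); rewrite inE orbC; apply/orP; left.
apply/allP => n /mapP[m hm ->]; have /andP[m0 hs] := allP h2 _ hm.
rewrite muln_gt0 (prime_gt0 pp) m0 /=; apply/allP => q; rewrite mem_primes => /and3P[pq _].
rewrite Euclid_dvdM // => /orP[|hd].
  by rewrite dvdn_prime2 // => /eqP ->; apply: mem_head.
have := allP hs q; rewrite mem_primes pq m0 hd => /(_ isT) h.
by change (q \in p :: l); rewrite inE orbC; apply/orP; left.
Qed.

Lemma prod_sqfree sg l : all prime l -> 
  \big[Rmult/1]_(p <- l) (1 + nps sg p) = \rsum_(n <- sqfree_list l) nps sg n.
Proof.
elim: l => [|p l IH] /=; first by rewrite big_nil big_seq1 nps1.
move=> /andP[pp pl]; rewrite big_cons IH // big_cat big_map /=.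
have -> : \rsum_(i <- sqfree_list l) nps sg (p * i) = nps sg p * \rsum_(i <- sqfree_list l) nps sg i.
  rewrite big_distrr /=; apply: eq_big_seq => n hn; apply: npsM; first exact: prime_gt0.
  have pos : all (leq 1) (sqfree_list l).
    elim: (l) pl => //= q l' IHl /andP[pq pl']; rewrite all_cat IHl //=.
    by apply/allP => m /mapP[k hk ->]; rewrite muln_gt0 (prime_gt0 pq); apply: (allP (IHl pl')).
  exact: (allP pos).
ring.
Qed.

Lemma exp_le_1plus u : 0 <= u -> exp (u - u ^ 2) <= 1 + u.
Proof.
move=> hu; have h := exp_ineq1_le (- (u - u ^ 2)).
have hpos : 0 < 1 - u + u ^ 2 by have := pow2_ge_0 (u - 1 / 2); nra.
have -> : exp (u - u ^ 2) = / exp (- (u - u ^ 2)) by rewrite exp_Ropp Rinv_inv.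
apply: Rle_trans (Rinv_le_contravar (1 - u + u ^ 2) _ hpos _) _; first lra.
apply: (Rmult_le_reg_r (1 - u + u ^ 2)) => //; rewrite Rinv_l; last lra.
have : 0 <= u ^ 3 by apply: pow_le.
nra.
Qed.

Lemma exp_rsum (I : Type) (r : seq I) (F : I -> R) :
  exp (\rsum_(i <- r) F i) = \big[Rmult/1]_(i <- r) exp (F i).
Proof. by apply: (big_morph exp) => [x y|]; [exact: exp_plus|exact: exp_0]. Qed.

Lemma rprod_le (I : eqType) (r : seq I) (F G : I -> R) : (forall i, i \in r -> 0 <= F i <= G i) ->
  0 <= \big[Rmult/1]_(i <- r) F i <= \big[Rmult/1]_(i <- r) G i.
Proof.
elim: r => [|i r IH] h; first by rewrite !big_nil; lra.
rewrite !big_cons; have := h i (mem_head _ _).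
have [a1 a2] : 0 <= \big[Rmult/1]_(j <- r) F j <= \big[Rmult/1]_(j <- r) G j.
  by apply: IH => j hj; apply: h; rewrite inE hj orbT.
move=> [b1 b2]; split; first exact: Rmult_le_pos.
exact: Rmult_le_compat.
Qed.

Lemma sum_inv_sqr_uniq l : uniq l -> all (leq 1) l -> \rsum_(n <- l) / INR n ^ 2 <= 2.
Proof.
move=> ul pl.
have h : \rsum_(n <- l) Rabs (/ INR n ^ 2) <= \rsum_(n <- iota 1 (sumn l)) Rabs (/ INR n ^ 2).
  by apply: rsum_uniq_le => // n; apply: Rabs_pos.
have e (s : seq nat) : all (leq 1) s -> \rsum_(n <- s) Rabs (/ INR n ^ 2) = \rsum_(n <- s) / INR n ^ 2.
  move=> hs; apply: eq_big_seq => n /(allP hs) hn; apply: Rabs_pos_eq.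
  by apply/Rlt_le/Rinv_0_lt_compat/pow_lt/INR_gt0.
have hi : all (leq 1) (iota 1 (sumn l)) by apply/allP => n; rewrite mem_iota => /andP[].
rewrite (e l pl) (e _ hi) in h; exact: Rle_trans h (sum_inv_sqr _).
Qed.

(** Exponential form of [sum p^(-1-x) <= ln (1/x) + O(1)]. The product of the [1 + p^(-1-x)] is
    dominated by a zeta sum, and the squares lost in [exp (u - u^2) <= 1 + u] add up to at most
    2. *)
Lemma exp_sum_primes x l : 0 < x -> uniq l -> all prime l ->
  exp (\rsum_(p <- l) nps (1 + x) p) <= exp 2 * ((2 + 2 * x + 12 * x ^ 2) / x).
Proof.
move=> hx ul pl.
have pos : all (leq 1) l by apply: sub_all pl => p; apply: prime_gt0.
have h1 : \big[Rmult/1]_(p <- l) exp (nps (1 + x) p - nps (1 + x) p ^ 2) <=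
          \big[Rmult/1]_(p <- l) (1 + nps (1 + x) p).
  apply: (proj2 (rprod_le _ _ _ _ _)) => p _; split; first exact/Rlt_le/exp_pos.
  exact/exp_le_1plus/Rlt_le/nps_gt0.
rewrite prod_sqfree // -exp_rsum in h1.
have [us hs] := sqfree_listP l ul pl.
have pos2 : all (leq 1) (sqfree_list l) by apply: sub_all hs => n /andP[].
have h2 := rsum_uniq_le _ (nps (1 + x)) us pos2 (fun n => Rlt_le _ _ (nps_gt0 _ n)).
have h3 := zeta_real x (sumn (sqfree_list l)) hx.
have h4 : \rsum_(n <- iota 1 (sumn (sqfree_list l))) nps (1 + x) n <= (2 + 2 * x + 12 * x ^ 2) / x.
  apply: (Rmult_le_reg_l x) => //; have -> : x * ((2 + 2 * x + 12 * x ^ 2) / x) = 2 + 2 * x + 12 * x ^ 2 by field; lra.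
  exact: h3.
have h5 : \rsum_(p <- l) nps (1 + x) p ^ 2 <= 2.
  apply: Rle_trans (sum_inv_sqr_uniq l ul pos); apply: rsum_le_seq => p hp.
  rewrite -pow_inv; apply: pow_incr; split; first exact/Rlt_le/nps_gt0.
  by apply: nps_le_inv; [apply: (allP pos)|lra].
have e : \rsum_(p <- l) nps (1 + x) p <= 2 + \rsum_(p <- l) (nps (1 + x) p - nps (1 + x) p ^ 2).
  have -> : \rsum_(p <- l) (nps (1 + x) p - nps (1 + x) p ^ 2) =
     \rsum_(p <- l) (nps (1 + x) p + -1 * nps (1 + x) p ^ 2) by apply: eq_bigr => p _; ring.
  rewrite big_split /= -big_distrr /=; move: h5.
  by set A := \rsum_(p <- l) nps (1 + x) p; set Q := \rsum_(p <- l) nps (1 + x) p ^ 2; lra.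
apply: Rle_trans (exp_le_mono _ _ e) _; rewrite exp_plus.
apply: Rmult_le_compat_l; first exact/Rlt_le/exp_pos.
lra.
Qed.

Lemma wprod_ge0 v l n : (forall k, 0 <= v k) -> 0 <= wprod v l n.
Proof. move=> h; apply: big_ind => //; [lra|exact: Rmult_le_pos]. Qed.

Lemma rsum_geom_tail t n : 0 <= t <= 3 / 4 -> \rsum_(k <- iota 2 n) t ^ k <= 4 * t ^ 2.
Proof.
move=> ht.
have h : forall m, (1 - t) * \rsum_(k <- iota 0 m) t ^ k = 1 - t ^ m.
  elim=> [|m IH]; first by rewrite big_nil /=; ring.
  by rewrite -addn1 iotaD big_cat big_seq1 /= Rmult_plus_distr_l IH add0n addn1 /=; ring.
rewrite -[2%N]/(2 + 0)%N iotaDl big_map.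
have -> : \rsum_(j <- iota 0 n) t ^ (2 + j) = t ^ 2 * \rsum_(j <- iota 0 n) t ^ j.
  by rewrite big_distrr; apply: eq_bigr => k _; rewrite -[(2 + k)%N]/k.+2 /=; ring.
rewrite Rmult_comm; apply: Rmult_le_compat_r; first exact: pow2_ge_0.
have h1 := h n; have h2 := pow_le t n (proj1 ht).
have h3 : 0 <= \rsum_(k <- iota 0 n) t ^ k by apply: rsum_ge0 => k _; apply: pow_le; lra.
nra.
Qed.

(** The value [b] at first powers is the order of the singularity at 1. The growth rate [3 / 2] is
    below the smallest prime: even at [p = 2] the terms decay with ratio at most [3 / 4]. *)
Definition euler_weights (b B : R) (v : nat -> R) : Prop :=
  [/\ v 0%N = 1, v 1%N = b, forall k, 0 <= v k & forall k, (2 <= k)%N -> v k <= B * (3 / 2) ^ k].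

Lemma euler_factor b B v x p N : euler_weights b B v -> 0 <= B -> 0 < x -> prime p ->
  \rsum_(k <- iota 0 N.+1) v k * nps (1 + x) (p ^ k) <= exp (b * nps (1 + x) p + 9 * B * / INR p ^ 2).
Proof.
move=> [v0 v1 hv hB] hB0 hx pp; have p0 := prime_gt0 pp.
set u := nps (1 + x) p; have u0 : 0 < u by apply: nps_gt0.
have hp2 : 2 <= INR p by apply: (le_INR 2); apply/leP; apply: prime_gt1.
have hu : u <= / INR p by apply: nps_le_inv => //; lra.
have hu2 : u <= 1 / 2 by apply: Rle_trans hu _; rewrite /Rdiv Rmult_1_l; apply: Rinv_le_contravar; lra.
apply: Rle_trans (_ : 1 + (b * u + 9 * B * / INR p ^ 2) <= _); last exact: exp_ineq1_le.
apply: Rle_trans (_ : \rsum_(k <- iota 0 N.+2) v k * nps (1 + x) (p ^ k) <= _).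
  rewrite -(addn1 N.+1) iotaD big_cat big_seq1.
  have : 0 <= v (0 + N.+1)%N * nps (1 + x) (p ^ (0 + N.+1)).
    by apply: Rmult_le_pos => //; apply/Rlt_le/nps_gt0.
  rewrite /=; lra.
rewrite -[iota 0 N.+2]/(0%N :: 1%N :: iota 2 N) 2!big_cons expn0 nps1 expn1 v0 v1.
suff : \rsum_(k <- iota 2 N) v k * nps (1 + x) (p ^ k) <= 9 * B * / INR p ^ 2 by rewrite -/u; lra.
apply: Rle_trans (_ : \rsum_(k <- iota 2 N) B * (3 / 2 * u) ^ k <= _).
  apply: rsum_le_seq => k; rewrite mem_iota => /andP[hk _]; rewrite npsX // Rpow_mult_distr.
  rewrite -Rmult_assoc; apply: Rmult_le_compat_r; first by apply: pow_le; exact/Rlt_le/nps_gt0.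
  exact: hB.
rewrite -big_distrr /=.
(* The tail is at most [4 (3u/2)^2 = 9 u^2], which is the origin of the constant 9. *)
have h1 := rsum_geom_tail (3 / 2 * u) N ltac:(lra).
have h2 : u ^ 2 <= / INR p ^ 2 by rewrite -pow_inv; apply: pow_incr; lra.
have : B * \rsum_(k <- iota 2 N) (3 / 2 * u) ^ k <= B * (4 * (3 / 2 * u) ^ 2) by apply: Rmult_le_compat_l.
rewrite /= in h2 *; nra.
Qed.

Lemma big_smooth_nil (V : Type) (idx : V) (op : Monoid.com_law idx) N (F : nat -> V) : (0 < N)%N ->
  \big[op/idx]_(n <- iota 1 N | smooth [::] n) F n = F 1%N.
Proof.
move=> hN; rewrite -(prednK hN) -[iota 1 _]/(1%N :: iota 2 _) big_cons /= big1_seq ?Monoid.mulm1 //.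
move=> n /andP[hs]; rewrite mem_iota => /andP[h2 _].
by rewrite smooth_nil in hs; [rewrite (eqP hs) in h2|apply: leq_trans h2].
Qed.

(** An inequality, since the product also contains integers beyond [N]. *)
Lemma euler_product v l sg N : (forall k, 0 <= v k) -> v 0%N = 1 -> uniq l -> all prime l ->
  \rsum_(d <- iota 1 N | smooth l d) wprod v l d * nps sg d <=
  \big[Rmult/1]_(p <- l) \rsum_(k <- iota 0 N.+1) v k * nps sg (p ^ k).
Proof.
move=> hv v0; case: N => [|N]; first move=> *; first rewrite big_nil.
  apply: big_ind; [lra|exact: Rmult_le_pos|move=> p _].
  by apply: rsum_ge0 => k _; apply: Rmult_le_pos => //; apply/Rlt_le/nps_gt0.
have hI m : m \in iota 1 N.+1 -> (0 < m)%N by rewrite mem_iota => /andP[].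
elim: l => [|p l IH].
  by move=> _ _; rewrite big_smooth_nil // big_nil /wprod big_nil nps1 Rmult_1_r; right.
rewrite cons_uniq => /andP[hp ul]; rewrite [all _ _]/= => /andP[pp pl].
pose F d := if (d <= N.+1)%N then wprod v (p :: l) d * nps sg d else 0.
have -> : \rsum_(d <- iota 1 N.+1 | smooth (p :: l) d) wprod v (p :: l) d * nps sg d =
          \rsum_(d <- iota 1 N.+1 | smooth (p :: l) d) F d.
  rewrite big_seq_cond [RHS]big_seq_cond; apply: eq_bigr => d /andP[].
  by rewrite mem_iota add1n ltnS /F => /andP[_ ->].
rewrite big_smooth_split //; last by move=> n; rewrite /F ltnNge; case: ifP.
rewrite big_cons big_distrl; apply: rsum_le => k _ /=.
apply: Rle_trans (_ : v k * nps sg (p ^ k) * (\rsum_(m <- iota 1 N.+1 | smooth l m) wprod v l m * nps sg m) <= _).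
  rewrite big_distrr big_seq_cond [X in _ <= X]big_seq_cond; apply: rsum_le => m /andP[/hI hm hs] /=.
  have hpk : (0 < p ^ k)%N by rewrite expn_gt0 prime_gt0.
  have h0 := wprod_ge0 v l m hv; have h1 := nps_gt0 sg m; have h2 := nps_gt0 sg (p ^ k); have h3 := hv k.
  have h4 : 0 <= v k * nps sg (p ^ k) * (wprod v l m * nps sg m) by repeat apply: Rmult_le_pos; lra.
  rewrite /F; case: ifP => // _; rewrite wprod_expM // npsM //.
  by apply: Req_le; ring.
apply: Rmult_le_compat_l; last exact: IH.
by apply: Rmult_le_pos => //; apply/Rlt_le/nps_gt0.
Qed.

(** The first powers of the primes contribute [x^(-b)] by [exp_sum_primes]; the higher powers cost
    the bounded factor [exp (18 * B)]. *)
Lemma euler_bound b B X : 0 <= b -> 0 <= B -> 0 < X -> exists2 M, 0 < M &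
  forall v x l N, euler_weights b B v -> 0 < x <= X -> uniq l -> all prime l ->
  \rsum_(d <- iota 1 N | smooth l d) wprod v l d * nps (1 + x) d <= M * rpow (/ x) b.
Proof.
move=> hb hB hX; pose Q := exp 2 * (2 + 2 * X + 12 * X ^ 2).
have hQ : 0 < Q by apply: Rmult_lt_0_compat; [exact: exp_pos|have := pow2_ge_0 X; lra].
exists (exp (18 * B) * rpow Q b).
  by apply: Rmult_lt_0_compat; [exact: exp_pos|exact: rpow_gt0].
move=> v x l N hv hx ul pl; have [v0 v1 hv0 _] := hv.
have x0 : 0 < x by lra.
have xi := Rinv_0_lt_compat _ x0.
apply: Rle_trans (euler_product v l (1 + x) N hv0 v0 ul pl) _.
apply: Rle_trans (proj2 (rprod_le _ l _ (fun p => exp (b * nps (1 + x) p + 9 * B * / INR p ^ 2)) _)) _.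
  move=> p hp; split; last by apply: euler_factor => //; apply: (allP pl).
  by apply: rsum_ge0 => k _; apply: Rmult_le_pos => //; apply/Rlt_le/nps_gt0.
rewrite -exp_rsum big_split /= -!big_distrr /= exp_plus [X in X <= _]Rmult_comm [X in _ <= X]Rmult_assoc.
apply: Rmult_le_compat; [exact/Rlt_le/exp_pos|exact/Rlt_le/exp_pos|..].
  apply: exp_le_mono.
  have pos : all (leq 1) l by apply: sub_all pl => p; apply: prime_gt0.
  have := Rmult_le_compat_l (9 * B) _ _ ltac:(lra) (sum_inv_sqr_uniq l ul pos).
  by rewrite /=; lra.
have h := exp_sum_primes x l x0 ul pl.
set S := \rsum_(p <- l) _ in h *.
have -> : exp (b * S) = rpow (exp S) b.
  by rewrite rpow_gt0E; [rewrite /Rpower ln_exp|exact: exp_pos].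
rewrite -rpowM; [|lra|lra].
apply: rpow_le => //; first exact/Rlt_le/exp_pos.
apply: Rle_trans h _; rewrite /Q /Rdiv -Rmult_assoc; apply: Rmult_le_compat_r; first lra.
apply: Rmult_le_compat_l; first exact/Rlt_le/exp_pos.
have : x ^ 2 <= X ^ 2 by apply: pow_incr; lra.
lra.
Qed.

(** Multiplied over the primes, the local hypothesis says that the weight at [n] is at most the sum
    of [v(d)] over the divisors [d] of [n]. Stated after summation against [X], it can be proved one
    prime at a time without divisor sums. *)
Lemma smooth_convolution_le winv v l N : (forall k, 0 <= v k) ->
  (forall k, 0 <= winv k <= \rsum_(i <- iota 0 k.+1) v i) -> uniq l -> all prime l ->
  forall X, (forall n, 0 <= X n) -> (forall n, (N < n)%N -> X n = 0) ->
  \rsum_(n <- iota 1 N | smooth l n) wprod winv l n * X n <=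
  \rsum_(d <- iota 1 N | smooth l d) wprod v l d * \rsum_(m <- iota 1 N | smooth l m) X (d * m)%N.
Proof.
move=> hv hw; case: N => [|N]; first by move=> *; rewrite !big_nil; lra.
have hI m : m \in iota 1 N.+1 -> (0 < m)%N by rewrite mem_iota => /andP[].
elim: l => [|p l IH].
  by move=> _ _ X hX _; rewrite !big_smooth_nil // /wprod !big_nil muln1; lra.
rewrite cons_uniq => /andP[hp ul]; rewrite [all _ _]/= => /andP[pp pl] X hX hXN.
have hpk k : (0 < p ^ k)%N by rewrite expn_gt0 prime_gt0.
pose U k := \rsum_(d <- iota 1 N.+1 | smooth l d) wprod v l d * \rsum_(m <- iota 1 N.+1 | smooth l m) X (p ^ k * (d * m))%N.
have hU k : 0 <= U k.
  apply: rsum_ge0 => d _; apply: Rmult_le_pos; first exact: wprod_ge0.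
  exact: rsum_ge0.
have hXk k n : (N.+1 < n)%N -> X (p ^ k * n)%N = 0.
  by move=> hn; apply: hXN; apply: leq_trans hn (leq_pmull _ _).
rewrite big_smooth_split //; last by move=> n /hXN ->; rewrite Rmult_0_r.
apply: Rle_trans (_ : \rsum_(k <- iota 0 N.+2) (\rsum_(i <- iota 0 k.+1) v i) * U k <= _).
  apply: rsum_le => k _.
  apply: Rle_trans (_ : winv k * \rsum_(m <- iota 1 N.+1 | smooth l m) wprod winv l m * X (p ^ k * m)%N <= _).
    rewrite big_distrr big_seq_cond [X in _ <= X]big_seq_cond; apply: Req_le; apply: eq_bigr => m /andP[/hI hm hs].
    by rewrite /= wprod_expM // Rmult_assoc.
  have [w0 w1] := hw k.
  apply: Rmult_le_compat => //; last by apply: (IH ul pl (fun m => X (p ^ k * m)%N)) => //; exact: hXk.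
  apply: rsum_ge0 => m _; apply: Rmult_le_pos => //; apply: wprod_ge0 => i; apply: (proj1 (hw i)).
rewrite [X in _ <= X]big_smooth_split //; last first.
  move=> d hd; rewrite big_seq_cond big1 ?Rmult_0_r // => m /andP[/hI hm _].
  by apply: hXN; apply: leq_trans hd (leq_pmulr _ hm).
have e i : \rsum_(d <- iota 1 N.+1 | smooth l d) wprod v (p :: l) (p ^ i * d) *
      (\rsum_(m <- iota 1 N.+1 | smooth (p :: l) m) X (p ^ i * d * m)%N) =
    v i * \rsum_(j <- iota 0 N.+2) U (i + j)%N.
  rewrite /U exchange_big big_distrr big_seq_cond [RHS]big_seq_cond; apply: eq_bigr => d /andP[/hI hd hs]; rewrite wprod_expM // Rmult_assoc; congr Rmult.
  rewrite -big_distrr; congr Rmult; rewrite big_smooth_split //; last first.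
    by move=> n hn; apply: hXN; apply: leq_trans hn (leq_pmull _ _); rewrite muln_gt0 hpk hd.
  apply: eq_bigr => j _; apply: eq_bigr => m _; congr X.
  by rewrite expnD -!mulnA; congr muln; rewrite mulnCA.
rewrite (eq_bigr _ (fun i _ => e i)).
have -> : \rsum_(k <- iota 0 N.+2) (\rsum_(i <- iota 0 k.+1) v i) * U k =
   \rsum_(i <- iota 0 N.+2) v i * \rsum_(k <- iota 0 N.+2 | (i <= k)%N) U k.
  rewrite [RHS](eq_bigr (fun i => \rsum_(k <- iota 0 N.+2 | (i <= k)%N) v i * U k)); last first.
    by move=> i _; rewrite big_distrr.
  rewrite [RHS](exchange_big_dep xpredT) //=; apply: eq_big_seq => k hk; rewrite big_distrl /=.
  rewrite -[RHS]big_filter; apply: perm_big; apply: uniq_perm.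
  - exact: (iota_uniq 0 k.+1).
  - exact/filter_uniq/(iota_uniq 0 N.+2).
  have {}hk : (k < N.+2)%N by have : k \in iota 0 N.+2 by []; rewrite mem_iota.
  move=> i; change ((i \in iota 0 k.+1) = (i \in filter (fun i => i <= k)%N (iota 0 N.+2))).
  rewrite mem_filter !mem_iota !add0n /= ltnS.
  case: (leqP i k) => //= hik; apply/esym; exact: leq_ltn_trans hik hk.
apply: rsum_le => i _; apply: Rmult_le_compat_l => //.
rewrite -big_filter -(big_map (addn i) xpredT U); apply: rsum_subset => //.
- by rewrite filter_uniq ?iota_uniq.
- by rewrite map_inj_uniq ?iota_uniq //; apply: addnI.
- move=> k; rewrite mem_filter mem_iota add0n => /andP[hik /andP[_ hk]].
  apply/mapP; exists (k - i)%N; last by rewrite subnKC.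
  by rewrite mem_iota add0n /=; apply: leq_ltn_trans (leq_subr _ _) hk.
Qed.

(** * Large sieve on the range of the symbol *)

Definition zsum (L : nat) (s : C) : C := \csum_(m <- iota 1 L) cpow_neg m s.

Lemma cpow_neg_conj n s : Cconj (cpow_neg n s) = cpow_neg n (Cconj s).
Proof.
rewrite !cpow_neg_cexp /cexp Cmult_conj -cisN; set z := RtoC (- _).
have -> : Re (Cmult z (Cconj s)) = Re (Cmult z s) by rewrite /z /Re /=; ring.
have -> : Im (Cmult z (Cconj s)) = - Im (Cmult z s) by rewrite /z /Re /Im /=; ring.
by congr Cmult; apply: C_ext => //=; rewrite Ropp_0.
Qed.

Lemma cpow_negD n s t : cpow_neg n (Cplus s t) = Cmult (cpow_neg n s) (cpow_neg n t).
Proof. by rewrite !cpow_neg_cexp -cexpD; congr cexp; ring. Qed.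

(** Schur's test for the Gram matrix of the vectors [m^(-s_k)]: its entries are zeta sums, and it is
    Hermitian, so a bound on its rows is enough. *)
Lemma zsum_sieve (E : seq nat) (s e : nat -> C) L Rb :
  (forall k, k \in E -> \rsum_(j <- E) Cmod (zsum L (Cplus (s k) (Cconj (s j)))) <= Rb) ->
  \rsum_(m <- iota 1 L) Cmod (\csum_(k <- E) Cmult (e k) (cpow_neg m (s k))) ^ 2
    <= Rb * \rsum_(k <- E) Cmod (e k) ^ 2.
Proof.
move=> hR; pose Z k j := zsum L (Cplus (s k) (Cconj (s j))).
have hsym k j : Cmod (Z j k) = Cmod (Z k j).
  rewrite -(Cmod_conj (Z j k)) /Z /zsum csum_conj; congr Cmod; apply: eq_bigr => m _.
  by rewrite cpow_neg_conj Cplus_conj Cconj_conj Cplus_comm.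
have e1 : RtoC (\rsum_(m <- iota 1 L) Cmod (\csum_(k <- E) Cmult (e k) (cpow_neg m (s k))) ^ 2) =
    \csum_(k <- E) \csum_(j <- E) Cmult (Cmult (e k) (Cconj (e j))) (Z k j).
  rewrite csum_RtoC (eq_bigr (fun m => \csum_(k <- E) \csum_(j <- E)
     Cmult (Cmult (e k) (Cconj (e j))) (cpow_neg m (Cplus (s k) (Cconj (s j)))))); last first.
    move=> m _; rewrite Cmod2_conj csum_conj big_distrl /=; apply: eq_bigr => k _.
    rewrite big_distrr /=; apply: eq_bigr => j _.
    rewrite Cmult_conj cpow_neg_conj cpow_negD; ring.
  rewrite exchange_big /=; apply: eq_bigr => k _; rewrite exchange_big /=; apply: eq_bigr => j _.
  by rewrite -big_distrr.
apply: Rle_trans (Rle_abs _) _; rewrite -Cmod_R e1.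
apply: Rle_trans (Cmod_csum _ _ _) _.
apply: Rle_trans (_ : \rsum_(k <- E) \rsum_(j <- E) (Cmod (e k) ^ 2 / 2 * Cmod (Z k j) + Cmod (e j) ^ 2 / 2 * Cmod (Z j k)) <= _).
  apply: rsum_le => k _; apply: Rle_trans (Cmod_csum _ _ _) _; apply: rsum_le => j _.
  rewrite !Cmod_mult Cmod_conj hsym -Rmult_plus_distr_r; apply: Rmult_le_compat_r; first exact: Cmod_ge_0.
  have := pow2_ge_0 (Cmod (e k) - Cmod (e j)); lra.
rewrite (eq_bigr (fun k => \rsum_(j <- E) Cmod (e k) ^ 2 / 2 * Cmod (Z k j) +
    \rsum_(j <- E) Cmod (e j) ^ 2 / 2 * Cmod (Z j k))); last by move=> k _; rewrite big_split.
rewrite big_split /= [X in _ + X]exchange_big /=.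
rewrite Rplus_diag !big_distrr /=; apply: rsum_le_seq => k hk.
rewrite -big_distrr /=; have hS := hR k hk.
have := Rmult_le_compat_l _ _ _ (pow2_ge_0 (Cmod (e k))) hS.
rewrite /Z; move: (\big[_/_]_(_ <- _) _) => S; lra.
Qed.

Definition wnorm (w : nat -> R) (l : seq nat) (A : nat -> C) (N : nat) : R :=
  \rsum_(n <- iota 1 N | smooth l n) wprod w l n * Cmod (A n) ^ 2.

Lemma wprod_inv w l n : (forall k, 0 < w k) -> wprod (fun k => / w k) l n = / wprod w l n /\ 0 < wprod w l n.
Proof.
move=> hw; rewrite /wprod; elim: l => [|p l [IH1 IH2]]; first by rewrite !big_nil Rinv_1; split; lra.
rewrite !big_cons IH1; split; last exact: Rmult_lt_0_compat.
by rewrite Rinv_mult.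
Qed.

(** Duality turns the sum of squared values into a pairing of [A] with [T n], the sum of
    [c_k n^(-s_k)] with [c_k] the conjugate values. The convolution bound for the inverse weight
    reduces [|T n|^2 / W(n)] to sums over the multiples of each [d]. There [zsum_sieve] applies with
    coefficients [c_k d^(-s_k)] and gains [d^(-1-x)]. *)
Lemma large_sieve (E : seq nat) (s : nat -> C) (A : nat -> C) N l (w v : nat -> R) x Rb Zv :
  prime_base l N -> (forall k, 0 < w k) -> (forall k, 0 <= v k) ->
  (forall k, / w k <= \rsum_(i <- iota 0 k.+1) v i) ->
  (forall k, k \in E -> 1 + x <= 2 * Re (s k)) -> 0 < Rb -> 0 < Zv ->
  (forall L k, k \in E -> \rsum_(j <- E) Cmod (zsum L (Cplus (s k) (Cconj (s j)))) <= Rb) ->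
  \rsum_(d <- iota 1 N | smooth l d) wprod v l d * nps (1 + x) d <= Zv ->
  \rsum_(k <- E) Cmod (dir_sum A N (s k)) ^ 2 <= Rb * Zv * wnorm w l A N.
Proof.
move=> hb hw hv hwv hs hRb hZv hrow hZ; have [ul pl hsm] := hb.
have sm (V : Type) (idx : V) (op : Monoid.law idx) (F : nat -> V) :
    \big[op/idx]_(n <- iota 1 N | smooth l n) F n = \big[op/idx]_(n <- iota 1 N) F n.
  rewrite -big_filter; congr bigop.
  by apply/all_filterP/allP => n; rewrite mem_iota add1n ltnS => /hsm.
pose c k := Cconj (dir_sum A N (s k)).
pose T n := \csum_(k <- E) Cmult (c k) (cpow_neg n (s k)).
set S := \rsum_(k <- E) _.
have hc k : Cmod (c k) ^ 2 = Cmod (dir_sum A N (s k)) ^ 2 by rewrite /c Cmod_conj.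
have S0 : 0 <= S by apply: rsum_ge0 => k _; apply: pow2_ge_0.
have eS : RtoC S = \csum_(n <- iota 1 N) Cmult (A n) (T n).
  rewrite /S csum_RtoC (eq_bigr (fun k => \csum_(n <- iota 1 N) Cmult (A n) (Cmult (c k) (cpow_neg n (s k))))).
    by rewrite exchange_big /=; apply: eq_bigr => n _; rewrite -big_distrr.
  move=> k _; rewrite Cmod2_conj -/(c k) dir_sumE big_distrl /=.
  by apply: eq_bigr => n _; ring.
pose X n := if (n <= N)%N then Cmod (T n) ^ 2 else 0.
have hX n : 0 <= X n by rewrite /X; case: ifP => _; [apply: pow2_ge_0|lra].
have hXN n : (N < n)%N -> X n = 0 by rewrite /X ltnNge; case: ifP.
have hQ : \rsum_(n <- iota 1 N | smooth l n) wprod (fun k => / w k) l n * X n <= Rb * Zv * S.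
  apply: Rle_trans (smooth_convolution_le _ v l N hv _ ul pl X hX hXN) _.
    by move=> k; split => //; apply/Rlt_le/Rinv_0_lt_compat.
  apply: Rle_trans (_ : \rsum_(d <- iota 1 N | smooth l d) wprod v l d * (nps (1 + x) d * (Rb * S)) <= _); last first.
    have -> : \rsum_(d <- iota 1 N | smooth l d) wprod v l d * (nps (1 + x) d * (Rb * S)) =
       (\rsum_(d <- iota 1 N | smooth l d) wprod v l d * nps (1 + x) d) * (Rb * S).
      by rewrite big_distrl /=; apply: eq_bigr => d _; rewrite Rmult_assoc.
    have -> : Rb * Zv * S = Zv * (Rb * S) by ring.
    apply: Rmult_le_compat_r => //; apply: Rmult_le_pos => //; lra.
  rewrite big_seq_cond [X in _ <= X]big_seq_cond; apply: rsum_le => d /andP[]; rewrite mem_iota => /andP[hd _] _.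
  apply: Rmult_le_compat_l; first exact: wprod_ge0.
  rewrite sm.
  pose e k := Cmult (c k) (cpow_neg d (s k)).
  (* Multiples [d * m] beyond [N] contribute nothing, since [X] vanishes there. *)
  apply: Rle_trans (_ : \rsum_(m <- iota 1 (N %/ d)) Cmod (\csum_(k <- E) Cmult (e k) (cpow_neg m (s k))) ^ 2 <= _).
    have hle : (N %/ d <= N)%N by apply: leq_div.
    rewrite -(subnKC hle) iotaD big_cat /= subnKC //.
    rewrite [X in _ + X]big1_seq ?Rplus_0_r; last first.
      move=> m /andP[_]; rewrite mem_iota => /andP[hm _]; apply: hXN.
      by rewrite mulnC -ltn_divLR //; rewrite add1n in hm.
    apply: Req_le; apply: eq_big_seq => m; rewrite mem_iota add1n ltnS => /andP[hm hmd].
    rewrite /X mulnC -leq_divRL // hmd; congr (Cmod _ ^ 2); apply: eq_bigr => k _.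
    have [_ hM] := character_cpow (s k); rewrite hM // /e; ring.
  apply: Rle_trans (zsum_sieve E s e _ Rb (hrow _)) _.
  have -> : nps (1 + x) d * (Rb * S) = Rb * (nps (1 + x) d * S) by ring.
  apply: Rmult_le_compat_l; first lra.
  rewrite /S big_distrr; apply: rsum_le_seq => k hk.
  change (Cmod (e k) ^ 2 <= nps (1 + x) d * Cmod (dir_sum A N (s k)) ^ 2).
  rewrite /e Cmod_mult Rpow_mult_distr hc Rmult_comm; apply: Rmult_le_compat_r; first exact: pow2_ge_0.
  have e2 y : exp y ^ 2 = exp (2 * y) by rewrite (_ : 2 * y = y + y) ?exp_plus /=; ring.
  rewrite Cmod_cpow /nps e2; apply: exp_le_mono.
  have := hs k hk; have := ln_INR_ge0 d hd; rewrite /=; nra.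
have h1 : S <= \rsum_(n <- iota 1 N) Cmod (A n) * Cmod (T n).
  apply: Rle_trans (Rle_abs _) _; rewrite -Cmod_R eS.
  apply: Rle_trans (Cmod_csum _ _ _) _; apply: Req_le; apply: eq_bigr => n _; exact: Cmod_mult.
(* Cauchy-Schwarz as an arithmetic-geometric mean inequality, with a parameter chosen so that the
   second term is at most [S / 2] and can be absorbed. *)
have h2 : \rsum_(n <- iota 1 N) Cmod (A n) * Cmod (T n) <=
   Rb * Zv / 2 * wnorm w l A N + / (2 * (Rb * Zv)) * \rsum_(n <- iota 1 N | smooth l n) wprod (fun k => / w k) l n * X n.
  rewrite /wnorm !sm !big_distrr -big_split /=; apply: rsum_le_seq => n; rewrite mem_iota add1n ltnS => /andP[_ hn].
  have [-> hW] := wprod_inv w l n hw; rewrite /X hn.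
  have hRZ : 0 < Rb * Zv by apply: Rmult_lt_0_compat.
  move: (Rb * Zv) (wprod w l n) (Cmod (A n)) (Cmod (T n)) hRZ hW => g W a t hg hW.
  have := pow2_ge_0 (g * W * a - t) => h.
  have hgW : 0 < / (2 * g * W) by apply: Rinv_0_lt_compat; nra.
  have := Rmult_le_pos _ _ (Rlt_le _ _ hgW) h.
  have -> : / (2 * g * W) * (g * W * a - t) ^ 2 = g / 2 * (W * a ^ 2) + / (2 * g) * (/ W * t ^ 2) - a * t by field; lra.
  lra.
have hRZ : 0 < Rb * Zv by apply: Rmult_lt_0_compat.
have h3 : / (2 * (Rb * Zv)) * (\rsum_(n <- iota 1 N | smooth l n) wprod (fun k => / w k) l n * X n) <= S / 2.
  have := Rmult_le_compat_l (/ (2 * (Rb * Zv))) _ _ ltac:(apply/Rlt_le/Rinv_0_lt_compat; lra) hQ.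
  by have -> : / (2 * (Rb * Zv)) * (Rb * Zv * S) = S / 2 by field; lra.
lra.
Qed.

(** * Power sums and trigonometric estimates *)

Lemma bernoulli_concave v t : 0 <= v -> 0 < t <= 1 -> rpow v t <= 1 + t * (v - 1).
Proof.
move=> hv ht; have hi : 1 <= / t by rewrite -Rinv_1; apply: Rinv_le_contravar; lra.
have h := bernoulli (rpow v t) (/ t) (rpow_ge0 _ _) hi.
rewrite rpow_root // in h; last lra.
have := Rmult_le_compat_l t _ _ ltac:(lra) h.
have -> : t * (1 + / t * (rpow v t - 1)) = t + (rpow v t - 1) by field; lra.
lra.
Qed.

(** Concavity of [t^(g+1)] makes each term of the sum at most the corresponding increment of the
    right side. *)
Lemma power_sum g m : -1 < g <= 0 ->
  (g + 1) * \rsum_(i <- iota 1 m) rpow (INR i) g <= rpow (INR m) (g + 1).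
Proof.
move=> hg; elim: m => [|m IH]; first by rewrite big_nil Rmult_0_r rpow0; lra.
rewrite -(addn1 m) iotaD big_cat big_seq1 add1n addn1 Rmult_plus_distr_l.
have hm := INR_gt0 m.+1 isT; have hm0 := pos_INR m.
set i := INR m.+1 in hm *.
have hv : 0 <= INR m / i by apply: Rdiv_le_0_compat.
have h := bernoulli_concave (INR m / i) (g + 1) hv ltac:(lra).
have e : rpow (INR m) (g + 1) = rpow i (g + 1) * rpow (INR m / i) (g + 1).
  by rewrite -rpowM //; [congr rpow; field; lra|lra].
have hd : INR m / i - 1 = - / i by rewrite /i S_INR; field; rewrite /i S_INR in hm; lra.
have h1 : rpow i (g + 1) * rpow (INR m / i) (g + 1) <= rpow i (g + 1) * (1 + (g + 1) * (INR m / i - 1)).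
  by apply: Rmult_le_compat_l => //; apply: rpow_ge0.
have e2 : rpow i (g + 1) * / i = rpow i g.
  by rewrite rpowD ?rpow1r; [field; lra|lra|lra].
rewrite hd in h1.
have e3 : rpow i (g + 1) * (1 + (g + 1) * - / i) = rpow i (g + 1) - (g + 1) * rpow i g by rewrite -e2; ring.
rewrite e3 in h1; rewrite e in IH.
have {}IH := Rle_trans _ _ _ IH h1.
by rewrite /= in IH *; lra.
Qed.

Lemma power_mean_sum g m M : -1 < g <= 0 -> 0 < M -> INR m <= 2 * M ->
  / M * \rsum_(i <- iota 1 m) rpow (INR i / M) g <= 2 / (g + 1).
Proof.
move=> hg hM hm; have hMi := Rinv_0_lt_compat _ hM.
have -> : \rsum_(i <- iota 1 m) rpow (INR i / M) g = rpow (/ M) g * \rsum_(i <- iota 1 m) rpow (INR i) g.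
  rewrite big_distrr /=; apply: eq_bigr => i _; rewrite rpowM; [|exact: pos_INR|lra].
  exact: Rmult_comm.
have h := power_sum g m hg.
have h1 : rpow (INR m) (g + 1) <= 2 * rpow M (g + 1).
  apply: Rle_trans (rpow_le _ _ _ _ (pos_INR m) hm) _; first lra.
  rewrite rpowM; [|lra|lra]; apply: Rmult_le_compat_r; first exact: rpow_ge0.
  rewrite -[X in _ <= X](rpow1r 2); last lra.
  rewrite !rpow_gt0E; [|lra|lra]; apply: Rle_Rpower; lra.
apply: (Rmult_le_reg_l (g + 1)); first lra.
have -> : (g + 1) * (2 / (g + 1)) = 2 by field; lra.
have e : rpow (/ M) (g + 1) * rpow M (g + 1) = 1.
  by rewrite -rpowM ?Rinv_l ?rpow1l //; lra.
have e1 : rpow (/ M) (g + 1) = rpow (/ M) g * / M by rewrite rpowD ?(rpow1r (/ M)); lra.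
set S := \rsum_(i <- _) _ in h *.
have -> : (g + 1) * (/ M * (rpow (/ M) g * S)) = rpow (/ M) (g + 1) * ((g + 1) * S) by rewrite e1; ring.
apply: Rle_trans (_ : rpow (/ M) (g + 1) * (2 * rpow M (g + 1)) <= _); last lra.
by apply: Rmult_le_compat_l; [apply: rpow_ge0|lra].
Qed.

(** Each distance from [k] is attained at most twice, once on each side. *)
Lemma sum_dist (g : nat -> R) n k : (forall i, 0 <= g i) -> (k < n)%N ->
  \rsum_(j <- iota 0 n | j != k) g (k - j + (j - k))%N <= 2 * \rsum_(i <- iota 1 n) g i.
Proof.
move=> hg hk; rewrite (bigID (fun j => (j < k)%N)) /=.
have aux (P : pred nat) (f : nat -> nat) :
    {in [seq j <- iota 0 n | P j], forall j, (0 < f j <= n)%N /\ (k - j + (j - k))%N = f j} ->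
    {in [seq j <- iota 0 n | P j] &, injective f} ->
    \rsum_(j <- iota 0 n | P j) g (k - j + (j - k))%N <= \rsum_(i <- iota 1 n) g i.
  move=> hf hinj; rewrite -big_filter.
  rewrite (eq_big_seq (fun j => g (f j))); last by move=> j /hf [_ ->].
  rewrite -(big_map f xpredT g); apply: rsum_subset => //.
  - by rewrite map_inj_in_uniq // filter_uniq // iota_uniq.
  - exact: iota_uniq.
  - by move=> i /mapP[j /hf [h _] ->]; rewrite mem_iota add1n ltnS.
have hl : \rsum_(j <- iota 0 n | (j != k) && (j < k)%N) g (k - j + (j - k))%N <= \rsum_(i <- iota 1 n) g i.
  apply: (aux _ (fun j => k - j)%N) => [j|i j].
    rewrite mem_filter => /andP[/andP[_ h] _]; rewrite subn_gt0 h.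
    split; first by apply: leq_trans (leq_subr _ _) (ltnW hk).
    by have /eqP -> : (j - k == 0)%N; [rewrite subn_eq0 ltnW|rewrite addn0].
  rewrite !mem_filter => /andP[/andP[_ hi] _] /andP[/andP[_ hj] _] /= e.
  by rewrite -(subKn (ltnW hi)) e subKn // ltnW.
have hr : \rsum_(j <- iota 0 n | (j != k) && ~~ (j < k)%N) g (k - j + (j - k))%N <= \rsum_(i <- iota 1 n) g i.
  apply: (aux _ (fun j => j - k)%N) => [j|i j].
    rewrite mem_filter mem_iota add0n -leqNgt => /andP[/andP[h1 h2] /andP[_ h3]].
    rewrite subn_gt0 ltn_neqAle eq_sym h1 h2; split.
      by apply: leq_trans (leq_subr _ _) (ltnW h3).
    by have /eqP -> : (k - j == 0)%N; [rewrite subn_eq0|rewrite add0n].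
  rewrite !mem_filter -!leqNgt => /andP[/andP[_ hi] _] /andP[/andP[_ hj] _] /= e.
  by rewrite -(subnK hi) e subnK.
lra.
Qed.

Lemma sin_diff_ge u v : Rabs u <= 1 -> Rabs v <= 1 -> Rabs (u - v) / 2 <= Rabs (sin u - sin v).
Proof.
move=> hu hv.
have [c [hc1 hc]] := MVT_gen sin v u cos (fun t _ => is_derive_sin t) (fun t _ => continuity_sin t).
rewrite hc Rabs_mult.
have hc2 : c ^ 2 <= 1.
  have : Rabs c <= 1.
    apply: Rabs_le; case/Rabs_le_between: hu => u1 u2; case/Rabs_le_between: hv => v1 v2.
    by move: hc1; rewrite /Rmin /Rmax; case: Rle_dec => h [h1 h2]; lra.
  by move=> h; rewrite -pow2_abs; have := pow_incr (Rabs c) 1 2 (conj (Rabs_pos _) h); lra.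
have h3 := one_minus_cos c.
have h4 : 1 / 2 <= Rabs (cos c) by rewrite Rabs_pos_eq; lra.
have := Rabs_pos (u - v); nra.
Qed.

Lemma one_minus_cos_ge u : Rabs u <= 1 -> u ^ 2 / 4 <= 1 - cos u.
Proof.
move=> hu.
have e : cos u = 1 - 2 * sin (u / 2) ^ 2 by rewrite {1}(_ : u = 2 * (u / 2)); [rewrite cos_2a_sin; ring|field].
have hu2 : Rabs (u / 2) <= 1 / 2 by rewrite Rabs_div ?(Rabs_pos_eq 2); lra.
have [c [hc1 hc]] := MVT_gen sin 0 (u / 2) cos (fun t _ => is_derive_sin t) (fun t _ => continuity_sin t).
rewrite sin_0 !Rminus_0_r in hc.
have hc2 : c ^ 2 <= 1 / 4.
  have : Rabs c <= 1 / 2.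
    apply: Rabs_le; case/Rabs_le_between: hu2 => u1 u2.
    by move: hc1; rewrite /Rmin /Rmax; case: Rle_dec => h [h1 h2]; lra.
  by move=> h; rewrite -pow2_abs; have := pow_incr (Rabs c) (1 / 2) 2 (conj (Rabs_pos _) h); lra.
have h3 := one_minus_cos c.
have h4 : 3 / 4 <= cos c ^ 2 by nra.
rewrite e hc Rpow_mult_distr; have := pow2_ge_0 (u / 2); nra.
Qed.

Lemma one_minus_cos_far u : 1 <= Rabs u <= PI -> 1 / 4 <= 1 - cos u.
Proof.
move=> [h1 h2].
have hc1 : cos 1 <= 3 / 4 by have := one_minus_cos_ge 1; rewrite Rabs_R1 => /(_ (Rle_refl _)); lra.
have hpi := PI_RGT_0.
have -> : cos u = cos (Rabs u) by rewrite /Rabs; case: Rcase_abs => // _; rewrite cos_neg.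
suff : cos (Rabs u) <= cos 1 by lra.
by apply: cos_decr_1; lra.
Qed.

Lemma one_minus_cos_near_far u : Rabs u <= PI -> (Rabs u <= 1 /\ u ^ 2 / 4 <= 1 - cos u) \/ 1 / 4 <= 1 - cos u.
Proof.
move=> h; case: (Rle_dec (Rabs u) 1) => h1; first by left; split => //; apply: one_minus_cos_ge.
by right; apply: one_minus_cos_far; lra.
Qed.

Definition gap (i j : nat) : nat := (i - j + (j - i))%N.

Lemma INR_gap i j : INR (gap i j) = Rabs (INR i - INR j).
Proof.
rewrite /gap; case: (leqP i j) => h.
  have /eqP -> : (i - j == 0)%N by rewrite subn_eq0.
  have hle : INR i <= INR j by apply/le_INR/leP.
  rewrite add0n (minus_INR j i) //; last exact/leP.
  by rewrite Rabs_left1; lra.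
have /eqP -> : (j - i == 0)%N by rewrite subn_eq0 ltnW.
have hle : INR j <= INR i by apply/le_INR/leP; rewrite ltnW.
rewrite addn0 (minus_INR i j); last by apply/leP; rewrite ltnW.
by rewrite Rabs_pos_eq; lra.
Qed.

Definition ug (K k : nat) : R := 2 * PI * (INR k - INR K) / INR (2 * K + 1).

Lemma ug_dist K i j : Rabs (ug K i - ug K j) = 2 * PI * (INR (gap i j) / INR (2 * K + 1)).
Proof.
have hM := grid_size_gt0 K; have hpi := PI_RGT_0.
have -> : ug K i - ug K j = 2 * PI * / INR (2 * K + 1) * (INR i - INR j) by rewrite /ug; field; lra.
rewrite Rabs_mult INR_gap Rabs_pos_eq; first by rewrite /Rdiv; ring.
have := Rinv_0_lt_compat _ hM; nra.
Qed.

Lemma ug_K K : ug K K = 0.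
Proof. by rewrite /ug Rminus_diag Rmult_0_r /Rdiv Rmult_0_l. Qed.

Lemma ug_abs K k : Rabs (ug K k) = 2 * PI * (INR (gap k K) / INR (2 * K + 1)).
Proof. by rewrite -ug_dist ug_K Rminus_0_r. Qed.

(** The symbol in two angles measured from the point where its real part is smallest. The value [sg]
    at [u1 = u2 = 0] collects the constant and all other primes. *)
Definition symbol2 (a b : R) (sg : C) (u1 u2 : R) : C :=
  Cplus sg (Cplus (Cmult (RtoC a) (Cminus 1 (cis u1))) (Cmult (RtoC b) (Cminus 1 (cis u2)))).

Lemma symbol2_Re a b sg u1 u2 : Re (symbol2 a b sg u1 u2) = Re sg + a * (1 - cos u1) + b * (1 - cos u2).
Proof. by rewrite /symbol2 /cis /Re /=; ring. Qed.

Lemma symbol2_Im a b sg u1 u2 : Im (symbol2 a b sg u1 u2) = Im sg - a * sin u1 - b * sin u2.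
Proof. by rewrite /symbol2 /cis /Im /=; ring. Qed.

(** The part [|u1| <= |u2|] of a row. It has few points when [u2] is small, and this count is the
    gain in [near_row_bound]; the part [|u1| >= |u2|] is handled with the two variables
    exchanged. *)
Definition near_set (K k2 : nat) : seq nat := [seq k <- iota 0 (2 * K + 1) | (gap k K <= gap k2 K)%N].

Lemma near_set_uniq K k2 : uniq (near_set K k2).
Proof. exact/filter_uniq/iota_uniq. Qed.

Lemma size_near_set K k2 : (size (near_set K k2) <= 2 * (gap k2 K).+1)%N.
Proof.
apply: leq_trans (_ : size (iota (K - gap k2 K) (2 * (gap k2 K).+1)) <= _)%N; last by rewrite size_iota.
apply: uniq_leq_size; first exact: near_set_uniq.
move=> k; rewrite mem_filter mem_iota => /andP[h _]; rewrite mem_iota.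
by move: h; rewrite /gap; lia.
Qed.

Lemma normalized_mean_pf (E : seq nat) : (0 < size E)%N ->
  let EE := fun f => / INR (size E) * \rsum_(k <- E) f k in
  positive_functional EE /\ EE (fun=> 1) = 1.
Proof.
move=> hs EE; have h := INR_gt0 _ hs; have hi := Rinv_0_lt_compat _ h.
split; last by rewrite /EE rsum_const Rmult_1_r Rinv_l; lra.
split=> [f g|c f|f g hfg]; rewrite /EE.
- by rewrite big_split /=; ring.
- by rewrite -big_distrr /=; ring.
- by apply: Rmult_le_compat_l; [lra|apply: rsum_le].
Qed.

(** Jensen for the normalized sum. As [q < 2], the number of points enters with a positive power. *)
Lemma rsum_holder (E : seq nat) (f : nat -> R) q : 1 <= q < 2 -> (0 < size E)%N -> (forall k, 0 <= f k) ->
  \rsum_(k <- E) rpow (f k) q <= rpow (INR (size E)) (1 - q / 2) * rpow (\rsum_(k <- E) f k ^ 2) (q / 2).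
Proof.
move=> hq hs hf; have h := INR_gt0 _ hs; have hi := Rinv_0_lt_compat _ h.
have [hE h1] := normalized_mean_pf E hs; set EE := fun f => _ in hE h1.
have hr : 1 <= 2 / q by apply: (Rmult_le_reg_r q); [lra|rewrite /Rdiv Rmult_assoc Rinv_l; lra].
have hj := pf_jensen EE hE (fun k => rpow (f k) q) (2 / q) h1 (fun k => rpow_ge0 _ _) hr.
have S0 : 0 <= EE (fun k => rpow (f k) q) by apply: (pf_ge0 _ hE) => k; apply: rpow_ge0.
have e : EE (fun k => rpow (rpow (f k) q) (2 / q)) = / INR (size E) * \rsum_(k <- E) f k ^ 2.
  rewrite /EE; congr Rmult; apply: eq_bigr => k _.
  by rewrite rpow_rpow // (_ : q * (2 / q) = 2) ?rpow_sqr //; field; lra.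
rewrite e in hj.
have Q0 : 0 <= \rsum_(k <- E) f k ^ 2 by apply: rsum_ge0 => k _; apply: pow2_ge_0.
have h2 : EE (fun k => rpow (f k) q) <= rpow (/ INR (size E) * \rsum_(k <- E) f k ^ 2) (q / 2).
  have e2 : q / 2 = / (2 / q) by field; lra.
  rewrite -[X in X <= _](rpow_root _ (2 / q)) //; last lra.
  by rewrite e2; apply: rpow_le => //; [rewrite -e2; lra|apply: rpow_ge0].
have e3 : \rsum_(k <- E) rpow (f k) q = INR (size E) * EE (fun k => rpow (f k) q).
  by rewrite /EE; field; lra.
rewrite e3; apply: Rle_trans (Rmult_le_compat_l _ _ _ (Rlt_le _ _ h) h2) _.
rewrite rpowM //; last lra.
rewrite rpow_inv // -Rmult_assoc; apply: Rmult_le_compat_r; first exact: rpow_ge0.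
apply: Req_le; rewrite -rpow_opp // -{1}(rpow1r (INR (size E))); last lra.
by rewrite -rpowD //; lra.
Qed.

Lemma im_le_Cmod (z : C) : Rabs (Im z) <= Cmod z.
Proof.
apply: Rsqr_incr_0_var; last exact: Cmod_ge_0.
rewrite -Rsqr_abs !Rsqr_pow2 Cmod_sqr; have := pow2_ge_0 (Re z); lra.
Qed.

Section InnerBound.

Variables (a b H : R).
Hypotheses (ha : 0 < a) (hb : 0 < b).

Let R0 := 2 * Rabs H + 1 + 4 * a + 4 * b.
Let CR := 2 + 2 * R0 + 12 * R0 ^ 2.

Let R0_gt0 : 0 < R0.
Proof. by rewrite /R0; have := Rabs_pos H; lra. Qed.

Let CR_gt0 : 0 < CR.
Proof. by rewrite /CR; have := R0_gt0; have := pow2_ge_0 R0; lra. Qed.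

(** The zeta sum attached to a pair of points is evaluated at 1 plus this number, whose modulus is
    therefore the distance to the pole. *)
Definition pair_shift (sg : C) (u1 u2 v1 v2 : R) : C :=
  Cminus (Cplus (symbol2 a b sg u1 u2) (Cconj (symbol2 a b sg v1 v2))) 1.

Lemma pair_shift_Re sg u1 u2 v1 v2 : Re (pair_shift sg u1 u2 v1 v2) =
  (2 * Re sg - 1) + a * (1 - cos u1) + b * (1 - cos u2) + a * (1 - cos v1) + b * (1 - cos v2).
Proof.
have -> : Re (pair_shift sg u1 u2 v1 v2) = Re (symbol2 a b sg u1 u2) + Re (symbol2 a b sg v1 v2) - 1.
  by rewrite /pair_shift /Re /=; ring.
rewrite !symbol2_Re; ring.
Qed.

Lemma pair_shift_Im sg u1 u2 v1 v2 :
  Im (pair_shift sg u1 u2 v1 v2) = a * (sin v1 - sin u1) + b * (sin v2 - sin u2).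
Proof.
have -> : Im (pair_shift sg u1 u2 v1 v2) = Im (symbol2 a b sg u1 u2) - Im (symbol2 a b sg v1 v2).
  by rewrite /pair_shift /Im /=; ring.
rewrite !symbol2_Im; ring.
Qed.

(** On the bounded range of the symbol, [R0] bounds the distance to the pole, and the right side of
    [zeta_partial_bound] becomes the constant [CR]. *)
Lemma zsum_pair_bound L sg u1 u2 v1 v2 : 1 / 2 < Re sg <= H ->
  Cmod (zsum L (Cplus (symbol2 a b sg u1 u2) (Cconj (symbol2 a b sg v1 v2)))) <=
    CR * / Cmod (pair_shift sg u1 u2 v1 v2).
Proof.
move=> hs; set z := pair_shift _ _ _ _ _.
have c1 := one_minus_cos u1; have c2 := one_minus_cos u2; have c3 := one_minus_cos v1; have c4 := one_minus_cos v2.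
have a1 := Rmult_le_pos _ _ (Rlt_le _ _ ha) (proj1 c1); have a2 := Rmult_le_pos _ _ (Rlt_le _ _ hb) (proj1 c2).
have a3 := Rmult_le_pos _ _ (Rlt_le _ _ ha) (proj1 c3); have a4 := Rmult_le_pos _ _ (Rlt_le _ _ hb) (proj1 c4).
have hre : 0 < Re z by rewrite /z pair_shift_Re; lra.
have hz : 0 < Cmod z by apply: Rlt_le_trans hre _; apply: Rle_trans (Rle_abs _) _; apply: re_le_Cmod.
have d1 := COS_bound u1; have d2 := COS_bound u2; have d3 := COS_bound v1; have d4 := COS_bound v2.
have e1 := SIN_bound u1; have e2 := SIN_bound u2; have e3 := SIN_bound v1; have e4 := SIN_bound v2.
have hzR : Cmod z <= R0.
  have -> : z = Cplus (RtoC (2 * Re sg - 1)) (Cplus (Cplus (Cmult (RtoC a) (Cminus 1 (cis u1))) (Cmult (RtoC b) (Cminus 1 (cis u2))))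
      (Cconj (Cplus (Cmult (RtoC a) (Cminus 1 (cis v1))) (Cmult (RtoC b) (Cminus 1 (cis v2)))))).
    by rewrite /z /pair_shift /symbol2; apply: C_ext; rewrite /Re /Im /=; ring.
  have hc c y : 0 < c -> Cmod (Cmult (RtoC c) (Cminus 1 (cis y))) <= 2 * c.
    move=> hc; rewrite Cmod_mult Cmod_R Rabs_pos_eq; last lra.
    have : Cmod (Cminus 1 (cis y)) <= 2.
      by apply: Rle_trans (Cmod_triangle _ _) _; rewrite Cmod_opp Cmod_1 Cmod_cis; lra.
    nra.
  apply: Rle_trans (Cmod_triangle _ _) _; rewrite Cmod_R Rabs_pos_eq; last lra.
  have h1 := Cmod_triangle (Cplus (Cmult (RtoC a) (Cminus 1 (cis u1))) (Cmult (RtoC b) (Cminus 1 (cis u2))))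
      (Cconj (Cplus (Cmult (RtoC a) (Cminus 1 (cis v1))) (Cmult (RtoC b) (Cminus 1 (cis v2))))).
  rewrite Cmod_conj in h1.
  have h2 := Cmod_triangle (Cmult (RtoC a) (Cminus 1 (cis u1))) (Cmult (RtoC b) (Cminus 1 (cis u2))).
  have h3 := Cmod_triangle (Cmult (RtoC a) (Cminus 1 (cis v1))) (Cmult (RtoC b) (Cminus 1 (cis v2))).
  have := hc a u1 ha; have := hc b u2 hb; have := hc a v1 ha; have := hc b v2 hb.
  have := Rle_abs H; rewrite /R0; lra.
have -> : Cplus (symbol2 a b sg u1 u2) (Cconj (symbol2 a b sg v1 v2)) = Cplus 1 z.
  by rewrite /z /pair_shift; ring.
have h := zeta_partial_bound z L (Rlt_le _ _ hre).
apply: (Rmult_le_reg_l (Cmod z)) => //.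
have -> : Cmod z * (CR * / Cmod z) = CR by field; lra.
apply: Rle_trans h _; rewrite /CR.
have : Cmod z ^ 2 <= R0 ^ 2 by apply: pow_incr; lra.
lra.
Qed.

Let c0 := Rmin 1 b.

Let c0_bounds : 0 < c0 /\ c0 <= 1 /\ c0 <= b.
Proof. by rewrite /c0; split; [apply: Rmin_glb_lt; lra|split; [apply: Rmin_l|apply: Rmin_r]]. Qed.

(** [|ug K k| / (2 * PI)] increased by [1 / (2 * K + 1)], so that negative powers stay finite at the
    centre. *)
Definition yscale (K k : nat) : R := INR (gap k K).+1 / INR (2 * K + 1).

Lemma yscale_gt0 K k : 0 < yscale K k.
Proof. by apply: Rdiv_lt_0_compat; [apply: INR_gt0|apply: grid_size_gt0]. Qed.

Lemma yscale_le1 K k : (k < 2 * K + 1)%N -> yscale K k <= 1.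
Proof.
move=> hk; have hM := grid_size_gt0 K.
apply: (Rmult_le_reg_r (INR (2 * K + 1))) => //.
rewrite /yscale /Rdiv Rmult_assoc Rinv_l ?Rmult_1_r ?Rmult_1_l; last lra.
by apply/le_INR/leP; rewrite /gap; lia.
Qed.

(* [x = c0 (Y^2 + delta) / 2] bounds [2 Re s - 1] from below on the whole row. *)
Lemma row_height K k2 d : Rabs (ug K k2) <= 1 -> 1 <= INR (2 * K + 1) * d -> 0 < d ->
  c0 * (yscale K k2 ^ 2 + d) / 2 <= 2 * d + 2 * b * (1 - cos (ug K k2)).
Proof.
move=> hu hMd hd; have hM := grid_size_gt0 K; have [c00 [c01 c0b]] := c0_bounds.
have hc := one_minus_cos_ge _ hu.
have hM1 : 1 <= INR (2 * K + 1) by apply: (le_INR 1); apply/leP; rewrite addn1.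
set M := INR (2 * K + 1) in hM hM1 hMd.
set t := INR (gap k2 K) / M.
have eu : Rabs (ug K k2) = 2 * PI * t by rewrite ug_abs.
have hpi : 1 <= PI by have := PI2_1; lra.
have ht0 : 0 <= t by apply: Rdiv_le_0_compat => //; apply: pos_INR.
have hut : t ^ 2 <= ug K k2 ^ 2 / 4.
  rewrite -(pow2_abs (ug K k2)) eu.
  have : 1 <= PI ^ 2 by nra.
  have := pow2_ge_0 t; nra.
have eY : yscale K k2 = t + / M.
  by rewrite /yscale -/M S_INR /t; field; lra.
have hMi : / M <= d.
  by apply: (Rmult_le_reg_l M) => //; rewrite Rinv_r; lra.
have hMi0 : 0 < / M by apply: Rinv_0_lt_compat.
have hMi1 : / M <= 1 by rewrite -Rinv_1; apply: Rinv_le_contravar; lra.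
have hY : yscale K k2 ^ 2 <= 2 * t ^ 2 + 2 * d.
  rewrite eY; have := pow2_ge_0 (t - / M); nra.
have h1 : c0 * (yscale K k2 ^ 2 + d) / 2 <= c0 * (2 * t ^ 2 + 3 * d) / 2.
  apply: Rmult_le_compat_r; first lra.
  by apply: Rmult_le_compat_l; lra.
apply: Rle_trans h1 _.
have h2 : c0 * t ^ 2 <= b * t ^ 2 by apply: Rmult_le_compat_r => //; apply: pow2_ge_0.
have h3 : b * t ^ 2 <= b * (1 - cos (ug K k2)) by apply: Rmult_le_compat_l; lra.
have h4 : b * (ug K k2 ^ 2 / 4) <= b * (1 - cos (ug K k2)) by apply: Rmult_le_compat_l; lra.
nra.
Qed.

Variables (q b0 B eps : R).
Hypotheses (hq : 1 <= q < 2) (hb0 : 0 <= b0) (hB : 0 <= B) (heps : 0 < eps < 1).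

Let C1 := CR * (2 / c0 + 4 * rpow a (eps - 1) / eps).

(** The distance to the pole is at least [x] by real parts and at least [a * gap / (2 * K + 1)] by
    imaginary parts. The second bound alone would produce a harmonic sum; the geometric mean with
    weights [eps] and [1 - eps] trades its logarithm for [x^(-eps)]. The diagonal term [1 / x] is at
    most a multiple of [2 * K + 1] because [(2 * K + 1) * d >= 1]. *)
Lemma row_sum K d sg k2 x L k : 0 < d <= 1 -> 1 <= INR (2 * K + 1) * d -> 1 / 2 + d <= Re sg <= H ->
  (k2 < 2 * K + 1)%N -> Rabs (ug K k2) <= 1 ->
  x = c0 * (yscale K k2 ^ 2 + d) / 2 -> k \in near_set K k2 ->
  \rsum_(j <- near_set K k2)
     Cmod (zsum L (Cplus (symbol2 a b sg (ug K k) (ug K k2)) (Cconj (symbol2 a b sg (ug K j) (ug K k2)))))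
  <= C1 * INR (2 * K + 1) * rpow (/ x) eps.
Proof.
move=> hd hMd hs hk2 hu ex hk; have hM := grid_size_gt0 K; have [c00 [c01 c0b]] := c0_bounds.
have hY0 := yscale_gt0 K k2; have hY1 := yscale_le1 K k2 hk2.
have hx := row_height K k2 d hu hMd (proj1 hd); rewrite -ex in hx.
have x0 : 0 < x by rewrite ex; have := pow2_ge_0 (yscale K k2); nra.
have x1 : x <= 1 by rewrite ex; nra.
have xi : 1 <= / x by rewrite -Rinv_1; apply: Rinv_le_contravar.
have hnear j : j \in near_set K k2 -> Rabs (ug K j) <= 1.
  rewrite mem_filter => /andP[h _]; apply: Rle_trans hu; rewrite !ug_abs.
  apply: Rmult_le_compat_l; first by have := PI_RGT_0; lra.
  apply: Rmult_le_compat_r; first exact/Rlt_le/Rinv_0_lt_compat.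
  exact/le_INR/leP.
pose z j := pair_shift sg (ug K k) (ug K k2) (ug K j) (ug K k2).
have hzre j : x <= Cmod (z j).
  apply: Rle_trans (re_le_Cmod _); apply: Rle_trans (Rle_abs _); rewrite /z pair_shift_Re.
  have c1 := one_minus_cos (ug K k); have c3 := one_minus_cos (ug K j).
  have a1 := Rmult_le_pos _ _ (Rlt_le _ _ ha) (proj1 c1).
  have a3 := Rmult_le_pos _ _ (Rlt_le _ _ ha) (proj1 c3); lra.
have hzim j : j \in near_set K k2 -> a * (INR (gap k j) / INR (2 * K + 1)) <= Cmod (z j).
  move=> hj; apply: Rle_trans (im_le_Cmod _); rewrite /z pair_shift_Im Rminus_diag Rmult_0_r Rplus_0_r.
  rewrite Rabs_mult (Rabs_pos_eq a); last lra.
  apply: Rmult_le_compat_l; first lra.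
  rewrite Rabs_minus_sym; apply: Rle_trans (sin_diff_ge _ _ (hnear k hk) (hnear j hj)).
  rewrite ug_dist; have : 1 <= PI by have := PI2_1; lra.
  have : 0 <= INR (gap k j) / INR (2 * K + 1) by apply: Rdiv_le_0_compat => //; apply: pos_INR.
  nra.
have hs' : 1 / 2 < Re sg <= H by lra.
have hkin : k \in iota 0 (2 * K + 1) by move: hk; rewrite mem_filter => /andP[].
have hkM : (k < 2 * K + 1)%N by rewrite mem_iota in hkin; case/andP: hkin.
pose D := rpow (/ x) eps * rpow a (eps - 1).
pose T j := if j == k then / x else D * rpow (INR (gap k j) / INR (2 * K + 1)) (eps - 1).
have D0 : 0 <= D by apply: Rmult_le_pos; apply: rpow_ge0.
have hT j : 0 <= T j.
  by rewrite /T; case: eqP => _; [lra|apply: Rmult_le_pos => //; apply: rpow_ge0].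
have hterm j : j \in near_set K k2 -> / Cmod (z j) <= T j.
  move=> hj; rewrite /T; case: eqP => [_|/eqP hjk]; first exact: Rinv_le_contravar.
  have hgap : 0 < INR (gap k j) / INR (2 * K + 1).
    by apply: Rdiv_lt_0_compat => //; apply: INR_gt0; move: hjk; rewrite /gap; lia.
  have hzp : 0 < Cmod (z j) by apply: Rlt_le_trans x0 (hzre j).
  have hag : 0 < a * (INR (gap k j) / INR (2 * K + 1)) by apply: Rmult_lt_0_compat.
  have hxe := rpow_gt0 x eps x0; have hae := rpow_gt0 _ (1 - eps) hag.
  have h1 : rpow x eps * rpow (a * (INR (gap k j) / INR (2 * K + 1))) (1 - eps) <= Cmod (z j).
    rewrite -[X in _ <= X](rpow1r (Cmod (z j))); last lra.
    have -> : rpow (Cmod (z j)) 1 = rpow (Cmod (z j)) eps * rpow (Cmod (z j)) (1 - eps).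
      by rewrite -rpowD; [congr rpow; ring|lra].
    apply: Rmult_le_compat; [lra|lra|apply: rpow_le; [lra|lra|exact: hzre]|].
    by apply: rpow_le; [lra|lra|exact: hzim].
  have h2 := Rinv_le_contravar _ _ (Rmult_lt_0_compat _ _ hxe hae) h1.
  apply: Rle_trans h2 _; apply: Req_le.
  rewrite Rinv_mult -rpow_inv // -rpow_opp // /D Rmult_assoc -rpowM; [|lra|lra].
  by congr (_ * rpow _ _); ring.
apply: Rle_trans (_ : \rsum_(j <- near_set K k2) CR * T j <= _).
  apply: rsum_le_seq => j hj; apply: Rle_trans (zsum_pair_bound L sg _ _ _ _ hs') _.
  by apply: Rmult_le_compat_l; [exact/Rlt_le/CR_gt0|apply: hterm].
rewrite -big_distrr /=.
have hsum : \rsum_(j <- near_set K k2) T j <= / x + D * (2 * (INR (2 * K + 1) * (2 / eps))).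
  apply: Rle_trans (rsum_subset _ _ (iota 0 (2 * K + 1)) T (near_set_uniq _ _) (iota_uniq _ _) _ _) _ => //.
    by move=> j; rewrite mem_filter => /andP[].
  rewrite (bigD1_seq k) ?iota_uniq //= {1}/T eqxx; apply: Rplus_le_compat_l.
  rewrite (eq_bigr (fun j => D * rpow (INR (gap k j) / INR (2 * K + 1)) (eps - 1))); last first.
    by move=> j /negbTE hj; rewrite /T hj.
  rewrite -big_distrr /=; apply: Rmult_le_compat_l => //.
  apply: Rle_trans (sum_dist (fun i => rpow (INR i / INR (2 * K + 1)) (eps - 1)) _ _ _ hkM) _.
    by move=> i; apply: rpow_ge0.
  apply: Rmult_le_compat_l; first lra.
  have := power_mean_sum (eps - 1) (2 * K + 1) (INR (2 * K + 1)) ltac:(lra) hM ltac:(lra).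
  rewrite (_ : eps - 1 + 1 = eps); last ring.
  move/(Rmult_le_compat_l _ _ _ (Rlt_le _ _ hM)); rewrite -Rmult_assoc Rinv_r ?Rmult_1_l //; lra.
apply: Rle_trans (Rmult_le_compat_l _ _ _ (Rlt_le _ _ CR_gt0) hsum) _.
rewrite /C1 !Rmult_assoc; apply: Rmult_le_compat_l; first exact/Rlt_le/CR_gt0.
rewrite Rmult_plus_distr_r; apply: Rplus_le_compat; last first.
  by apply: Req_le; rewrite /D; field; lra.
have hxe : 1 <= rpow (/ x) eps.
  rewrite rpow_inv //; rewrite -Rinv_1; apply: Rinv_le_contravar; first exact: rpow_gt0.
  by apply: rpow_le1; lra.
have h1 : / x <= 2 / c0 * INR (2 * K + 1).
  apply: (Rmult_le_reg_l x) => //; rewrite Rinv_r; last lra.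
  have : c0 * d / 2 <= x by rewrite ex; have := pow2_ge_0 (yscale K k2); nra.
  have hc : 0 < 2 / c0 by apply: Rdiv_lt_0_compat; lra.
  move=> h2; apply: Rle_trans (_ : c0 * d / 2 * (2 / c0 * INR (2 * K + 1)) <= _); last first.
    by apply: Rmult_le_compat_r => //; apply: Rmult_le_pos; lra.
  have -> : c0 * d / 2 * (2 / c0 * INR (2 * K + 1)) = INR (2 * K + 1) * d by field; lra.
  exact: hMd.
have h3 : 0 <= 2 / c0 * INR (2 * K + 1).
  by apply: Rmult_le_pos; [apply: Rdiv_le_0_compat; lra|lra].
rewrite -Rmult_assoc; nra.
Qed.

Let bb := b0 + eps.

(** The sieve bounds the sum of squares by a multiple of [(2K+1) x^(-(b0+eps))] with [x] at least of
    order [Y^2], where [Y] is [yscale]. Hölder over at most [2 (2K+1) Y] points passes to the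
    exponent [q]: the powers of the grid size cancel and the stated power of [Y] remains. *)
Lemma near_row_bound : exists2 Cst, 0 < Cst & forall K d sg k2 A N l w v,
  prime_base l N -> (forall k, 0 < w k) -> euler_weights b0 B v ->
  (forall k, / w k <= \rsum_(i <- iota 0 k.+1) v i) ->
  0 < d <= 1 -> 1 <= INR (2 * K + 1) * d -> 1 / 2 + d <= Re sg <= H ->
  (k2 < 2 * K + 1)%N -> Rabs (ug K k2) <= 1 ->
  / INR (2 * K + 1) * \rsum_(k <- near_set K k2)
      rpow (Cmod (dir_sum A N (symbol2 a b sg (ug K k) (ug K k2)))) q
  <= Cst * rpow (yscale K k2) (1 - q / 2 - q * bb) * rpow (wnorm w l A N) (q / 2).
Proof.
have [M0 hM0 hEuler] := euler_bound b0 B 1 hb0 hB Rlt_0_1.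
have [c00 [c01 c0b]] := c0_bounds.
have C1p : 0 < C1.
  apply: Rmult_lt_0_compat; first exact: CR_gt0.
  apply: Rplus_lt_le_0_compat; first by apply: Rdiv_lt_0_compat; lra.
  apply: Rdiv_le_0_compat; last lra.
  by apply: Rmult_le_pos; [lra|apply: rpow_ge0].
have hbb : 0 < bb by rewrite /bb; lra.
pose C2 := C1 * M0 * rpow (2 / c0) bb.
have C2p : 0 < C2.
  apply: Rmult_lt_0_compat; first exact: Rmult_lt_0_compat.
  by apply: rpow_gt0; apply: Rdiv_lt_0_compat; lra.
exists (rpow 2 (1 - q / 2) * rpow C2 (q / 2)).
  by apply: Rmult_lt_0_compat; apply: rpow_gt0; lra.
move=> K d sg k2 A N l w v hbase hw hv hwv hd hMd hs hk2 hu.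
have hM := grid_size_gt0 K; have hY0 := yscale_gt0 K k2; have hY1 := yscale_le1 K k2 hk2.
have [ul pl _] := hbase; have [_ _ hv0 _] := hv.
pose x := c0 * (yscale K k2 ^ 2 + d) / 2.
have x0 : 0 < x by rewrite /x; have := pow2_ge_0 (yscale K k2); nra.
have x1 : x <= 1 by rewrite /x; nra.
have hx := row_height K k2 d hu hMd (proj1 hd); rewrite -/x in hx.
have xi : 0 < / x by apply: Rinv_0_lt_compat.
pose F k := Cmod (dir_sum A N (symbol2 a b sg (ug K k) (ug K k2))).
have F0 k : 0 <= F k by apply: Cmod_ge_0.
pose Nn := wnorm w l A N.
have Nn0 : 0 <= Nn.
  apply: rsum_ge0 => n _; apply: Rmult_le_pos; last exact: pow2_ge_0.
  by apply: wprod_ge0 => k; apply/Rlt_le.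
have hsieve : \rsum_(k <- near_set K k2) F k ^ 2 <= C1 * INR (2 * K + 1) * rpow (/ x) eps * (M0 * rpow (/ x) b0) * Nn.
  apply: (large_sieve (near_set K k2) (fun k => symbol2 a b sg (ug K k) (ug K k2)) A N l w v x) => //.
  - move=> k _; rewrite symbol2_Re.
    have := Rmult_le_pos _ _ (Rlt_le _ _ ha) (proj1 (one_minus_cos (ug K k))); lra.
  - by repeat apply: Rmult_lt_0_compat => //; apply: rpow_gt0.
  - by apply: Rmult_lt_0_compat => //; apply: rpow_gt0.
  - by move=> L k hk; apply: (row_sum K d sg k2 x L k).
  - by apply: hEuler => //; lra.
have hxY : rpow (/ x) bb <= rpow (2 / c0) bb * rpow (yscale K k2) (- 2 * bb).
  have hY2 : 0 < yscale K k2 ^ 2 by apply: pow_lt.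
  have hcY : 0 < c0 * yscale K k2 ^ 2 / 2 by nra.
  have -> : rpow (yscale K k2) (- 2 * bb) = rpow (/ yscale K k2 ^ 2) bb.
    rewrite rpow_inv; last exact: pow_lt.
    rewrite -(rpow_nat (yscale K k2) 1); last lra.
    rewrite rpow_rpow; last lra.
    by rewrite -rpow_opp //; congr rpow; rewrite /=; ring.
  rewrite -rpowM; [|by apply: Rdiv_le_0_compat; lra|by apply/Rlt_le/Rinv_0_lt_compat/pow_lt].
  apply: rpow_le; [lra|lra|].
  have -> : 2 / c0 * / yscale K k2 ^ 2 = / (c0 * yscale K k2 ^ 2 / 2) by field; split; lra.
  by apply: Rinv_le_contravar => //; rewrite /x; nra.
have hS : \rsum_(k <- near_set K k2) F k ^ 2 <= INR (2 * K + 1) * (C2 * rpow (yscale K k2) (- 2 * bb) * Nn).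
  apply: Rle_trans hsieve _.
  have -> : C1 * INR (2 * K + 1) * rpow (/ x) eps * (M0 * rpow (/ x) b0) * Nn =
     INR (2 * K + 1) * (C1 * M0 * rpow (/ x) bb * Nn) by rewrite /bb rpowD; [ring|lra].
  apply: Rmult_le_compat_l; first lra.
  apply: Rmult_le_compat_r => //; rewrite /C2 (Rmult_assoc (C1 * M0)).
  by apply: Rmult_le_compat_l => //; apply: Rlt_le; apply: Rmult_lt_0_compat.
have hk2in : k2 \in near_set K k2 by rewrite mem_filter leqnn mem_iota.
have hsz : (0 < size (near_set K k2))%N by case: (near_set K k2) hk2in.
have hsz2 : INR (size (near_set K k2)) <= 2 * (INR (2 * K + 1) * yscale K k2).
  have -> : INR (2 * K + 1) * yscale K k2 = INR (gap k2 K).+1 by rewrite /yscale; field; lra.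
  rewrite -[2]/(INR 2) -mult_INR; apply/le_INR/leP; exact: size_near_set.
have hh := rsum_holder (near_set K k2) F q hq hsz F0.
apply: Rle_trans (Rmult_le_compat_l _ _ _ (Rlt_le _ _ (Rinv_0_lt_compat _ hM)) hh) _.
have hq2 : 0 <= q / 2 by lra.
have hYb := rpow_gt0 (yscale K k2) (- 2 * bb) hY0.
have hCYN : 0 <= C2 * rpow (yscale K k2) (- 2 * bb) * Nn.
  by apply: Rmult_le_pos => //; apply: Rmult_le_pos; lra.
have h1 : rpow (INR (size (near_set K k2))) (1 - q / 2) <= rpow (2 * (INR (2 * K + 1) * yscale K k2)) (1 - q / 2).
  by apply: rpow_le => //; [lra|apply: pos_INR].
have h2 : rpow (\rsum_(k <- near_set K k2) F k ^ 2) (q / 2) <=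
   rpow (INR (2 * K + 1) * (C2 * rpow (yscale K k2) (- 2 * bb) * Nn)) (q / 2).
  by apply: rpow_le => //; apply: rsum_ge0 => k _; apply: pow2_ge_0.
have h3 := Rmult_le_compat _ _ _ _ (rpow_ge0 _ _) (rpow_ge0 _ _) h1 h2.
apply: Rle_trans (Rmult_le_compat_l _ _ _ (Rlt_le _ _ (Rinv_0_lt_compat _ hM)) h3) _.
have hYn : 0 <= INR (2 * K + 1) * yscale K k2 by apply: Rmult_le_pos; lra.
rewrite (rpowM 2) //; last lra.
rewrite (rpowM _ (yscale K k2)); [|lra|lra].
rewrite (rpowM (INR (2 * K + 1)) (C2 * _ * _)) //; last lra.
rewrite (rpowM (C2 * _) Nn) //; last by apply: Rmult_le_pos; lra.
rewrite (rpowM C2); [|lra|lra].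
rewrite (rpow_rpow (yscale _ _)); last lra.
have -> : 1 - q / 2 - q * bb = (1 - q / 2) + (- 2 * bb * (q / 2)) by field.
rewrite (rpowD (yscale K k2)); last lra.
have eM : rpow (INR (2 * K + 1)) (1 - q / 2) * rpow (INR (2 * K + 1)) (q / 2) = INR (2 * K + 1).
  by rewrite -rpowD; [rewrite (_ : 1 - q / 2 + q / 2 = 1) ?rpow1r; lra|lra].
rewrite -/Nn; set m1 := rpow (INR (2 * K + 1)) (1 - q / 2) in eM *; set m2 := rpow (INR (2 * K + 1)) (q / 2) in eM *.
apply: Req_le; rewrite -[in LHS]eM.
have hm : m1 * m2 <> 0 by rewrite eM; lra.
by field; split => h0; apply: hm; rewrite h0; ring.
Qed.

End InnerBound.

Lemma rpow_le_neg g x y : g <= 0 -> 0 < x -> x <= y -> rpow y g <= rpow x g.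
Proof.
move=> hg hx hxy; have [h eh] : exists h, g = - h by exists (- g); ring.
rewrite eh in hg *.
rewrite !rpow_opp; [|lra|lra]; apply: Rinv_le_contravar; first exact: rpow_gt0.
by apply: rpow_le; lra.
Qed.

(** A Riemann sum for an integrable power. One copy of [S] pays for the centre and two for the two
    sides. *)
Lemma yscale_sum K g : -1 < g <= 0 ->
  / INR (2 * K + 1) * \rsum_(k <- iota 0 (2 * K + 1)) rpow (yscale K k) g <= 6 / (g + 1).
Proof.
move=> hg; have hM := grid_size_gt0 K; have hMi := Rinv_0_lt_compat _ hM.
have hK : (K < 2 * K + 1)%N by lia.
set M := INR (2 * K + 1) in hM hMi *.
pose G i := rpow (INR i.+1 / M) g.
pose S := \rsum_(i <- iota 1 (2 * K + 1)) rpow (INR i / M) g.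
have hS : / M * S <= 2 / (g + 1) by apply: power_mean_sum => //; rewrite -/M; lra.
have hG0 : G 0%N <= S.
  apply: (rsum_term_le _ _ (fun i => rpow (INR i / M) g) 1%N) => [i _|]; first exact: rpow_ge0.
  by rewrite mem_iota; lia.
have hGs : \rsum_(i <- iota 1 (2 * K + 1)) G i <= S.
  apply: rsum_le_seq => i; rewrite mem_iota => /andP[hi _]; have := INR_gt0 i hi => hi'.
  apply: rpow_le_neg; [lra|exact: Rdiv_lt_0_compat|].
  by apply: Rmult_le_compat_r; [lra|rewrite S_INR; lra].
have h : \rsum_(k <- iota 0 (2 * K + 1)) rpow (yscale K k) g <= 3 * S.
  rewrite (bigD1_seq K) ?iota_uniq ?mem_iota //=.
  have -> : rpow (yscale K K) g = G 0%N by rewrite /yscale /gap subnn.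
  have := sum_dist G (2 * K + 1) K (fun i => rpow_ge0 _ _) hK.
  have -> : \rsum_(j <- iota 0 (2 * K + 1) | j != K) G (K - j + (j - K))%N =
            \rsum_(j <- iota 0 (2 * K + 1) | j != K) rpow (yscale K j) g.
    by apply: eq_bigr => j _; rewrite /yscale /gap addnC.
  lra.
have := Rmult_le_compat_l _ _ _ (Rlt_le _ _ hMi) h.
have -> : 6 / (g + 1) = 3 * (2 / (g + 1)) by field; lra.
lra.
Qed.

Lemma ug_le_PI K k : (k < 2 * K + 1)%N -> Rabs (ug K k) <= PI.
Proof.
move=> hk; have hM := grid_size_gt0 K; have hpi := PI_RGT_0.
have h : 2 * INR (gap k K) <= INR (2 * K + 1).
  by rewrite -[2]/(INR 2) -mult_INR; apply/le_INR/leP; rewrite /gap; lia.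
have h2 : INR (gap k K) / INR (2 * K + 1) <= 1 / 2.
  by apply: (Rmult_le_reg_r (INR (2 * K + 1))) => //; rewrite /Rdiv Rmult_assoc Rinv_l; lra.
rewrite ug_abs; nra.
Qed.

Lemma symbol2_swap a b sg u1 u2 : symbol2 a b sg u1 u2 = symbol2 b a sg u2 u1.
Proof. by rewrite /symbol2; ring. Qed.

(** Away from the minimum the symbol keeps a fixed distance from the critical line, and the sieve
    with a single point is the boundedness of point evaluation. *)
Lemma far_bound a b H q b0 B : 0 < a -> 0 < b -> 1 <= q < 2 -> 0 <= b0 -> 0 <= B ->
  exists2 Cst, 0 < Cst & forall sg u1 u2 A N l w v,
  prime_base l N -> (forall k, 0 < w k) -> euler_weights b0 B v ->
  (forall k, / w k <= \rsum_(i <- iota 0 k.+1) v i) ->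
  1 / 2 < Re sg <= H -> Rmin 1 (Rmin a b) / 4 <= a * (1 - cos u1) + b * (1 - cos u2) ->
  rpow (Cmod (dir_sum A N (symbol2 a b sg u1 u2))) q <= Cst * rpow (wnorm w l A N) (q / 2).
Proof.
move=> ha hb hq hb0 hB; have [M0 hM0 hEuler] := euler_bound b0 B 1 hb0 hB Rlt_0_1.
have hz := zsum_pair_bound a b H ha hb.
set CR := 2 + _ + _ in hz.
have hCR : 0 < CR.
  by rewrite /CR; have := Rabs_pos H => h; have := pow2_ge_0 (2 * Rabs H + 1 + 4 * a + 4 * b); lra.
set c0 := Rmin 1 (Rmin a b).
have c00 : 0 < c0 by repeat apply: Rmin_glb_lt; lra.
have c01 : c0 <= 1 by apply: Rmin_l.
pose x := c0 / 2; have x0 : 0 < x by rewrite /x; lra.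
pose C := CR * / x * (M0 * rpow (/ x) b0).
have hxi : 0 < / x by apply: Rinv_0_lt_compat.
have hxb : 0 < rpow (/ x) b0 by apply: rpow_gt0.
have hCx : 0 < CR * / x by apply: Rmult_lt_0_compat.
have hMx : 0 < M0 * rpow (/ x) b0 by apply: Rmult_lt_0_compat.
have hC : 0 < C by apply: Rmult_lt_0_compat.
exists (rpow C (q / 2)); first exact: rpow_gt0.
move=> sg u1 u2 A N l w v hbase hw hv hwv hs hfar; have [ul pl _] := hbase.
set s := symbol2 a b sg u1 u2.
have hre : 1 + x <= 2 * Re s by rewrite /s symbol2_Re /x; lra.
have hNn : 0 <= wnorm w l A N.
  apply: rsum_ge0 => n _; apply: Rmult_le_pos; last exact: pow2_ge_0.
  by apply: wprod_ge0 => k; apply/Rlt_le.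
have := large_sieve [:: 0%N] (fun=> s) A N l w v x (CR * / x) (M0 * rpow (/ x) b0) hbase hw.
have [_ _ hv0 _] := hv => /(_ hv0 hwv (fun _ _ => hre) hCx hMx).
rewrite !big_seq1 => h.
have {}h : Cmod (dir_sum A N s) ^ 2 <= C * wnorm w l A N.
  apply: h => [L k _|]; last by apply: hEuler => //; rewrite /x; lra.
  rewrite big_seq1; apply: Rle_trans (hz L sg u1 u2 u1 u2 hs) _.
  apply: Rmult_le_compat_l; first lra.
  apply: Rinv_le_contravar => //; apply: Rle_trans (re_le_Cmod _).
  apply: Rle_trans (Rle_abs _); rewrite pair_shift_Re.
  by rewrite /s symbol2_Re in hre; lra.
rewrite -rpowM //; last lra.
rewrite -rpow_sqr_half; last exact: Cmod_ge_0.
by apply: rpow_le => //; [lra|apply: pow2_ge_0].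
Qed.

Lemma double_mean_add (I : seq nat) (m c : R) (A B : nat -> nat -> R) : m * INR (size I) = 1 ->
  m * \rsum_(k2 <- I) (m * \rsum_(k1 <- I) (c + (A k1 k2 + B k1 k2))) =
  c + (m * \rsum_(k2 <- I) (m * \rsum_(k1 <- I) A k1 k2) + m * \rsum_(k1 <- I) (m * \rsum_(k2 <- I) B k1 k2)).
Proof.
move=> hm.
have -> : \rsum_(k1 <- I) (m * \rsum_(k2 <- I) B k1 k2) = \rsum_(k2 <- I) (m * \rsum_(k1 <- I) B k1 k2).
  by rewrite -!big_distrr exchange_big.
rewrite (eq_bigr (fun k2 => c + (m * \rsum_(k1 <- I) A k1 k2 + m * \rsum_(k1 <- I) B k1 k2))); last first.
  move=> k2 _; rewrite !big_split /= rsum_const -[X in _ = X + _](Rmult_1_l c) -hm; ring.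
rewrite !big_split /= rsum_const -[X in _ = X + _](Rmult_1_l c) -hm; ring.
Qed.

(** The square of angles is covered by a far region and, near the minimum, by the parts
    [|u1| <= |u2|] and [|u2| <= |u1|], summed by rows and by columns respectively. *)
Lemma two_dim_bound a b H q b0 B eps : 0 < a -> 0 < b -> 1 <= q < 2 -> 0 <= b0 -> 0 <= B ->
  0 < eps < 1 -> -1 < 1 - q / 2 - q * (b0 + eps) <= 0 ->
  exists2 Cst, 0 < Cst & forall K d sg A N l w v,
  prime_base l N -> (forall k, 0 < w k) -> euler_weights b0 B v ->
  (forall k, / w k <= \rsum_(i <- iota 0 k.+1) v i) ->
  0 < d <= 1 -> 1 <= INR (2 * K + 1) * d -> 1 / 2 + d <= Re sg <= H ->
  / INR (2 * K + 1) * \rsum_(k2 <- iota 0 (2 * K + 1)) (/ INR (2 * K + 1) *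
     \rsum_(k1 <- iota 0 (2 * K + 1)) rpow (Cmod (dir_sum A N (symbol2 a b sg (ug K k1) (ug K k2)))) q)
  <= Cst * rpow (wnorm w l A N) (q / 2).
Proof.
move=> ha hb hq hb0 hB heps hg.
have [Cf hCf hfar] := far_bound a b H q b0 B ha hb hq hb0 hB.
have [Ca hCa hnear_a] := near_row_bound a b H ha hb q b0 B eps hq hb0 hB heps.
have [Cb hCb hnear_b] := near_row_bound b a H hb ha q b0 B eps hq hb0 hB heps.
set g := 1 - q / 2 - q * (b0 + eps) in hg hnear_a hnear_b.
have hg6 : 0 < 6 / (g + 1) by apply: Rdiv_lt_0_compat; lra.
exists (Cf + (Ca + Cb) * (6 / (g + 1))).
  by have := Rmult_lt_0_compat _ _ (Rplus_lt_0_compat _ _ hCa hCb) hg6; lra.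
move=> K d sg A N l w v hbase hw hv hwv hd hMd hs.
have hM := grid_size_gt0 K; have hMi := Rinv_0_lt_compat _ hM.
set Nq := rpow (wnorm w l A N) (q / 2); have Nq0 : 0 <= Nq by apply: rpow_ge0.
pose f k1 k2 := rpow (Cmod (dir_sum A N (symbol2 a b sg (ug K k1) (ug K k2)))) q.
have f0 k1 k2 : 0 <= f k1 k2 by apply: rpow_ge0.
pose near k : bool := if Rle_dec (Rabs (ug K k)) 1 then true else false.
pose P1 k1 k2 := near k2 && (gap k1 K <= gap k2 K)%N.
pose P2 k1 k2 := near k1 && (gap k2 K <= gap k1 K)%N.
pose I := iota 0 (2 * K + 1).
have split3 k1 k2 : k1 \in I -> k2 \in I ->
    f k1 k2 <= Cf * Nq + ((if P1 k1 k2 then f k1 k2 else 0) + (if P2 k1 k2 then f k1 k2 else 0)).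
  rewrite !mem_iota add0n => /andP[_ h1] /andP[_ h2].
  have CfN : 0 <= Cf * Nq by apply: Rmult_le_pos; lra.
  have tot : 0 <= (if P1 k1 k2 then f k1 k2 else 0) + (if P2 k1 k2 then f k1 k2 else 0).
    by have := f0 k1 k2; case: (P1 k1 k2); case: (P2 k1 k2); lra.
  have c1 := one_minus_cos (ug K k1); have c2 := one_minus_cos (ug K k2).
  have a1 := Rmult_le_pos _ _ (Rlt_le _ _ ha) (proj1 c1); have a2 := Rmult_le_pos _ _ (Rlt_le _ _ hb) (proj1 c2).
  have m1 : Rmin 1 (Rmin a b) <= a by apply: Rle_trans (Rmin_r _ _) _; apply: Rmin_l.
  have m2 : Rmin 1 (Rmin a b) <= b by apply: Rle_trans (Rmin_r _ _) _; apply: Rmin_r.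
  have hs' : 1 / 2 < Re sg <= H by lra.
  have fin : Rmin 1 (Rmin a b) / 4 <= a * (1 - cos (ug K k1)) + b * (1 - cos (ug K k2)) -> f k1 k2 <= Cf * Nq.
    by move=> h; apply: (hfar sg _ _ A N l w v).
  case: (one_minus_cos_near_far _ (ug_le_PI K k1 h1)) => [[n1 _]|n1]; last first.
    suff : f k1 k2 <= Cf * Nq by lra.
    by apply: fin; nra.
  case: (one_minus_cos_near_far _ (ug_le_PI K k2 h2)) => [[n2 _]|n2]; last first.
    suff : f k1 k2 <= Cf * Nq by lra.
    by apply: fin; nra.
  have nk k : Rabs (ug K k) <= 1 -> near k by move=> h; rewrite /near; case: (Rle_dec (Rabs (ug K k)) 1).
  rewrite /P1 /P2 (nk _ n1) (nk _ n2) /=.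
  have := f0 k1 k2; case: leqP => hle; case: leqP => hle' f00; try lra.
  by move: hle hle'; lia.
have nearP k : near k -> Rabs (ug K k) <= 1 by rewrite /near; case: Rle_dec.
have rowsum (F : nat -> nat -> R) Cst : 0 < Cst ->
    (forall k2, k2 \in I -> near k2 -> / INR (2 * K + 1) * \rsum_(k1 <- near_set K k2) F k1 k2 <= Cst * rpow (yscale K k2) g * Nq) ->
    / INR (2 * K + 1) * \rsum_(k2 <- I) (/ INR (2 * K + 1) *
       \rsum_(k1 <- I) (if near k2 && (gap k1 K <= gap k2 K)%N then F k1 k2 else 0)) <= Cst * (6 / (g + 1)) * Nq.
  move=> hCst hF.
  apply: Rle_trans (_ : / INR (2 * K + 1) * \rsum_(k2 <- I) (Cst * Nq * rpow (yscale K k2) g) <= _).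
    apply: Rmult_le_compat_l; first lra.
    apply: rsum_le_seq => k2 hk2; case hn : (near k2).
      have := hF k2 hk2 hn; rewrite /near_set big_filter big_mkcond /=.
      by rewrite -/I; move=> h; apply: Rle_trans h _; right; ring.
    rewrite big1 ?Rmult_0_r //; apply: Rmult_le_pos; last exact: rpow_ge0.
    by apply: Rmult_le_pos; lra.
  rewrite -big_distrr /=.
  have h := yscale_sum K g hg.
  have hCN : 0 <= Cst * Nq by apply: Rmult_le_pos; lra.
  have := Rmult_le_compat_l _ _ _ hCN h; rewrite -/I; set S := \rsum_(k <- I) _; lra.
have h1 : / INR (2 * K + 1) * \rsum_(k2 <- I) (/ INR (2 * K + 1) *
       \rsum_(k1 <- I) (if P1 k1 k2 then f k1 k2 else 0)) <= Ca * (6 / (g + 1)) * Nq.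
  apply: (rowsum f Ca hCa) => k2; rewrite mem_iota add0n => /andP[_ hk2] hn.
  by apply: (hnear_a K d sg k2 A N l w v) => //; apply: nearP.
have h2 : / INR (2 * K + 1) * \rsum_(k1 <- I) (/ INR (2 * K + 1) *
       \rsum_(k2 <- I) (if P2 k1 k2 then f k1 k2 else 0)) <= Cb * (6 / (g + 1)) * Nq.
  apply: (rowsum (fun k2 k1 => f k1 k2) Cb hCb) => k1; rewrite mem_iota add0n => /andP[_ hk1] hn.
  have := hnear_b K d sg k1 A N l w v hbase hw hv hwv hd hMd hs hk1 (nearP _ hn).
  by rewrite (eq_bigr (fun k2 => f k1 k2)) // => k2 _; rewrite /f symbol2_swap.
apply: Rle_trans (_ : / INR (2 * K + 1) * \rsum_(k2 <- I) (/ INR (2 * K + 1) * \rsum_(k1 <- I)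
   (Cf * Nq + ((if P1 k1 k2 then f k1 k2 else 0) + (if P2 k1 k2 then f k1 k2 else 0)))) <= _).
  apply: Rmult_le_compat_l; first lra.
  apply: rsum_le_seq => k2 hk2; apply: Rmult_le_compat_l; first lra.
  by apply: rsum_le_seq => k1 hk1; apply: split3.
rewrite double_mean_add; last by rewrite size_iota Rinv_l; lra.
lra.
Qed.

(** * Composition operators *)

(* [y] is the exponent of the zeta function that controls the kernel of the weighted space; the
   condition [y < 2 / q + 1 / 2] is exactly what makes the exponent below exceed [-1]. *)
Lemma weights_from_two_term q p0 w1 : 1 <= q < 2 -> two_term p0 w1 -> 1 / 2 <= w1 <= 2 / 3 ->
  / w1 < 2 / q + 1 / 2 ->
  exists b0 B eps w v, [/\ 0 <= b0, 0 <= B, 0 < eps < 1 & -1 < 1 - q / 2 - q * (b0 + eps) <= 0] /\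
   [/\ coef_ineq p0 w, forall k, 0 < w k, w 0%N = 1, euler_weights b0 B v
     & forall k, / w k <= \rsum_(i <- iota 0 k.+1) v i].
Proof.
move=> hq ht hw1 hlt; pose Y := / w1; pose Z := 2 / q + 1 / 2; pose y := (Y + Z) / 2.
have Y1 : 3 / 2 <= Y.
  have -> : 3 / 2 = / (2 / 3) by field.
  by apply: Rinv_le_contravar; lra.
have Y2 : Y <= 2.
  have -> : 2 = / (1 / 2) by field.
  by apply: Rinv_le_contravar; lra.
have hYZ : Y < Z by [].
have eq2 : q * (2 / q) = 2 by field; lra.
have Z2 : Z <= 5 / 2.
  rewrite /Z; have : 2 / q <= 2 by apply: (Rmult_le_reg_l q); lra.
  lra.
have hy : Y < y /\ y < Z by rewrite /y; lra.
have y0 : 0 < y by lra.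
(* [eta] is chosen so that [w 1 = / y], hence [v 0 + v 1 = / w 1] with [v 1 = y - 1]. The mass [eta]
   goes to the higher powers with ratio [2 / 3], the inverse of the rate in [euler_weights]; it
   suffices since the [(2/3)^k] with [k >= 2] sum to at most [16/9 < 2]. [eps] is half of
   [Z - y]. *)
pose eta := (y - Y) / y; pose eps := (Z - Y) / 4.
have heta : 0 < eta < 1.
  have e : eta = 1 - Y / y by rewrite /eta; field; lra.
  have : 0 < Y / y by apply: Rdiv_lt_0_compat; lra.
  have : Y / y < 1 by apply: (Rmult_lt_reg_r y) => //; rewrite /Rdiv Rmult_assoc Rinv_l; lra.
  lra.
have ew : w1 * (1 - eta) = / y.
  have -> : w1 = / Y by rewrite /Y Rinv_inv.
  by rewrite /eta; field; lra.
pose lam k : R := match k with 0%N => 0 | 1%N => 1 - eta | _ => eta / 2 * (2 / 3) ^ k end.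
pose w k : R := if k is 0%N then 1 else w1 * lam k.
pose v k : R := match k with 0%N => 1 | 1%N => y - 1 | _ => / w k end.
have hp k : 0 < (2 / 3) ^ k by apply: pow_lt; lra.
have hlam k : (0 < k)%N -> 0 < lam k.
  case: k => [//|[|k]] _ /=; first lra.
  by have := hp k.+2; rewrite /=; nra.
have hw k : 0 < w k by case: k => [|k]; [rewrite /w; lra|apply: Rmult_lt_0_compat; [lra|apply: hlam]].
exists (y - 1), (/ (w1 * (eta / 2))), eps, w, v; split.
  split; [lra|by apply/Rlt_le/Rinv_0_lt_compat; nra|by rewrite /eps; lra|].
  have e1 : q * (y - 1 + eps) + q / 2 = 2 - q * (Z - y - eps).
    have -> : q * (y - 1 + eps) + q / 2 = q * (Z - 1 / 2) - q * (Z - y - eps) by field.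
    by rewrite /Z (_ : 2 / q + 1 / 2 - 1 / 2 = 2 / q) ?eq2; lra.
  have h1 : 0 < Z - y - eps by rewrite /y /eps; lra.
  have h2 : 0 < q * (Z - y - eps) by apply: Rmult_lt_0_compat; lra.
  have h3 : 1 <= q * (y - 1 + eps) + q / 2.
    have h4 : 0 < eps by rewrite /eps; lra.
    have : q * (1 / 2) <= q * (y - 1 + eps) by apply: Rmult_le_compat_l; lra.
    lra.
  lra.
split=> //.
- apply: (two_term_coef_ineq p0 w1 w lam ht) => //; first lra.
  + by case.
  + by case=> [|k]; [rewrite /lam; lra|apply/Rlt_le/hlam].
  case=> [|n]; first by rewrite big_nil; lra.
  rewrite -[iota 1 n.+1]/(1%N :: iota 2 n) big_cons.
  have -> : \rsum_(k <- iota 2 n) lam k = eta / 2 * \rsum_(k <- iota 2 n) (2 / 3) ^ k.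
    rewrite big_distrr; apply: eq_big_seq => k; rewrite mem_iota => /andP[hk _].
    by case: k hk => [|[|k]].
  have := rsum_geom_tail (2 / 3) n ltac:(lra).
  by rewrite /lam; nra.
- split=> //.
  + case=> [|[|k]]; [by rewrite /v; lra|by rewrite /v; lra|].
    by apply/Rlt_le/Rinv_0_lt_compat.
  case=> [|[|k]] // _; right; rewrite /v /w /lam.
  have -> : (3 / 2) ^ k.+2 = / (2 / 3) ^ k.+2 by rewrite -pow_inv; congr pow; field.
  by have := hp k.+2 => h; field; lra.
case=> [|[|k]].
- by rewrite big_seq1 /w /v Rinv_1; lra.
- rewrite !big_cons big_nil /w /lam ew Rinv_inv /v; lra.
have -> : / w k.+2 = v k.+2 by [].
apply: (rsum_term_le _ _ v k.+2); last by rewrite mem_iota; lia.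
move=> [|[|i]] _; [by rewrite /v; lra|by rewrite /v; lra|].
by apply/Rlt_le/Rinv_0_lt_compat.
Qed.

(** [4 / 3] is both the value of [q] at which the weight from [two_term_1] stops being good enough
    and the least [q] with [p0 <= q] for [two_term_43]. *)
Lemma weights_exist q : 1 <= q < 2 ->
  exists p0 b0 B eps w v, [/\ 0 <= b0, 0 <= B, 0 < eps < 1, -1 < 1 - q / 2 - q * (b0 + eps) <= 0 & 0 < p0 <= q] /\
   [/\ coef_ineq p0 w, forall k, 0 < w k, w 0%N = 1, euler_weights b0 B v
     & forall k, / w k <= \rsum_(i <- iota 0 k.+1) v i].
Proof.
move=> hq; have eq2 : q * (2 / q) = 2 by field; lra.
case: (Rlt_dec q (4 / 3)) => h.
  have hc : / (1 / 2) < 2 / q + 1 / 2.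
    have : 3 / 2 < 2 / q by apply: (Rmult_lt_reg_l q); lra.
    have -> : / (1 / 2) = 2 by field.
    lra.
  have [b0 [B [eps [w [v [[h1 h2 h3 h4] h5]]]]]] := weights_from_two_term q 1 (1 / 2) hq two_term_1 ltac:(lra) hc.
  by exists 1, b0, B, eps, w, v; split => //; split => //; lra.
have hc : / (2 / 3) < 2 / q + 1 / 2.
  have : 1 < 2 / q by apply: (Rmult_lt_reg_l q); lra.
  have -> : / (2 / 3) = 3 / 2 by field.
  lra.
have [b0 [B [eps [w [v [[h1 h2 h3 h4] h5]]]]]] := weights_from_two_term q (4 / 3) (2 / 3) hq two_term_43 ltac:(lra) hc.
by exists (4 / 3), b0, B, eps, w, v; split => //; split => //; lra.
Qed.

(** Jensen raises the exponent of the coefficient inequality from [p0] to [q]. *)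
Lemma wnorm_le_torus_mean p0 q w A N l L : coef_ineq p0 w -> 0 < p0 <= q -> q < 2 ->
  (forall k, 0 < w k) -> w 0%N = 1 -> prime_base l N -> (0 < N)%N ->
  (forall n, (N < n)%N -> A n = RtoC 0) ->
  torus_mean l (fun th => rpow (Cmod (dtorus A N l th)) q) L ->
  rpow (wnorm w l A N) (q / 2) <= L.
Proof.
move=> hc hp hq hw hw0 [ul pl hs] hN hA hL; apply: le_epsilon => e he.
have [K0 hK0] := coef_ineq_torus p0 w l hc ltac:(lra) (fun k => Rlt_le _ _ (hw k)) hw0 pl ul N hN.
have [K1 hK1] := hL e he; pose K := maxn K0 K1.
have h1 := hK0 K (fun=> 0) A (fun=> 0) (leq_maxl _ _) hA.
have /Rabs_def2 h2 := hK1 K (fun=> 0) (fun=> 0) (leq_maxr _ _).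
have hE := avgs_pf K (fun=> 0) l (fun=> 0).
set E1 := avgs K _ l (fun th => rpow _ p0) _ in h1.
have hNn : 0 <= wnorm w l A N.
  apply: rsum_ge0 => n _; apply: Rmult_le_pos; last exact: pow2_ge_0.
  by apply: wprod_ge0 => k; apply/Rlt_le.
have hE1 : 0 <= E1 by apply: (pf_ge0 _ hE) => th; apply: rpow_ge0.
apply: Rle_trans (rpow_le _ _ (q / 2) _ hNn h1) _; first lra.
rewrite rpow_rpow // (_ : 2 / p0 * (q / 2) = q / p0); last by field; lra.
have hr : 1 <= q / p0 by apply: (Rmult_le_reg_r p0); [lra|rewrite /Rdiv Rmult_assoc Rinv_l; lra].
apply: Rle_trans (pf_jensen _ hE _ _ (avgs_1 _ _ _ _) (fun th => rpow_ge0 _ _) hr) _.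
rewrite (pf_ext _ hE _ (fun th => rpow (Cmod (dtorus A N l th)) q)); first lra.
move=> th; rewrite rpow_rpow; last exact: Cmod_ge_0.
by congr rpow; field; lra.
Qed.

Lemma prime_base_mono l N M : (N <= M)%N -> prime_base l M -> prime_base l N.
Proof.
move=> h [ul pl hs]; split => // n /andP[n0 nN]; apply: hs; rewrite n0; exact: leq_trans nN h.
Qed.

(** Controls the horizontal shift of the symbol. The constant depends on the polynomial, which is
    harmless because [d] will tend to 0. *)
Lemma dir_sum_lipschitz a N s d : 0 <= Re s -> 0 <= d ->
  Rabs (Cmod (dir_sum a N s) - Cmod (dir_sum a N (Cplus s (RtoC d)))) <=
    d * \rsum_(n <- iota 1 N) Cmod (a n) * ln (INR n).
Proof.
move=> hs hd.
have h : Cmod (Cminus (dir_sum a N s) (dir_sum a N (Cplus s (RtoC d)))) <=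
    d * \rsum_(n <- iota 1 N) Cmod (a n) * ln (INR n).
  have -> : Cminus (dir_sum a N s) (dir_sum a N (Cplus s (RtoC d))) =
     \csum_(n <- iota 1 N) Cmult (a n) (Cminus (cpow_neg n s) (cpow_neg n (Cplus s (RtoC d)))).
    rewrite !dir_sumE [RHS](eq_bigr (fun n => Cplus (Cmult (a n) (cpow_neg n s)) (Cmult (RtoC (-1)) (Cmult (a n) (cpow_neg n (Cplus s (RtoC d))))))).
      by rewrite big_split -big_distrr /=; ring.
    by move=> n _; ring.
  apply: Rle_trans (Cmod_csum _ _ _) _; rewrite big_distrr; apply: rsum_le_seq => n; rewrite mem_iota => /andP[hn _] /=.
  have hln := ln_INR_ge0 n hn.
  rewrite Cmod_mult cpow_negD.
  have -> : Cminus (cpow_neg n s) (Cmult (cpow_neg n s) (cpow_neg n (RtoC d))) =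
    Cmult (cpow_neg n s) (RtoC (1 - exp (- d * ln (INR n)))).
    have -> : cpow_neg n (RtoC d) = RtoC (exp (- d * ln (INR n))).
      by rewrite (cpow_neg_split n d 0) cpow_neg_line Ropp_0 Rmult_0_l cis0 Cmult_1_r.
    by rewrite RtoC_minus; ring.
  rewrite Cmod_mult Cmod_R.
  have h1 := Cmod_cpow_le1 n s hn hs.
  have h2 := exp_ineq1_le (- d * ln (INR n)).
  have h3 : exp (- d * ln (INR n)) <= 1 by rewrite -exp_0; apply: exp_le_mono; nra.
  rewrite Rabs_pos_eq; last lra.
  have h4 := Cmod_ge_0 (a n); have h5 := Cmod_ge_0 (cpow_neg n s).
  have h6 : Cmod (cpow_neg n s) * (1 - exp (- d * ln (INR n))) <= d * ln (INR n).
    have : 0 <= 1 - exp (- d * ln (INR n)) by lra.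
    nra.
  have := Rmult_le_compat_l _ _ _ h4 h6; lra.
set z := dir_sum a N s in h *; set z' := dir_sum a N _ in h *.
have h1 := Cmod_triangle (Cminus z z') z'; have h2 := Cmod_triangle (Cminus z' z) z.
have e1 : Cplus (Cminus z z') z' = z by ring.
have e2 : Cplus (Cminus z' z) z = z' by ring.
have e3 : Cmod (Cminus z' z) = Cmod (Cminus z z').
  by rewrite -Cmod_opp; congr Cmod; ring.
by rewrite e1 in h1; rewrite e2 e3 in h2; apply: Rabs_le; lra.
Qed.

Definition torsym (c1 : C) (c : nat -> C) (ps : seq nat) (th : nat -> R) : C :=
  linsym c1 c ps (fun q => cis (th q)).

Lemma torsym_Re_ge c1 c ps th : Re c1 - \rsum_(q <- ps) Cmod (c q) <= Re (torsym c1 c ps th).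
Proof.
have -> : Re (torsym c1 c ps th) = Re c1 + \rsum_(q <- ps) Re (Cmult (c q) (cis (th q))).
  by rewrite -csum_Re.
suff : \rsum_(q <- ps) (-1 * Cmod (c q)) <= \rsum_(q <- ps) Re (Cmult (c q) (cis (th q))).
  by rewrite -big_distrr /=; lra.
apply: rsum_le => q _; have := re_le_Cmod (Cmult (c q) (cis (th q))).
rewrite Cmod_mult Cmod_cis Rmult_1_r; have := Rle_abs (- Re (Cmult (c q) (cis (th q)))).
rewrite Rabs_Ropp; lra.
Qed.

Lemma torsym_upd c1 c q1 q2 ps th al u1 u2 : uniq (q1 :: q2 :: ps) ->
  Cmult (c q1) (cis (al q1)) = RtoC (- Cmod (c q1)) ->
  Cmult (c q2) (cis (al q2)) = RtoC (- Cmod (c q2)) ->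
  torsym c1 c (q1 :: q2 :: ps) (upd (upd th q2 (al q2 + u2)) q1 (al q1 + u1)) =
  symbol2 (Cmod (c q1)) (Cmod (c q2))
    (Cminus (torsym c1 c ps th) (RtoC (Cmod (c q1) + Cmod (c q2)))) u1 u2.
Proof.
rewrite !cons_uniq inE negb_or => /andP[/andP[h12 h1] /andP[h2 _]] e1 e2.
have v1 x1 x2 : upd (upd th q2 x2) q1 x1 q1 = x1 by rewrite /upd eqxx.
have v2 x1 x2 : upd (upd th q2 x2) q1 x1 q2 = x2 by rewrite /upd eq_sym (negbTE h12) eqxx.
rewrite /torsym /linsym !big_cons v1 v2 !cisD.
have -> : \csum_(q <- ps) Cmult (c q) (cis (upd (upd th q2 (al q2 + u2)) q1 (al q1 + u1) q)) =
          \csum_(q <- ps) Cmult (c q) (cis (th q)).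
  apply: eq_big_seq => q hq; rewrite /upd; case: eqP => [eq|_]; first by rewrite -eq hq in h1.
  by case: eqP => [eq|//]; rewrite -eq hq in h2.
rewrite !Cmult_assoc e1 e2 /symbol2 RtoC_plus !RtoC_opp; pose S := \csum_(q <- ps) Cmult (c q) (cis (th q)); rewrite -/S; ring.
Qed.

(** The order of quantifiers matters: [Cst] serves all polynomials, [D] does not. The term with [D]
    pays for the shift by [d = / INR (2 * K + 1)], which creates the room [1/2 + d <= Re sg] that
    [two_dim_bound] asks for. The variables of [rest] are averaged last, in a bound uniform in
    them. *)
Lemma comp_norm_bound c1 c q1 q2 ps p al : uniq (q1 :: q2 :: ps) -> 1 <= p ->
  1 / 2 + \rsum_(q <- q1 :: q2 :: ps) Cmod (c q) <= Re c1 ->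
  0 < Cmod (c q1) -> 0 < Cmod (c q2) ->
  (forall q, Cmult (c q) (cis (al q)) = RtoC (- Cmod (c q))) ->
  exists2 Cst, 0 <= Cst & forall a N, exists2 D, 0 <= D & forall K rest th,
  rpow (avgs K al (q1 :: q2 :: rest)
     (fun th => rpow (Cmod (dir_sum a N (torsym c1 c (q1 :: q2 :: ps) th))) p) th) (/ p)
  <= Cst * hp_norm_poly p (dir_sum a N) + D / INR (2 * K + 1).
Proof.
move=> hu hp hre hc1 hc2 hal.
have [j [hj1 hj2]] := nfloor_ex p ltac:(lra).
have hj : (0 < j)%N.
  case: j hj1 hj2 => // _ h; exfalso; rewrite /= in h; lra.
have hJ := INR_gt0 j hj.
have hJ1 : 1 <= INR j by apply: (le_INR 1); apply/leP.
pose q := p / INR j.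
have eq1 : q * INR j = p by rewrite /q; field; lra.
have hq : 1 <= q < 2.
  split; first by apply: (Rmult_le_reg_r (INR j)); lra.
  by apply: (Rmult_lt_reg_r (INR j)); lra.
have [p0 [b0 [B [eps [w [v [[hb0 hB heps hg hp0] [hcoef hw hw0 hv hwv]]]]]]]] := weights_exist q hq.
pose ca := Cmod (c q1); pose cb := Cmod (c q2).
pose H := Cmod c1 + \rsum_(q <- q1 :: q2 :: ps) Cmod (c q) + 1.
have [Cst hCst hbound] := two_dim_bound ca cb H q b0 B eps hc1 hc2 hq hb0 hB heps hg.
exists (rpow Cst (/ p)); first exact: rpow_ge0.
move=> a N; exists (\rsum_(n <- iota 1 N) Cmod (a n) * ln (INR n)).
  rewrite big_seq; apply: rsum_ge0 => n; rewrite mem_iota => /andP[hn _].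
  by apply: Rmult_le_pos; [apply: Cmod_ge_0|apply: ln_INR_ge0].
set D := \rsum_(n <- _) _.
(* the [j]-th power of the Dirichlet polynomial, measured in [L^q] with [q = p / j < 2] *)
have [N' [A [hA eA]]] : dirichlet_poly (fun chi => Cpow (\csum_(n <- iota 1 N) Cmult (a n) (chi n)) j).
  apply: dp_pow; apply: (dp_sum _ _ (fun n chi => Cmult (a n) (chi n))) => n.
  by rewrite mem_iota => /andP[hn _]; apply: dp_scal; apply: dp_char.
(* The length is raised by one to be positive, as [wnorm_le_torus_mean] requires. *)
have hA' n : (N'.+1 < n)%N -> A n = RtoC 0 by move=> h; apply: hA; apply: ltnW.
have eA' chi : character chi -> \csum_(n <- iota 1 N'.+1) Cmult (A n) (chi n) =
    Cpow (\csum_(n <- iota 1 N) Cmult (a n) (chi n)) j.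
  by move=> hchi; rewrite -(dp_widen N' N'.+1) // eA.
have eF s : dir_sum A N'.+1 s = Cpow (dir_sum a N s) j.
  by rewrite !dir_sumE eA' //; apply: character_cpow.
pose l := [seq p <- iota 1 (N + N'.+1) | prime p].
have hl : prime_base l (N + N'.+1) by apply: prime_base_iota.
have hlN : prime_base l N by apply: prime_base_mono hl; apply: leq_addr.
have hlN' : prime_base l N'.+1 by apply: prime_base_mono hl; apply: leq_addl.
have [L [hL0 hL eL]] := hp_norm_torus a N l p hlN ltac:(lra).
have epow z : 0 <= z -> rpow (z ^ j) q = rpow z p.
  move=> hz; rewrite -{1}(prednK hj) -rpow_nat // rpow_rpow // prednK //.
  by congr rpow; rewrite -eq1; ring.
have hLq : torus_mean l (fun th => rpow (Cmod (dtorus A N'.+1 l th)) q) L.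
  move=> e he; have [K0 hK0] := hL e he; exists K0 => K al' th /(hK0 _ al' th).
  rewrite (avgs_ext _ _ _ (fun th => rpow (Cmod (dtorus A N'.+1 l th)) q)
     (fun th => rpow (Cmod (dtorus a N l th)) p)) // => th'.
  rewrite !dtorusE // eA'; last exact: character_ang.
  by rewrite Cmod_pow epow //; apply: Cmod_ge_0.
have hnorm := wnorm_le_torus_mean p0 q w A N'.+1 l L hcoef hp0 ltac:(lra) hw hw0 hlN' isT hA' hLq.
move=> K rest th; pose d := / INR (2 * K + 1).
have hM := grid_size_gt0 K; have hd0 : 0 < d by apply: Rinv_0_lt_compat.
have hd1 : d <= 1.
  rewrite /d -Rinv_1; apply: Rinv_le_contravar; first lra.
  by apply: (le_INR 1); apply/leP; rewrite addn1.
pose phi th := torsym c1 c (q1 :: q2 :: ps) th.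
have hphi th' : 1 / 2 <= Re (phi th').
  pose S := \rsum_(q <- q1 :: q2 :: ps) Cmod (c q).
  have h1 : 1 / 2 + S <= Re c1 by [].
  have h2 : Re c1 - S <= Re (phi th') by apply: torsym_Re_ge.
  lra.
pose ll := q1 :: q2 :: rest; pose E G := avgs K al ll G th.
have hE : positive_functional E by apply: avgs_pf.
pose G1 th := Cmod (dir_sum a N (Cplus (phi th) (RtoC d))).
have hG1 : E (fun th => rpow (G1 th) p) <= Cst * L.
  rewrite /E /ll /=.
  have hER := avgs_pf K al rest th.
  apply: Rle_trans (pf_le _ hER _ (fun=> Cst * L) _) _; last first.
    by rewrite (pf_const _ hER) avgs_1; lra.
  move=> th'; rewrite /avg1 /gmean.
  pose sg := Cplus (Cminus (torsym c1 c ps th') (RtoC (ca + cb))) (RtoC d).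
  have eG k1 k2 : rpow (G1 (upd (upd th' q2 (gpt K (al q2) k2)) q1 (gpt K (al q1) k1))) p =
      rpow (Cmod (dir_sum A N'.+1 (symbol2 ca cb sg (ug K k1) (ug K k2)))) q.
    rewrite eF Cmod_pow epow; last exact: Cmod_ge_0.
    congr (rpow (Cmod (dir_sum a N _)) p).
    rewrite /phi /gpt -/(ug K k1) -/(ug K k2) torsym_upd // /sg /symbol2 /ca /cb; ring.
  rewrite (eq_bigr (fun k2 => / INR (2 * K + 1) * \rsum_(k1 <- iota 0 (2 * K + 1))
      rpow (Cmod (dir_sum A N'.+1 (symbol2 ca cb sg (ug K k1) (ug K k2)))) q)); last first.
    by move=> k2 _; congr Rmult; apply: eq_bigr => k1 _.
  apply: Rle_trans (hbound K d sg A N'.+1 l w v hlN' hw hv hwv _ _ _) _.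
  - by lra.
  - by rewrite /d Rinv_r; lra.
  - have e1 : Re sg = Re (torsym c1 c ps th') - (ca + cb) + d by rewrite /sg /Re /=; ring.
    pose S := \rsum_(q <- ps) Cmod (c q).
    have hreS : 1 / 2 + (ca + (cb + S)) <= Re c1 by move: hre; rewrite !big_cons.
    have eH : H = Cmod c1 + (ca + (cb + S)) + 1 by rewrite /H !big_cons.
    have h1 : Re c1 - S <= Re (torsym c1 c ps th') by apply: torsym_Re_ge.
    have h2 : Re (torsym c1 c ps th') <= Cmod c1 + S.
      apply: Rle_trans (Rle_abs _) _; apply: Rle_trans (re_le_Cmod _) _.
      by apply: linsym_bound => i _; rewrite Cmod_cis; lra.
    have hca : 0 < ca by []; have hcb : 0 < cb by [].
    by rewrite e1 eH; lra.
  by apply: Rmult_le_compat_l; lra.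
have hG th' : Cmod (dir_sum a N (phi th')) <= G1 th' + d * D.
  have := dir_sum_lipschitz a N (phi th') d ltac:(have := hphi th'; lra) (Rlt_le _ _ hd0).
  by rewrite -/D -/(G1 th') => h; have := Rle_abs (Cmod (dir_sum a N (phi th')) - G1 th'); lra.
have hD : 0 <= D.
  rewrite /D big_seq; apply: rsum_ge0 => n; rewrite mem_iota => /andP[hn _].
  by apply: Rmult_le_pos; [apply: Cmod_ge_0|apply: ln_INR_ge0].
have hdD : 0 <= d * D by apply: Rmult_le_pos; lra.
have hip : 0 <= / p by apply/Rlt_le/Rinv_0_lt_compat; lra.
have hG10 th' : 0 <= G1 th' by apply: Cmod_ge_0.
apply: Rle_trans (_ : rpow (E (fun th => rpow (G1 th + d * D) p)) (/ p) <= _).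
  apply: rpow_le => //; first by apply: (pf_ge0 E hE) => th'; apply: rpow_ge0.
  apply: (pf_le E hE) => th'; apply: rpow_le; [lra|exact: Cmod_ge_0|exact: hG].
apply: Rle_trans (pf_minkowski E hE G1 (fun=> d * D) p hp hG10 (fun=> hdD)) _.
apply: Rplus_le_compat.
  rewrite eL // -rpowM //; last lra.
  by apply: rpow_le => //; apply: (pf_ge0 E hE) => th'; apply: rpow_ge0.
rewrite (pf_const E hE) /E avgs_1 Rmult_1_r rpow_root //; last lra.
by rewrite /d; apply: Req_le; rewrite /Rdiv; ring.
Qed.

(** * Approximation of composed Dirichlet polynomials *)

Lemma Cpow_sub_le n (z w : C) m : 1 <= m -> Cmod z <= m -> Cmod w <= m ->
  Cmod (Cminus (Cpow z n) (Cpow w n)) <= INR n * m ^ n * Cmod (Cminus z w).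
Proof.
move=> hm hz hw; have h0 := Cmod_ge_0 (Cminus z w).
elim: n => [|n IH].
  have -> : Cminus (Cpow z 0) (Cpow w 0) = RtoC 0 by rewrite /=; ring.
  by rewrite Cmod_0 !Rmult_0_l; apply: Rle_refl.
have -> : Cminus (Cpow z n.+1) (Cpow w n.+1) =
  Cplus (Cmult z (Cminus (Cpow z n) (Cpow w n))) (Cmult (Cminus z w) (Cpow w n)) by rewrite /=; ring.
apply: Rle_trans (Cmod_triangle _ _) _; rewrite !Cmod_mult Cmod_pow S_INR.
have hmn : 1 <= m ^ n by apply: pow_R1_Rle.
have h1 : Cmod w ^ n <= m ^ n by apply: pow_incr; split => //; apply: Cmod_ge_0.
have hX0 : 0 <= INR n * m ^ n * Cmod (Cminus z w).
  by apply: Rmult_le_pos => //; apply: Rmult_le_pos; [apply: pos_INR|lra].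
have h2 : Cmod z * Cmod (Cminus (Cpow z n) (Cpow w n)) <= m * (INR n * m ^ n * Cmod (Cminus z w)).
  by apply: Rmult_le_compat => //; apply: Cmod_ge_0.
have h3 : Cmod (Cminus z w) * Cmod w ^ n <= Cmod (Cminus z w) * m ^ n by apply: Rmult_le_compat_l.
have h4 : Cmod (Cminus z w) * m ^ n <= m * (Cmod (Cminus z w) * m ^ n).
  have : 0 <= Cmod (Cminus z w) * m ^ n by apply: Rmult_le_pos; lra.
  nra.
rewrite -[m ^ n.+1]/(m * m ^ n); lra.
Qed.

(** Both terms are [n]-th powers, of [1 + z/n] and of [exp (z/n)]. These differ by [O(1/n^2)], so
    their powers differ by [O(1/n)], uniformly on the disc. *)
Lemma cexp_pow_approx R0 eps : 0 <= R0 -> 0 < eps -> exists n, forall z, Cmod z <= R0 ->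
  Cmod (Cminus (Cpow (Cplus 1 (Cmult (RtoC (/ INR n)) z)) n) (cexp z)) <= eps.
Proof.
move=> hR he; pose T := 6 * exp (2 * R0) * R0 ^ 2.
have hT : 0 <= T by apply: Rmult_le_pos; [have := exp_pos (2 * R0); lra|apply: pow2_ge_0].
have [n0 hn0] := INR_unbounded (T / eps).
exists n0.+1 => z hz; set n := n0.+1; have hn := INR_gt0 n isT.
have hn1 : 1 <= INR n by apply: (le_INR 1); apply/leP.
have hni := Rinv_0_lt_compat _ hn.
set w := Cmult (RtoC (/ INR n)) z.
have hw : Cmod w <= R0 / INR n.
  rewrite /w Cmod_mult Cmod_R Rabs_pos_eq; last lra.
  by rewrite Rmult_comm; apply: Rmult_le_compat_r; lra.
have hRn : 0 <= R0 / INR n by apply: Rdiv_le_0_compat.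
have hew : cexp z = Cpow (cexp w) n.
  have ez k : Cpow (cexp w) k = cexp (Cmult (RtoC (INR k)) w).
    elim: k => [|k IH]; first by rewrite /= Cmult_0_l cexp_0.
    rewrite -[Cpow _ k.+1]/(Cmult (cexp w) (Cpow (cexp w) k)) IH -cexpD S_INR RtoC_plus.
    by congr cexp; ring.
  rewrite ez; congr cexp; rewrite /w Cmult_assoc -RtoC_mult Rinv_r; last lra.
  by rewrite Cmult_1_l.
have hre : Re w <= R0 / INR n by apply: Rle_trans (Rle_abs _) _; apply: Rle_trans (re_le_Cmod _) hw.
have h1 := cexp_taylor w (R0 / INR n) (Rmax_lub _ _ _ hRn hre).
set m := exp (R0 / INR n) in h1.
have hm1 : 1 + R0 / INR n <= m by apply: exp_ineq1_le.
have hmn k : m ^ k = exp (INR k * (R0 / INR n)).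
  elim: k => [|k IH]; first by rewrite /= Rmult_0_l exp_0.
  by rewrite S_INR Rmult_plus_distr_r Rmult_1_l exp_plus -IH -/m -tech_pow_Rmult; ring.
rewrite hew.
apply: Rle_trans (Cpow_sub_le n _ _ m _ _ _) _; first lra.
- by apply: Rle_trans (Cmod_triangle _ _) _; rewrite Cmod_1; lra.
- by rewrite Cmod_cexp; apply: exp_le_mono.
have -> : Cmod (Cminus (Cplus 1 w) (cexp w)) = Cmod (Cminus (Cminus (cexp w) 1) w).
  by rewrite -Cmod_opp; congr Cmod; ring.
have hmm : m ^ n = exp R0 by rewrite hmn; congr exp; field; lra.
have h2 : Cmod w ^ 2 <= (R0 / INR n) ^ 2 by apply: pow_incr; split => //; apply: Cmod_ge_0.
have h3 : m <= exp R0.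
  apply: exp_le_mono; apply: (Rmult_le_reg_r (INR n)) => //.
  by rewrite /Rdiv Rmult_assoc Rinv_l; nra.
have h4 : Cmod (Cminus (Cminus (cexp w) 1) w) <= 6 * exp R0 * (R0 / INR n) ^ 2.
  apply: Rle_trans h1 _; apply: Rmult_le_compat => //; [have := exp_pos (R0 / INR n); rewrite -/m; lra|exact: pow2_ge_0|lra].
rewrite hmm.
apply: Rle_trans (_ : INR n * exp R0 * (6 * exp R0 * (R0 / INR n) ^ 2) <= _).
  by apply: Rmult_le_compat_l => //; apply: Rmult_le_pos; [lra|apply/Rlt_le/exp_pos].
have -> : INR n * exp R0 * (6 * exp R0 * (R0 / INR n) ^ 2) = T / INR n.
  by rewrite /T (_ : 2 * R0 = R0 + R0) ?exp_plus; [field; lra|ring].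
apply: (Rmult_le_reg_r (INR n)) => //.
have -> : T / INR n * INR n = T by field; lra.
have : T / eps < INR n by rewrite /n S_INR; lra.
move/(Rmult_lt_compat_r eps _ _ he).
have -> : T / eps * eps = T by field; lra.
lra.
Qed.

(** Writing [n^(-phi)] as [exp (- ln n * phi)] and the exponential as a power keeps the
    approximation among Dirichlet polynomials. As it holds for all characters bounded by 1 on [ps],
    one [G] serves both the half-plane [Re s >= 0] and the polytorus. *)
Lemma comp_approx c1 c ps a N eps : all prime ps -> 0 < eps ->
  exists2 G, dirichlet_poly G & forall chi, character chi -> (forall q, q \in ps -> Cmod (chi q) <= 1) ->
    Cmod (Cminus (G chi) (dir_sum a N (linsym c1 c ps chi))) <= eps.
Proof.
move=> pps he; pose Bp := Cmod c1 + \rsum_(q <- ps) Cmod (c q).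
have hBp : 0 <= Bp.
  have : 0 <= \rsum_(q <- ps) Cmod (c q) by apply: rsum_ge0 => q _; apply: Cmod_ge_0.
  by rewrite /Bp; have := Cmod_ge_0 c1; lra.
pose S := \rsum_(n <- iota 1 N) ln (INR n).
have hS n : n \in iota 1 N -> ln (INR n) <= S.
  move=> hn; apply: (rsum_term_le _ _ (fun n => ln (INR n))) => // i; rewrite mem_iota => /andP[hi _].
  exact: ln_INR_ge0.
have hS0 : 0 <= S.
  by rewrite /S big_seq; apply: rsum_ge0 => n; rewrite mem_iota => /andP[hn _]; apply: ln_INR_ge0.
pose Sa := \rsum_(n <- iota 1 N) Cmod (a n).
have hSa : 0 <= Sa by apply: rsum_ge0 => n _; apply: Cmod_ge_0.
have [m hm] := cexp_pow_approx (S * Bp) (eps / (Sa + 1)) ltac:(exact: Rmult_le_pos) ltac:(apply: Rdiv_lt_0_compat; lra).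
exists (fun chi => \csum_(n <- iota 1 N) Cmult (a n) (Cpow (Cplus 1 (Cmult (RtoC (/ INR m))
    (Cmult (RtoC (- ln (INR n))) (linsym c1 c ps chi)))) m)).
  apply: (dp_sum _ _ (fun n chi => Cmult (a n) (Cpow (Cplus 1 (Cmult (RtoC (/ INR m))
    (Cmult (RtoC (- ln (INR n))) (linsym c1 c ps chi)))) m))) => n _.
  apply: dp_scal; apply: dp_pow; apply: dp_add; first exact: dp_const.
  by apply: dp_scal; apply: dp_scal; apply: linsym_dp.
move=> chi hchi hle; have hb := linsym_bound c1 c ps chi hle; rewrite -/Bp in hb.
set s := linsym _ _ _ _ in hb *.
have -> : Cminus (\csum_(n <- iota 1 N) Cmult (a n) (Cpow (Cplus 1 (Cmult (RtoC (/ INR m))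
    (Cmult (RtoC (- ln (INR n))) s))) m)) (dir_sum a N s) =
  \csum_(n <- iota 1 N) Cmult (a n) (Cminus (Cpow (Cplus 1 (Cmult (RtoC (/ INR m))
    (Cmult (RtoC (- ln (INR n))) s))) m) (cexp (Cmult (RtoC (- ln (INR n))) s))).
  rewrite dir_sumE [RHS](eq_bigr (fun n => Cplus (Cmult (a n) (Cpow (Cplus 1 (Cmult (RtoC (/ INR m))
    (Cmult (RtoC (- ln (INR n))) s))) m)) (Cmult (RtoC (-1)) (Cmult (a n) (cpow_neg n s))))).
    by rewrite big_split -big_distrr /=; ring.
  by move=> n _; rewrite cpow_neg_cexp; ring.
apply: Rle_trans (Cmod_csum _ _ _) _.
apply: Rle_trans (_ : \rsum_(n <- iota 1 N) Cmod (a n) * (eps / (Sa + 1)) <= _).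
  apply: rsum_le_seq => n hn; rewrite Cmod_mult; apply: Rmult_le_compat_l; first exact: Cmod_ge_0.
  apply: hm; rewrite Cmod_mult Cmod_R Rabs_Ropp Rabs_pos_eq; last first.
    by apply: ln_INR_ge0; move: hn; rewrite mem_iota => /andP[].
  apply: Rmult_le_compat => //; [|exact: Cmod_ge_0|exact: hS].
  by apply: ln_INR_ge0; move: hn; rewrite mem_iota => /andP[].
rewrite -big_distrl /= -/Sa; have he2 : 0 < eps / (Sa + 1) by apply: Rdiv_lt_0_compat; lra.
have : (Sa + 1) * (eps / (Sa + 1)) = eps by field; lra.
nra.
Qed.

Lemma torus_mean_lim l H L al th q : 0 < q -> torus_mean l H L ->
  is_lim_seq (fun K => rpow (avgs K al l H th) q) (rpow L q).
Proof.
move=> hq h; apply: (is_lim_seq_continuous (fun u => rpow u q)).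
  by apply/continuity_pt_filterlim; apply: continuous_rpow.
apply/is_lim_seq_spec => e; have [K0 hK0] := h e (cond_pos e).
by exists K0 => K /leP hK; apply: hK0.
Qed.

Lemma lim_inv_grid D : 0 <= D -> is_lim_seq (fun K => D / INR (2 * K + 1)) 0.
Proof.
move=> hD; apply/is_lim_seq_spec => e; have he := cond_pos e.
have [K0 hK0] := INR_unbounded (D / e); exists K0 => K /leP hK.
have hM := grid_size_gt0 K.
rewrite Rminus_0_r Rabs_pos_eq; last exact: Rdiv_le_0_compat.
have h1 : D / e < INR (2 * K + 1).
  by apply: Rlt_le_trans hK0 _; apply/le_INR/leP; lia.
have h2 := Rmult_lt_compat_r e _ _ he h1.
have e1 : D / e * e = D by field; lra.
apply: (Rmult_lt_reg_r (INR (2 * K + 1))) => //.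
have -> : D / INR (2 * K + 1) * INR (2 * K + 1) = D by field; lra.
lra.
Qed.

Lemma hp_norm_lim a N l p P al th : prime_base l N -> 0 < p -> (forall s, P s = dir_sum a N s) ->
  is_lim_seq (fun K => rpow (avgs K al l (fun th => rpow (Cmod (dtorus a N l th)) p) th) (/ p)) (hp_norm_poly p P).
Proof.
move=> hb hp eP; have [L [_ hL ->]] := hp_norm_torus a N l p hb hp => //.
by apply: torus_mean_lim hL; apply: Rinv_0_lt_compat.
Qed.

Lemma is_dirpolyP P : is_dirpoly P <-> exists2 G, dirichlet_poly G & forall s, P s = G (fun n => cpow_neg n s).
Proof.
split=> [[N [a eP]]|[G [N [a [_ eG]]] eP]].
  exists (fun chi => \csum_(n <- iota 1 N) Cmult (a n) (chi n)).
    apply: (dp_sum _ _ (fun n chi => Cmult (a n) (chi n))) => n.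
    by rewrite mem_iota => /andP[hn _]; apply: dp_scal; apply: dp_char.
  by move=> s; rewrite eP dir_sumE.
by exists N, a => s; rewrite eP dir_sumE eG //; apply: character_cpow.
Qed.

Lemma dp_sub G H : dirichlet_poly G -> dirichlet_poly H -> dirichlet_poly (fun chi => Cminus (G chi) (H chi)).
Proof.
move=> hG hH; apply: (dp_ext (fun chi => Cplus (G chi) (Cmult (RtoC (-1)) (H chi)))).
  by move=> chi _; ring.
by apply: dp_add => //; apply: dp_scal.
Qed.

Lemma is_dirpoly_sub P Q : is_dirpoly P -> is_dirpoly Q -> is_dirpoly (fun s => Cminus (P s) (Q s)).
Proof.
move=> /is_dirpolyP[G hG eP] /is_dirpolyP[H hH eQ]; apply/is_dirpolyP.
by exists (fun chi => Cminus (G chi) (H chi)); [apply: dp_sub|move=> s; rewrite eP eQ].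
Qed.

(** Minkowski on grids, passed to the limit; it makes the norms of a Cauchy sequence of Dirichlet
    polynomials converge. *)
Lemma hp_norm_triangle p P Q : 1 <= p -> is_dirpoly P -> is_dirpoly Q ->
  hp_norm_poly p P <= hp_norm_poly p Q + hp_norm_poly p (fun s => Cminus (P s) (Q s)).
Proof.
move=> hp /is_dirpolyP[G [N [a [ha eG]]] eP] /is_dirpolyP[H [M [b [hb eH]]] eQ].
pose L := maxn N M; pose l := [seq q <- iota 1 L | prime q].
have hl : prime_base l L := prime_base_iota L.
have eG' chi : character chi -> G chi = \csum_(n <- iota 1 L) Cmult (a n) (chi n).
  by move=> hchi; rewrite eG // (dp_widen N L) ?leq_maxl.
have eH' chi : character chi -> H chi = \csum_(n <- iota 1 L) Cmult (b n) (chi n).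
  by move=> hchi; rewrite eH // (dp_widen M L) ?leq_maxr.
pose dab n := Cminus (a n) (b n).
have eab (chi : nat -> C) : \csum_(n <- iota 1 L) Cmult (a n) (chi n) =
    Cplus (\csum_(n <- iota 1 L) Cmult (b n) (chi n)) (\csum_(n <- iota 1 L) Cmult (dab n) (chi n)).
  by rewrite -big_split /=; apply: eq_bigr => n _; rewrite /dab; ring.
have e1 s : P s = dir_sum a L s by rewrite dir_sumE eP eG' //; apply: character_cpow.
have e2 s : Q s = dir_sum b L s by rewrite dir_sumE eQ eH' //; apply: character_cpow.
have e3 s : Cminus (P s) (Q s) = dir_sum dab L s by rewrite e1 e2 !dir_sumE eab; ring.
have hp0 : 0 < p by lra.
have hip : 0 <= / p by apply/Rlt_le/Rinv_0_lt_compat.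
have lim1 := hp_norm_lim a L l p P (fun=> 0) (fun=> 0) hl hp0 e1.
have lim2 := hp_norm_lim b L l p Q (fun=> 0) (fun=> 0) hl hp0 e2.
have lim3 := hp_norm_lim dab L l p _ (fun=> 0) (fun=> 0) hl hp0 e3.
apply: (is_lim_seq_le _ _ _ _ _ lim1 (is_lim_seq_plus' _ _ _ _ lim2 lim3)) => K.
have hE := avgs_pf K (fun=> 0) l (fun=> 0).
apply: Rle_trans (pf_minkowski _ hE (fun th => Cmod (dtorus b L l th)) (fun th => Cmod (dtorus dab L l th)) p hp
  (fun=> Cmod_ge_0 _) (fun=> Cmod_ge_0 _)).
apply: rpow_le => //; first by apply: (pf_ge0 _ hE) => th; apply: rpow_ge0.
apply: (pf_le _ hE) => th; apply: rpow_le; [lra|exact: Cmod_ge_0|].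
by rewrite !dtorusE // eab; apply: Cmod_triangle.
Qed.

Lemma linsym_ang l th c1 c ps : uniq l -> all prime l -> (forall q, q \in ps -> q \in l) ->
  linsym c1 c ps (fun n => cis (ang l th n)) = torsym c1 c ps th.
Proof.
by move=> ul pl h; congr Cplus; apply: eq_big_seq => q /h hq; rewrite ang_prime.
Qed.

(** Grid means of [G] converge to its norm, while those of [P] composed with the symbol obey
    [comp_norm_bound]. Minkowski carries the error [e] across, and the term with [D] vanishes as [K]
    grows. *)
Lemma comp_norm_approx c1 c q1 q2 ps p : uniq (q1 :: q2 :: ps) -> all prime (q1 :: q2 :: ps) -> 1 <= p ->
  1 / 2 + \rsum_(q <- q1 :: q2 :: ps) Cmod (c q) <= Re c1 ->
  0 < Cmod (c q1) -> 0 < Cmod (c q2) ->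
  exists2 Cst, 0 <= Cst & forall P G e, is_dirpoly P -> dirichlet_poly G -> 0 <= e ->
  (forall chi, character chi -> (forall q, q \in q1 :: q2 :: ps -> Cmod (chi q) <= 1) ->
    Cmod (Cminus (G chi) (P (linsym c1 c (q1 :: q2 :: ps) chi))) <= e) ->
  hp_norm_poly p (fun s => G (fun n => cpow_neg n s)) <= Cst * hp_norm_poly p P + e.
Proof.
move=> hu hpr hp hre hc1 hc2.
have [al hal] := exists_angles c.
have [Cst hC hb] := comp_norm_bound c1 c q1 q2 ps p al hu hp hre hc1 hc2 hal.
exists Cst => // P G e [N [a eP]] [M [g [hg eG]]] he happ.
have [D hD hK] := hb a N.
have hp0 : 0 < p by lra.
have hip : 0 <= / p by apply/Rlt_le/Rinv_0_lt_compat.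
have -> : hp_norm_poly p P = hp_norm_poly p (dir_sum a N).
  have [L [_ _ eL]] := hp_norm_torus a N _ p (prime_base_iota N) hp0.
  by rewrite !eL.
set ps0 := q1 :: q2 :: ps in hu hpr hre happ hK *.
(* The two critical primes must head the list, because its head is averaged innermost; the remaining
   primes cover those of [G] and of the symbol. *)
pose rest := [seq q <- undup (ps ++ [seq q <- iota 1 M | prime q]) | (q != q1) && (q != q2)].
pose l := q1 :: q2 :: rest.
have hin q : (q \in l) = (q \in ps0) || (q \in [seq q <- iota 1 M | prime q]).
  rewrite !inE mem_filter mem_undup mem_cat.
  by case: (q == q1) => //; case: (q == q2).
have hl : prime_base l M.
  split.
  - rewrite !cons_uniq inE negb_or !mem_filter !eqxx /= andbF /= filter_uniq ?undup_uniq ?andbT //.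
    by move: hu; rewrite !cons_uniq inE negb_or => /andP[/andP[]].
  - apply/allP => q; rewrite hin => /orP[/(allP hpr)//|]; by rewrite mem_filter => /andP[].
  move=> n hn; have [_ _ h] := prime_base_iota M; apply/allP => q /(allP (h n hn)) hq.
  by change (q \in l); rewrite hin hq orbT.
have [ul pl _] := hl.
have eGd s : G (fun n => cpow_neg n s) = dir_sum g M s.
  by rewrite dir_sumE eG //; apply: character_cpow.
have lim1 := hp_norm_lim g M l p _ al (fun=> 0) hl hp0 eGd.
have lim2 : is_lim_seq (fun K => (Cst * hp_norm_poly p (dir_sum a N) + D / INR (2 * K + 1)) + e)
    (Cst * hp_norm_poly p (dir_sum a N) + 0 + e).
  apply: is_lim_seq_plus'; last exact: is_lim_seq_const.
  by apply: is_lim_seq_plus'; [exact: is_lim_seq_const|exact: lim_inv_grid].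
rewrite Rplus_0_r in lim2.
apply: (is_lim_seq_le _ _ _ _ _ lim1 lim2) => K.
have hE := avgs_pf K al l (fun=> 0).
apply: Rle_trans (_ : rpow (avgs K al l (fun th => rpow (Cmod (dir_sum a N (torsym c1 c ps0 th)) + e) p) (fun=> 0)) (/ p) <= _).
  apply: rpow_le => //; first by apply: (pf_ge0 _ hE) => th; apply: rpow_ge0.
  apply: (pf_le _ hE) => th; apply: rpow_le; [lra|exact: Cmod_ge_0|].
  have hch := character_ang l th.
  have := happ _ hch (fun q _ => Req_le _ _ (Cmod_cis _)).
  rewrite linsym_ang //; last by move=> q hq; rewrite hin hq.
  rewrite eP eG // -dtorusE //; set z := dtorus _ _ _ _; set w := dir_sum _ _ _ => h.
  have ez : z = Cplus w (Cminus z w) by ring.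
  rewrite [in X in X <= _]ez; have := Cmod_triangle w (Cminus z w); lra.
apply: Rle_trans (pf_minkowski _ hE (fun th => Cmod (dir_sum a N (torsym c1 c ps0 th))) (fun=> e) p hp
  (fun=> Cmod_ge_0 _) (fun=> he)) _.
apply: Rplus_le_compat; first exact: hK.
rewrite (pf_const _ hE) avgs_1 Rmult_1_r rpow_root //; lra.
Qed.

(** The norm estimate is also applied to [G k - G m] against [P k - P m], so the approximants of the
    compositions form a Cauchy sequence. They converge pointwise to [f (phi s)], since the symbol
    maps the half-plane [Re s > 1/2] into itself. *)
Lemma linsym_comp_bounded c1 c q1 q2 ps p phi : uniq (q1 :: q2 :: ps) -> all prime (q1 :: q2 :: ps) -> 1 <= p ->
  1 / 2 + \rsum_(q <- q1 :: q2 :: ps) Cmod (c q) <= Re c1 ->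
  0 < Cmod (c q1) -> 0 < Cmod (c q2) ->
  (forall s, phi s = linsym c1 c (q1 :: q2 :: ps) (fun n => cpow_neg n s)) ->
  (forall s, 1 / 2 < Re s -> 1 / 2 < Re (phi s)) ->
  comp_bounded_Hp p phi.
Proof.
move=> hu hpr hp hre hc1 hc2 ephi hphi.
have [Cst hC happ] := comp_norm_approx c1 c q1 q2 ps p hu hpr hp hre hc1 hc2.
set ps0 := q1 :: q2 :: ps in hu hpr hre ephi happ.
exists Cst => f r [P [hP [hcau [hpt hlim]]]].
(* A positive null sequence of approximation errors, in the form covered by [lim_inv_grid]. *)
pose e k := 1 / INR (2 * k + 1).
have he k : 0 < e k by apply: Rdiv_lt_0_compat; [lra|exact: grid_size_gt0].
have le0 : is_lim_seq e 0 by apply: lim_inv_grid; lra.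
have hG k : exists G, dirichlet_poly G /\ forall chi, character chi -> (forall q, q \in ps0 -> Cmod (chi q) <= 1) ->
    Cmod (Cminus (G chi) (P k (linsym c1 c ps0 chi))) <= e k.
  have [N [a eP]] := hP k; have [G h1 h2] := comp_approx c1 c ps0 a N (e k) hpr (he k).
  by exists G; split => // chi hchi hle; rewrite eP; apply: h2.
have [G hGk] : exists G, forall k, dirichlet_poly (G k) /\ forall chi, character chi ->
    (forall q, q \in ps0 -> Cmod (chi q) <= 1) -> Cmod (Cminus (G k chi) (P k (linsym c1 c ps0 chi))) <= e k.
  have g k := ClassicalEpsilon.constructive_indefinite_description _ (hG k).
  by exists (fun k => proj1_sig (g k)) => k; apply: (proj2_sig (g k)).
have dG k : dirichlet_poly (G k) by case: (hGk k).
have aG k chi : character chi -> (forall q, q \in ps0 -> Cmod (chi q) <= 1) ->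
    Cmod (Cminus (G k chi) (P k (linsym c1 c ps0 chi))) <= e k.
  by have [_] := hGk k; apply.
pose Q k s := G k (fun n => cpow_neg n s).
have hQ k : is_dirpoly (Q k) by apply/is_dirpolyP; exists (G k).
have hQd k m : hp_norm_poly p (fun s => Cminus (Q k s) (Q m s)) <=
    Cst * hp_norm_poly p (fun s => Cminus (P k s) (P m s)) + (e k + e m).
  apply: (happ _ (fun chi => Cminus (G k chi) (G m chi))).
  - exact: is_dirpoly_sub.
  - exact: dp_sub.
  - by have := he k; have := he m; lra.
  move=> chi hchi hle; have h1 := aG k chi hchi hle; have h2 := aG m chi hchi hle.
  set w := linsym _ _ _ _ in h1 h2 *.
  have -> : Cminus (Cminus (G k chi) (G m chi)) (Cminus (P k w) (P m w)) =
     Cplus (Cminus (G k chi) (P k w)) (Copp (Cminus (G m chi) (P m w))) by ring.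
  by apply: Rle_trans (Cmod_triangle _ _) _; rewrite Cmod_opp; lra.
have hQ1 k : hp_norm_poly p (Q k) <= Cst * hp_norm_poly p (P k) + e k.
  by apply: happ => //; [have := he k; lra|exact: aG].
have hQc eps : 0 < eps -> exists K : nat, forall k m : nat, (K <= k)%coq_nat -> (K <= m)%coq_nat ->
    hp_norm_poly p (fun s => Cminus (Q k s) (Q m s)) < eps.
  move=> heps.
  have h1 : 0 < eps / (2 * (Cst + 1)) by apply: Rdiv_lt_0_compat; lra.
  have h2 : 0 < eps / 4 by lra.
  have [K1 hK1] := hcau _ h1.
  have [K2 hK2] := proj2 (is_lim_seq_spec _ _) le0 (mkposreal _ h2).
  exists (maxn K1 K2) => k m /leP; rewrite geq_max => /andP[/leP k1 /leP k2] /leP.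
  rewrite geq_max => /andP[/leP m1 /leP m2].
  apply: Rle_lt_trans (hQd k m) _.
  have h3 := hK1 k m k1 m1.
  have h4 := hK2 k k2; have h5 := hK2 m m2.
  move: h4 h5; rewrite /= !Rminus_0_r => /Rabs_def2 h4 /Rabs_def2 h5.
  have h6 := Rmult_le_compat_l _ _ _ hC (Rlt_le _ _ h3).
  have h7 : (Cst + 1) * (eps / (2 * (Cst + 1))) = eps / 2 by field; lra.
  lra.
have [r' hr'] : ex_finite_lim_seq (fun k => hp_norm_poly p (Q k)).
  apply/ex_lim_seq_cauchy_corr => eps; have [K hK] := hQc eps (cond_pos eps).
  exists K => k m hk hm.
  have h1 := hp_norm_triangle p (Q k) (Q m) hp (hQ k) (hQ m).
  have h2 := hp_norm_triangle p (Q m) (Q k) hp (hQ m) (hQ k).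
  have h3 := hK k m hk hm; have h4 := hK m k hm hk.
  by apply: Rabs_def1; lra.
exists r'; split; last first.
  have h : is_lim_seq (fun k => Cst * hp_norm_poly p (P k) + e k) (Cst * r + 0).
    by apply: is_lim_seq_plus' => //; apply: (is_lim_seq_scal_l _ Cst r).
  by have := is_lim_seq_le _ _ _ _ hQ1 hr' h; rewrite /= Rplus_0_r.
exists Q; split => //; split => //; split => // s hs.
apply/filterlim_locally => eps.
have he2 : 0 < eps / 2 by have := cond_pos eps; lra.
have [K1 hK1] := proj1 (filterlim_locally _ _) (hpt (phi s) (hphi s hs)) (mkposreal _ he2).
have [K2 hK2] := proj2 (is_lim_seq_spec _ _) le0 (mkposreal _ he2).
exists (maxn K1 K2) => k /leP; rewrite geq_max => /andP[/leP k1 /leP k2].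
have -> : pos eps = eps / 2 + eps / 2 by lra.
apply: ball_triangle (hK1 k k1) _.
have hcl : forall q, q \in ps0 -> Cmod (cpow_neg q s) <= 1.
  by move=> q /(allP hpr) hq; apply: Cmod_cpow_le1; [exact: prime_gt0|lra].
have h := aG k _ (character_cpow s) hcl; rewrite -ephi in h.
apply: (@norm_compat1 C_AbsRing C_NormedModule); apply: Rle_lt_trans h _.
by have := hK2 k k2; rewrite /= Rminus_0_r => /Rabs_def2 [].
Qed.

(** * The enumeration of the primes and the final assembly *)

Lemma next_primeP m : (m < next_prime m)%N && prime (next_prime m).
Proof. by rewrite /next_prime; case: ex_minnP. Qed.

Lemma nth_prime_mono : {mono nth_prime : i j / (i <= j)%N}.
Proof.
apply: leq_mono; apply: homo_ltn ltn_trans _ => i.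
by have /andP[] := next_primeP (nth_prime i).
Qed.

Lemma prime_nth_prime j : (0 < j)%N -> prime (nth_prime j).
Proof. by case: j => // j _; have /andP[] := next_primeP (nth_prime j). Qed.

Lemma nth_primes_uniq d : uniq [seq nth_prime j | j <- iota 1 d].
Proof. by rewrite map_inj_uniq ?iota_uniq //; apply: incn_inj nth_prime_mono. Qed.

Lemma nth_primes_prime d : all prime [seq nth_prime j | j <- iota 1 d].
Proof.
by apply/allP => q /mapP[j]; rewrite mem_iota => /andP[hj _] ->; apply: prime_nth_prime.
Qed.

Lemma sum_nth_primeE (F : nat -> C) d :
  sum_n_m (fun j => F (nth_prime j)) 1 d = \csum_(q <- [seq nth_prime j | j <- iota 1 d]) F q.
Proof.
rewrite big_map; elim: d => [|d IH]; first by rewrite big_nil sum_n_m_zero //; apply/ltP.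
rewrite -{2}(addn1 d) iotaD big_cat big_seq1 -IH sum_n_Sm; last by apply/leP.
by rewrite add1n.
Qed.

Lemma in_GH_class_ext phi psi : (forall s, phi s = psi s) -> in_GH_class phi -> in_GH_class psi.
Proof.
by move=> e [c0 [c [phi0 [h1 h2]]]]; exists c0, c, phi0; split => // s hs; rewrite -e h1.
Qed.

Lemma GH_prime_symbol_comp_bounded (d : nat) (c : nat -> C) (phi : C -> C) p : (2 <= d)%N ->
  (forall s, phi s = Cplus (c 1%N) (sum_n_m (fun j => Cmult (c (nth_prime j)) (cpow_neg (nth_prime j) s)) 1 d)) ->
  in_GH_class phi -> (forall j, (1 <= j <= 2)%N -> c (nth_prime j) <> RtoC 0) -> 1 <= p ->
  comp_bounded_Hp p phi.
Proof.
move=> hd ephi hG hc hp; pose ps := [seq nth_prime j | j <- iota 1 d].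
have hu : uniq ps := nth_primes_uniq d.
have hpr : all prime ps := nth_primes_prime d.
have esym s : phi s = linsym (c 1%N) c ps (fun n => cpow_neg n s).
  by rewrite ephi (sum_nth_primeE (fun q => Cmult (c q) (cpow_neg q s))).
have hG' := in_GH_class_ext _ _ esym hG.
have hext := GH_linsym_extremal (c 1%N) c ps hpr hG'.
have hhalf := GH_linsym_halfplane (c 1%N) c ps hpr hG'.
have [rest eps] : exists rest, ps = nth_prime 1 :: nth_prime 2 :: rest.
  by rewrite /ps; case: d hd {ephi ps hu hpr esym hG' hext hhalf} => [|[|d]] // _; eexists.
rewrite eps in hu hpr esym hext hhalf.
apply: (linsym_comp_bounded (c 1%N) c (nth_prime 1) (nth_prime 2) rest) => //.
- by apply/Cmod_gt_0; apply: hc.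
- by apply/Cmod_gt_0; apply: hc.
by move=> s hs; rewrite esym; apply: hhalf; lra.
Qed.

End Hardy.

Theorem theorem1p2 (d : nat) (c : nat -> C) :
  (2 <= d)%nat ->
  in_GH_class (fun s => Cplus (c 1%nat)
                 (sum_n_m (fun j => Cmult (c (nth_prime j)) (cpow_neg (nth_prime j) s)) 1 d)) ->
  (forall j : nat, (1 <= j <= d)%nat -> c (nth_prime j) <> RtoC 0) ->
  forall p : R, 1 <= p ->
    comp_bounded_Hp p (fun s => Cplus (c 1%nat)
                 (sum_n_m (fun j => Cmult (c (nth_prime j)) (cpow_neg (nth_prime j) s)) 1 d)).
Proof.
intros hd hG hc p hp.
apply (Hardy.GH_prime_symbol_comp_bounded d c); auto.
- now apply ssrbool.introT with (1 := @ssrnat.leP 2 d).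
- intros j hj; apply hc.
  destruct (ssrbool.elimT (@ssrbool.andP _ _) hj) as [h1 h2].
  apply (ssrbool.elimT ssrnat.leP) in h1; apply (ssrbool.elimT ssrnat.leP) in h2; lia.
Qed.
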